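(* Let $F$ be an algebraically closed field of characteristic $0$, let $A$ be a simple finite-dimensional Jordan superalgebra over $F$, let $\delta\in F$, and let $\phi$ be a non-trivial $\delta$-derivation of $A$. Then $\delta=\frac12$ and there exists $\alpha\in F$ such that $\phi(x)=\alpha x$ for every $x\in A$.
   Context: A superalgebra over $F$ is a $\mathbb{Z}_2$-graded (not necessarily associative) $F$-algebra $A=A_0\oplus A_1$, i.e. $A_iA_j\subseteq A_{i+j \bmod 2}$. Let $\Gamma=\Gamma_0+\Gamma_1$ be the Grassmann algebra over $F$ generated by $1,e_1,e_2,\dots$ with relations $e_i^2=0$, $e_ie_j=-e_je_i$, where $\Gamma_0$ and $\Gamma_1$ are spanned by the products of even and odd length respectively. The Grassmann envelope of $A$ is the subalgebra $\Gamma(A)=\Gamma_0\otimes A_0+\Gamma_1\otimes A_1$ of $\Gamma\otimes A$. A Jordan algebra is an algebra satisfying $xy=yx$ and $(x^2y)x=x^2(yx)$; the superalgebra $A$ is a Jordan superalgebra if $\Gamma(A)$ is a Jordan algebra. For $\delta\in F$, a $\delta$-derivation of $A$ is an $F$-linear map $\phi:A\to A$ (not assumed to respect the grading) with $\phi(xy)=\delta(x\phi(y)+\phi(x)y)$ for all $x,y\in A$. A $0$-derivation is a linear map $\phi:A\to A$ with $\phi(A^2)=0$. A non-trivial $\delta$-derivation is a $\delta$-derivation that is neither a $1$-derivation nor a $0$-derivation. *)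

(* Defs.v *)
From HB Require Import structures.
From mathcomp Require Import all_boot all_order all_algebra.
From mathcomp Require Import finmap.
From mathcomp.multinomials Require Import monalg.

Set Implicit Arguments.
Unset Strict Implicit.
Unset Printing Implicit Defensive.

Import GRing.Theory.
Local Open Scope ring_scope.
Local Open Scope fset_scope.

(* The Grassmann algebra Gamma on e_0, e_1, ... has as basis the monomials
   e_S = e_(i_1) ... e_(i_k), one for each finite set S = {i_1 < ... < i_k} of
   naturals (e_fset0 = 1). For an algebra V, Gamma (x) V is therefore the space
   of finitely supported families of elements of V indexed by finite sets,
   << v *g S >> standing for e_S (x) v. In particular Gamma is the case V = F. *)
Definition grassmann_tensor (V : zmodType) := {malg V[{fset nat}]}.

(* e_S e_T = grassmann_sign S T e_(S `|` T): 0 if S and T share a generator,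
   otherwise the sign of the number of transpositions sorting the product. *)
Definition grassmann_sign (F : fieldType) (S T : {fset nat}) : F :=
  if [disjoint S & T]%fset
  then (-1) ^+ (\sum_(i <- S) \sum_(j <- T) (j < i : nat))%N else 0.

Definition grassmann_tensor_mul (F : fieldType) (V : lmodType F)
    (m : V -> V -> V) (x y : grassmann_tensor V) : grassmann_tensor V :=
  \sum_(S <- msupp x) \sum_(T <- msupp y)
    << grassmann_sign F S T *: m x@_S y@_T *g S `|` T >>.

Definition grassmann (F : fieldType) := grassmann_tensor F.

Definition grassmann_mul (F : fieldType) : grassmann F -> grassmann F -> grassmann F :=
  @grassmann_tensor_mul F F^o *%R.

Definition grassmann_gen (F : fieldType) (i : nat) : grassmann F :=
  << 1 *g [fset i] >>.

Section Grassmann.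
Variable F : fieldType.
Implicit Types (S T U : {fset nat}) (i j : nat).

Lemma grassmann_tensor_mulU (V : lmodType F) (m : V -> V -> V) S T (v w : V) :
  (forall z, m 0 z = 0) -> (forall z, m z 0 = 0) ->
  grassmann_tensor_mul m << v *g S >> << w *g T >> =
  << grassmann_sign F S T *: m v w *g S `|` T >>.
Proof.
move=> m0l m0r; rewrite /grassmann_tensor_mul !msuppU.
have [->|_] := eqVneq v 0; first by rewrite big_seq_fset0 m0l scaler0 monalgU0.
rewrite big_seq_fset1.
have [->|_] := eqVneq w 0; first by rewrite big_seq_fset0 m0r scaler0 monalgU0.
by rewrite big_seq_fset1 !mcoeffUU.
Qed.

Lemma grassmann_mulU S T (a b : F) :
  grassmann_mul << a *g S >> << b *g T >> =
  << grassmann_sign F S T * (a * b) *g S `|` T >>.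
Proof.
by apply: (@grassmann_tensor_mulU F^o) => z; rewrite ?mul0r ?mulr0.
Qed.

Lemma grassmann_gen_sq i : grassmann_mul (grassmann_gen F i) (grassmann_gen F i) = 0.
Proof.
rewrite grassmann_mulU /grassmann_sign fdisjointX1 in_fset1 eqxx mul0r.
exact: monalgU0.
Qed.

Lemma grassmann_gen_anticomm i j :
  grassmann_mul (grassmann_gen F i) (grassmann_gen F j) =
  - grassmann_mul (grassmann_gen F j) (grassmann_gen F i).
Proof.
have [->|neq_ij] := eqVneq i j; first by rewrite grassmann_gen_sq oppr0.
rewrite !grassmann_mulU /grassmann_sign !fdisjointX1 !in_fset1.
rewrite neq_ij [j == i]eq_sym neq_ij !big_seq_fset1 -monalgUN fsetUC; congr << _ *g _ >>.
by rewrite !mulr1; case: ltngtP neq_ij => // _ _; rewrite ?expr0 ?expr1 ?opprK.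
Qed.

Lemma grassmann_mul_gen S i : (forall j, j \in S -> (j < i)%N) ->
  grassmann_mul << 1 *g S >> (grassmann_gen F i) = << 1 *g S `|` [fset i] >>.
Proof.
move=> ltSi; rewrite grassmann_mulU /grassmann_sign fdisjointX1.
have -> : i \notin S by apply/negP => /ltSi; rewrite ltnn.
rewrite big_seq big1 ?expr0 ?mulr1 // => j /ltSi lt_ji.
by rewrite big_seq_fset1 ltnNge ltnW.
Qed.

Lemma grassmann_signA S T U :
  grassmann_sign F S T * grassmann_sign F (S `|` T) U =
  grassmann_sign F T U * grassmann_sign F S (T `|` U).
Proof.
rewrite /grassmann_sign fdisjointUX fdisjointXU.
have [dST|] := boolP [disjoint S & T]%fset; last by rewrite !(mul0r, mulr0).
have [dTU|] := boolP [disjoint T & U]%fset;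
  last by rewrite andbF !(mul0r, mulr0).
have [dSU|] := boolP [disjoint S & U]%fset; last by rewrite !(mul0r, mulr0).
rewrite -!exprD; congr (_ ^+ _).
rewrite [X in (_ + X)%N](perm_big (S ++ T)) /=; last first.
  rewrite uniq_perm ?fset_uniq // ?cat_uniq ?fset_uniq ?andbT /=.
    by apply/hasPn => x xT /=; apply: contraL xT; move/fdisjointP: dST; apply.
  by move=> x; rewrite inE mem_cat.
rewrite big_cat /= addnA addnC; congr (_ + _)%N.
rewrite -big_split /=; apply: eq_bigr => i _.
rewrite [RHS](perm_big (T ++ U)) ?big_cat //=.
rewrite uniq_perm ?fset_uniq // ?cat_uniq ?fset_uniq ?andbT /=.
  by apply/hasPn => x xT /=; apply: contraL xT; move/fdisjointP: dTU; apply.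
by move=> x; rewrite inE mem_cat.
Qed.

End Grassmann.

(* A_i = superpart A (odd i): false is the even part, true the odd part. *)
Record superalgebra (F : fieldType) := Superalgebra {
  supercarrier :> vectType F;
  supermul : {bilinear supercarrier -> supercarrier -> supercarrier};
  superpart : bool -> {vspace supercarrier};
  superpart_full : (superpart false + superpart true)%VS = fullv;
  superpart_direct : (superpart false :&: superpart true)%VS = 0%VS;
  superpart_mul : forall (i j : bool) (x y : supercarrier),
    x \in superpart i -> y \in superpart j -> supermul x y \in superpart (i (+) j)
}.

Section Superalgebra.
Variables (F : fieldType) (A : superalgebra F).

Definition graded_ideal (I : {vspace A}) : Prop :=
  [/\ I = (I :&: superpart A false + I :&: superpart A true)%VS,
      forall a x : A, x \in I -> supermul A a x \in I
    & forall a x : A, x \in I -> supermul A x a \in I].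

Definition simple_superalgebra : Prop :=
  (exists x y : A, supermul A x y <> 0) /\
  (forall I : {vspace A}, graded_ideal I -> I = 0%VS \/ I = fullv).

Definition grassmann_envelope (x : grassmann_tensor A) : Prop :=
  forall S : {fset nat}, x@_S \in superpart A (odd #|` S|).

Lemma grassmann_envelope_mul x y :
  grassmann_envelope x -> grassmann_envelope y ->
  grassmann_envelope (grassmann_tensor_mul (supermul A) x y).
Proof.
move=> ex ey U; rewrite /grassmann_tensor_mul raddf_sum; apply: memv_suml => S _.
rewrite raddf_sum; apply: memv_suml => T _; rewrite /= mcoeffU.
have [<-|_] := eqVneq; last exact: mem0v.
rewrite mulr1n /grassmann_sign.
have [dST|_] := boolP [disjoint S & T]%fset; last by rewrite scale0r mem0v.
rewrite memvZ // cardfsU (eqP dST) cardfs0 subn0 oddD.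
exact: superpart_mul (ex S) (ey T).
Qed.

Definition delta_derivation (delta : F) (phi : {linear A -> A}) : Prop :=
  forall x y : A, phi (supermul A x y) =
    delta *: (supermul A x (phi y) + supermul A (phi x) y).

Definition zero_derivation (phi : {linear A -> A}) : Prop :=
  forall x y : A, phi (supermul A x y) = 0.

Definition nontrivial_delta_derivation (delta : F) (phi : {linear A -> A}) : Prop :=
  [/\ delta_derivation delta phi, ~ delta_derivation 1 phi & ~ zero_derivation phi].

End Superalgebra.

(* The product m, restricted to the subspace D stable under m, is a Jordan
   algebra product. *)
Definition jordan_on (T : Type) (D : T -> Prop) (m : T -> T -> T) : Prop :=
  (forall x y, D x -> D y -> m x y = m y x) /\
  (forall x y, D x -> D y -> m (m (m x x) y) x = m (m x x) (m y x)).

Definition jordan_superalgebra (F : fieldType) (A : superalgebra F) : Prop :=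
  jordan_on (@grassmann_envelope F A) (grassmann_tensor_mul (supermul A)).

(* Main.v *)
(* Since char F = 0, an Engel-type theorem for Jordan algebras shows that a simple A has an even idempotent
   e <> 0. If delta is not 0, 1/2 or 1, the Peirce decomposition of e forces every delta-superderivation to
   vanish; for delta = 1/4 this says that any two 1/2-superderivations supercommute.

   Let phi be an even 1/2-derivation. Its supercommutators with the inner superderivations [L_x, L_y] (when e is a
   unit), or with [L_e, L_x] and then [L_e, L_y] for x, y in P_(1/2) (otherwise), are 1/2-superderivations again. They
   are pairwise supercommuting and nilpotent, and their images span a graded ideal, so they vanish by simplicity.
   Hence phi(xy) = x phi(y), and phi is scalar because it has an eigenvector.

   An odd 1/2-derivation of A (without signs) satisfies phi(A_0) A_1 = 0, and vanishes because A has no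
   nonzero odd s with s A_1 = (A_0 s) A_1 = 0 and no nonzero element of P_(1/2) annihilating P_(1/2). *)
Require Import Defs.
From mathcomp Require Import all_boot all_order all_algebra.
From mathcomp Require Import finmap ring.
From mathcomp.multinomials Require Import monalg.
From Stdlib Require Import Classical.
Set Implicit Arguments. Unset Strict Implicit. Unset Printing Implicit Defensive.

Import GRing.Theory.
Local Open Scope ring_scope.

(** No classification of simple superalgebras enters: everything rests on one nonzero even
    idempotent, which need be neither primitive nor a unit. The first obstacle is that phi may
    ignore the grading. Conjugation by the grading automorphism splits it into an even part, which
    is a superderivation, and an odd part, which obeys the Leibniz rule without signs and so is not
    one. Supercommutators say nothing about the latter, hence its separate and more computational
    treatment. The number 1/4 appears because the supercommutator of a d- and a d'-superderivation
    is a d d'-superderivation. For the same reason a bracket with an inner superderivation (d = 1)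
    remains a 1/2-superderivation. These brackets are worth killing because they measure the defect
    between phi(x) y and x phi(y); once the defect is zero, the 1/2-rule becomes phi(xy) = x phi(y).
    The two cases need different brackets. With a unit, phi is multiplication by phi(e) and brackets
    are evaluated at e; without one, phi(e) controls phi on P_1 only, and P_(1/2) must serve as a
    faithful module on which to test equations. *)

Section Envelope.
Variables (F : fieldType) (V : lmodType F) (m : V -> V -> V).
Hypothesis mDl : forall x y z, m (x + y) z = m x z + m y z.
Hypothesis mDr : forall x y z, m x (y + z) = m x y + m x z.
Hypothesis m0l : forall z, m 0 z = 0.
Hypothesis m0r : forall z, m z 0 = 0.
Local Notation gm := (grassmann_tensor_mul m).

(** The supports of [x], [y] and [x + y] differ; summing over arbitrary larger sets of monomials
    makes additivity a termwise matter. *)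
Lemma gmulEw (D E : {fset {fset nat}}) (x y : grassmann_tensor V) :
  (msupp x `<=` D)%fset -> (msupp y `<=` E)%fset ->
  gm x y = \sum_(S <- D) \sum_(T <- E)
    << grassmann_sign F S T *: m x@_S y@_T *g (S `|` T)%fset >>.
Proof.
move=> xD yE; rewrite /grassmann_tensor_mul (big_fset_incl _ xD) => [|S _ Sx].
  apply: eq_bigr => S _; rewrite (big_fset_incl _ yE) // => T _ Ty.
  by rewrite (mcoeff_outdom Ty) m0r scaler0 monalgU0.
by rewrite big1 // => T _; rewrite (mcoeff_outdom Sx) m0l scaler0 monalgU0.
Qed.

Lemma gmulDl x y z : gm (x + y) z = gm x z + gm y z.
Proof.
rewrite (gmulEw (msuppD_le x y) (fsubset_refl (msupp z))).
rewrite (gmulEw (fsubsetUl (msupp x) (msupp y)) (fsubset_refl (msupp z))).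
rewrite (gmulEw (fsubsetUr (msupp x) (msupp y)) (fsubset_refl (msupp z))).
rewrite -big_split; apply: eq_bigr => S _; rewrite -big_split; apply: eq_bigr => T _.
by rewrite /= mcoeffD mDl scalerDr monalgUD.
Qed.

Lemma gmulDr x y z : gm x (y + z) = gm x y + gm x z.
Proof.
rewrite (gmulEw (fsubset_refl (msupp x)) (msuppD_le y z)).
rewrite (gmulEw (fsubset_refl (msupp x)) (fsubsetUl (msupp y) (msupp z))).
rewrite (gmulEw (fsubset_refl (msupp x)) (fsubsetUr (msupp y) (msupp z))).
rewrite -big_split; apply: eq_bigr => S _; rewrite -big_split; apply: eq_bigr => T _.
by rewrite /= mcoeffD mDr scalerDr monalgUD.
Qed.
End Envelope.

(** * Linearizations of the Jordan identity *)

Section Linearization.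
Variables (F : fieldType) (V : zmodType) (D : V -> Prop) (m : V -> V -> V).
Hypothesis two : 2%:R != 0 :> F.
Hypothesis sep : forall x y : V,
  (forall f : V -> F, (forall u v, f (u + v) = f u + f v) -> f x = f y) -> x = y.
Hypothesis mDl : forall x y z, m (x + y) z = m x z + m y z.
Hypothesis mDr : forall x y z, m x (y + z) = m x y + m x z.
Hypothesis DD : forall x y, D x -> D y -> D (x + y).
Hypothesis DM : forall x y, D x -> D y -> D (m x y).
Hypothesis mJ : jordan_on D m.

(** Polarization: the identity at x + y + z, minus those at the pair sums, plus those at the single
    elements, leaves twice the trilinear part. Additive maps to F separate points, so the
    bookkeeping is left to [ring]. *)
Lemma jordan_lin x y z w : D x -> D y -> D z -> D w ->
  m (m (m x y) w) z + m (m (m y z) w) x + m (m (m z x) w) y =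
  m (m x y) (m w z) + m (m y z) (m w x) + m (m z x) (m w y).
Proof.
case: mJ => mC jor Dx Dy Dz Dw.
have yx := mC _ _ Dy Dx; have zy := mC _ _ Dz Dy; have xz := mC _ _ Dx Dz.
have h1 := jor _ _ Dx Dw; have h2 := jor _ _ Dy Dw; have h3 := jor _ _ Dz Dw.
have h4 := jor _ _ (DD Dx Dy) Dw; have h5 := jor _ _ (DD Dy Dz) Dw.
have h6 := jor _ _ (DD Dx Dz) Dw; have h7 := jor _ _ (DD (DD Dx Dy) Dz) Dw.
rewrite !(mDl, mDr) ?yx ?zy ?xz in h4 h5 h6 h7.
apply: sep => f fD; apply: (mulfI two).
have add2 (a b c d : F) : a = b -> c = d -> a + c = b + d by move=> -> ->.
have sub2 (a b c d : F) : a = b -> c = d -> a - c = b - d by move=> -> ->.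
have := sub2 _ _ _ _ (congr1 f h7) (add2 _ _ _ _ (add2 _ _ _ _ (congr1 f h4) (congr1 f h5)) (congr1 f h6)).
move/add2/(_ (add2 _ _ _ _ (add2 _ _ _ _ (congr1 f h1) (congr1 f h2)) (congr1 f h3))).
rewrite !fD => /eqP; rewrite -subr_eq0 => /eqP e.
by apply/eqP; rewrite -subr_eq0 -{}e; apply/eqP; ring.
Qed.

(** By commutativity the right-hand side of [jordan_lin] is symmetric in its four arguments, so two
    of its left-hand sides can be equated. The outcome says that [L_x, L_y] is a derivation. *)
Lemma jordan_inner x y z w : D x -> D y -> D z -> D w ->
  m (m (m z w) y) x + m (m (m x z) y) w + m (m (m w x) y) z =
  m (m (m z w) x) y + m (m (m y z) x) w + m (m (m w y) x) z.
Proof.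
move=> Dx Dy Dz Dw; have h1 := jordan_lin Dy Dz Dw Dx; have h2 := jordan_lin Dx Dz Dw Dy.
have C a b : D a -> D b -> m a b = m b a by case: mJ => mC _; apply: mC.
rewrite [m _ x + m _ w]addrC h2 [m _ y + m _ w]addrC h1.
rewrite (C y x) // (C x w) // (C w y) // (C (m x z)) ?(C (m y z)); try exact: DM.
by rewrite addrC addrA addrAC.
Qed.

Lemma jordan_innerL x y z w : D x -> D y -> D z -> D w ->
  m x (m y (m z w)) + m (m y (m x z)) w + m z (m y (m x w)) =
  m y (m x (m z w)) + m (m x (m y z)) w + m z (m x (m y w)).
Proof.
move=> Dx Dy Dz Dw; have := jordan_inner Dx Dy Dz Dw.
have C a b : D a -> D b -> m a b = m b a by case: mJ => mC _; apply: mC.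
have [yz xz] := (DM Dy Dz, DM Dx Dz); have [yw xw] := (DM Dy Dw, DM Dx Dw).
have zw := DM Dz Dw.
rewrite (C w x) // (C w y) //.
rewrite (C (m (m z w) y)) ?(C (m (m z w) x)) ?(C (m z w) x) ?(C (m z w) y) //; try exact: DM.
rewrite (C (m (m x w) y)) ?(C (m (m y w) x)) ?(C (m x w) y) ?(C (m y w) x) //; try exact: DM.
by rewrite (C (m x z)) ?(C (m y z)).
Qed.

Lemma jordan_linL a b x w : D a -> D b -> D x -> D w ->
  m x (m (m a b) w) + m a (m (m b x) w) + m b (m (m a x) w) =
  m (m a b) (m x w) + m (m b x) (m a w) + m (m a x) (m b w).
Proof.
move=> Da Db Dx Dw; have := jordan_lin Da Db Dx Dw.
have C c d : D c -> D d -> m c d = m d c by case: mJ => mC _; apply: mC.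
rewrite (C x a) // !(C w) //.
rewrite (C (m (m a b) w)) ?(C (m (m b x) w)) ?(C (m (m a x) w)) //.
all: by do ?apply: DM.
Qed.
End Linearization.

(** * Signed identities on A from the Grassmann envelope *)

Definition odd_fset n (b : bool) : {fset nat} := if b then [fset n]%fset else fset0.

Lemma odd_card_odd_fset n b : odd #|` odd_fset n b| = b.
Proof. by case: b; rewrite /odd_fset ?cardfs1 ?cardfs0. Qed.

Section Sign.
Variable F : fieldType.
Local Notation sg := (grassmann_sign F).

Lemma grassmann_signUl (S S' T : {fset nat}) : [disjoint S & S']%fset ->
  sg (S `|` S')%fset T = sg S T * sg S' T.
Proof.
move=> dSS; rewrite /grassmann_sign fdisjointUX.
have [_|] := boolP [disjoint S & T]%fset; last by rewrite mul0r.
have [_|] := boolP [disjoint S' & T]%fset; last by rewrite mulr0.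
rewrite -exprD; congr (_ ^+ _).
rewrite (perm_big (S ++ S')) ?big_cat //= uniq_perm ?fset_uniq //.
  rewrite cat_uniq !fset_uniq andbT /=.
  by apply/hasPn => x xT /=; apply: contraL xT; move/fdisjointP: dSS; apply.
by move=> x; rewrite inE mem_cat.
Qed.

Lemma grassmann_signUr (S T T' : {fset nat}) : [disjoint T & T']%fset ->
  sg S (T `|` T')%fset = sg S T * sg S T'.
Proof.
move=> dTT; rewrite /grassmann_sign fdisjointXU.
have [_|] := boolP [disjoint S & T]%fset; last by rewrite mul0r.
have [_|] := boolP [disjoint S & T']%fset; last by rewrite mulr0.
rewrite -exprD -big_split; congr (_ ^+ _); apply: eq_bigr => i _ /=.
rewrite (perm_big (T ++ T')) ?big_cat //= uniq_perm ?fset_uniq //.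
  rewrite cat_uniq !fset_uniq andbT /=.
  by apply/hasPn => x xT /=; apply: contraL xT; move/fdisjointP: dTT; apply.
by move=> x; rewrite inE mem_cat.
Qed.

Lemma disjoint_odd_fset n p i j : n != p -> [disjoint odd_fset n i & odd_fset p j]%fset.
Proof.
case: i; case: j => np; rewrite /odd_fset ?fdisjoint0X ?fdisjointX0 //.
by rewrite fdisjointX1 inE eq_sym.
Qed.

Lemma grassmann_sign_odd_fset n p i j : n != p ->
  sg (odd_fset n i) (odd_fset p j) = (-1) ^+ [&& (p < n)%N, i & j].
Proof.
move=> np; rewrite /grassmann_sign disjoint_odd_fset //.
by case: i; case: j; rewrite /odd_fset ?andbF ?andbT ?(big_seq_fset0, big_seq_fset1) //= big_seq_fset0.
Qed.
End Sign.

(** Certificate format of the later computations: [c = d] is a combination of known identities, and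
    [a - b = c - d] is left to [ring] or [field]. *)
Lemma linear_combination (V : zmodType) (a b c d : V) : c = d -> a - b = c - d -> a = b.
Proof. by move=> ->; rewrite subrr => /eqP; rewrite subr_eq0 => /eqP. Qed.

Definition ssgn (F : fieldType) (i j : bool) : F := (-1) ^+ (i && j).

Section SuperIdentities.
Variables (F : fieldType) (A : superalgebra F).
Hypothesis two : 2%:R != 0 :> F.
Hypothesis jordanA : jordan_superalgebra A.
Local Notation "x ** y" := (supermul A x y) (at level 40, left associativity).
Local Notation gm := (grassmann_tensor_mul (supermul A)).
Local Notation E := odd_fset.

(** Coordinates are linear forms. Under an arbitrary linear form the nonassociative monomials of an
    equation in A become atoms in F, and [ring] applies. *)
Lemma vect_sep (x y : A) : (forall f : A -> F, (forall u v, f (u + v) = f u + f v) ->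
  (forall a u, f (a *: u) = a * f u) -> f x = f y) -> x = y.
Proof.
move=> h; rewrite (coord_vbasis (memvf x)) (coord_vbasis (memvf y)).
apply: eq_bigr => i _; congr (_ *: _).
by apply: h => [u v|a u]; [exact: linearD | exact: linearZ].
Qed.

Lemma envelope_sep (x y : grassmann_tensor A) : (forall f : grassmann_tensor A -> F,
  (forall u v, f (u + v) = f u + f v) -> f x = f y) -> x = y.
Proof.
move=> h; apply/malgP => S; apply: vect_sep => f fD _.
by apply: (h (fun u => f u@_S)) => u v; rewrite mcoeffD fD.
Qed.

Lemma envelopeD (x y : grassmann_tensor A) :
  grassmann_envelope x -> grassmann_envelope y -> grassmann_envelope (x + y).
Proof. by move=> ex ey S; rewrite mcoeffD memvD. Qed.

(* (S, v) stands for e_S (x) v; homogeneous elements are tested on distinct odd generators. *)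
Definition monomial (p : {fset nat} * A) : grassmann_tensor A := << p.2 *g p.1 >>.
Definition monomial_mul (p q : {fset nat} * A) :=
  ((p.1 `|` q.1)%fset, grassmann_sign F p.1 q.1 *: (p.2 ** q.2)).
Definition odd_lift n i (x : A) := monomial (E n i, x).

Lemma monomialM p q : gm (monomial p) (monomial q) = monomial (monomial_mul p q).
Proof. by apply: grassmann_tensor_mulU => z; rewrite ?linear0l ?linear0r. Qed.

Lemma monomial_coeff p S : p.1 = S -> (monomial p)@_S = p.2.
Proof. by move=> <-; rewrite mcoeffU eqxx mulr1n. Qed.

Lemma odd_lift_envelope n i x : x \in superpart A i -> grassmann_envelope (odd_lift n i x).
Proof.
move=> xi S; rewrite mcoeffU; have [<-|_] := eqVneq; last exact: mem0v.
by rewrite odd_card_odd_fset mulr1n.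
Qed.

Let smDl (x y z : A) : (x + y) ** z = x ** z + y ** z. Proof. exact: linearDl. Qed.
Let smDr (x y z : A) : x ** (y + z) = x ** y + x ** z. Proof. exact: linearDr. Qed.
Let sm0l (z : A) : 0 ** z = 0. Proof. exact: linear0l. Qed.
Let sm0r (z : A) : z ** 0 = 0. Proof. exact: linear0r. Qed.
Let smZl a (x y : A) : (a *: x) ** y = a *: (x ** y). Proof. exact: linearZl. Qed.
Let smZr a (x y : A) : x ** (a *: y) = a *: (x ** y). Proof. exact: linearZr. Qed.

Lemma supercomm i j x y : x \in superpart A i -> y \in superpart A j ->
  x ** y = ssgn F i j *: (y ** x).
Proof.
move=> xi yj; case: jordanA => gC _.
have /malgP/(_ (E 1 i `|` E 0 j)%fset) :=
  gC _ _ (odd_lift_envelope 1 xi) (odd_lift_envelope 0 yj).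
rewrite /odd_lift !monomialM !monomial_coeff //= 1?fsetUC // !grassmann_sign_odd_fset //.
move/(congr1 ( *:%R (ssgn F i j))); rewrite scalerA /ssgn -exprD addnn -mul2n exprM sqrrN.
by rewrite !expr1n /= expr0 !scale1r.
Qed.

(** The coefficient of [jordan_innerL] at the union of the four lifted generators; reordering the
    generators produces the signs. It is the super Leibniz rule for [L_x, L_y]. *)
Lemma superinner i j k l x y z w : x \in superpart A i -> y \in superpart A j ->
  z \in superpart A k -> w \in superpart A l ->
  x ** (y ** (z ** w)) - ssgn F i j *: (y ** (x ** (z ** w))) =
  (x ** (y ** z) - ssgn F i j *: (y ** (x ** z))) ** w
  + ssgn F k (i (+) j) *: (z ** (x ** (y ** w) - ssgn F i j *: (y ** (x ** w)))).
Proof.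
move=> xi yj zk wl.
have := jordan_innerL two envelope_sep (gmulDl smDl sm0l sm0r) (gmulDr smDr sm0l sm0r)
  envelopeD (@grassmann_envelope_mul F A) jordanA (odd_lift_envelope 0 xi)
  (odd_lift_envelope 1 yj) (odd_lift_envelope 2 zk) (odd_lift_envelope 3 wl).
rewrite /odd_lift; move: monomialM monomial_coeff; move: monomial => lift liftM lift_coeff.
rewrite !liftM; move/malgP/(_ (E 0 i `|` (E 1 j `|` (E 2 k `|` E 3 l)))%fset).
rewrite !mcoeffD !lift_coeff /=; try by apply/fsetP => t; rewrite !inE; do !case: (t \in _).
rewrite !smZl !smZr.
rewrite !(grassmann_signUr, grassmann_signUl) ?fdisjointXU ?fdisjointUX ?disjoint_odd_fset //.
rewrite !grassmann_sign_odd_fset //= !scalerA => h.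
apply: vect_sep => f fD fZ; move: (congr1 f h); rewrite /ssgn.
have fN u : f (- u) = - f u by rewrite -scaleN1r fZ mulN1r.
rewrite !(smDl, smDr, smZl, smZr, linearNl, linearNr) !(fD, fZ, fN).
move=> e; apply: (linear_combination e).
by case: i {xi h e}; case: j {yj}; case: k {zk}; rewrite /= ?expr0 ?expr1; ring.
Qed.

(** For even a and b no sign survives, since x precedes w in every term; so x and w need not be
    homogeneous. *)
Lemma superjordan_even a b x w : a \in superpart A false -> b \in superpart A false ->
  x ** (a ** b ** w) + a ** (b ** x ** w) + b ** (a ** x ** w) =
  (a ** b) ** (x ** w) + (b ** x) ** (a ** w) + (a ** x) ** (b ** w).
Proof.
move=> a0 b0.
suff hom i l (u v : A) : u \in superpart A i -> v \in superpart A l ->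
    u ** (a ** b ** v) + a ** (b ** u ** v) + b ** (a ** u ** v) =
    (a ** b) ** (u ** v) + (b ** u) ** (a ** v) + (a ** u) ** (b ** v).
  have dec (u : A) : exists u0 u1, [/\ u0 \in superpart A false, u1 \in superpart A true & u = u0 + u1].
    have := memvf u; rewrite -superpart_full => /memv_addP[u0 u0A [u1 u1A ->]].
    by exists u0, u1.
  have [x0 [x1 [x0A x1A ->]]] := dec x; have [w0 [w1 [w0A w1A ->]]] := dec w.
  move: (hom _ _ _ _ x0A w0A) (hom _ _ _ _ x0A w1A) (hom _ _ _ _ x1A w0A) (hom _ _ _ _ x1A w1A).
  move=> h00 h01 h10 h11; apply: vect_sep => f fD fZ.
  move: (congr1 f h00) (congr1 f h01) (congr1 f h10) (congr1 f h11).
  rewrite !(smDl, smDr) !fD => e00 e01 e10 e11.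
  apply: (linear_combination (congr2 +%R (congr2 +%R e00 e01) (congr2 +%R e10 e11))).
  by ring.
move=> ui vl.
have := jordan_linL two envelope_sep (gmulDl smDl sm0l sm0r) (gmulDr smDr sm0l sm0r)
  envelopeD (@grassmann_envelope_mul F A) jordanA (odd_lift_envelope 0 a0)
  (odd_lift_envelope 1 b0) (odd_lift_envelope 2 ui) (odd_lift_envelope 3 vl).
rewrite /odd_lift; move: monomialM monomial_coeff; move: monomial => lift liftM lift_coeff.
rewrite !liftM; move/malgP/(_ (E 2 i `|` E 3 l)%fset).
rewrite !mcoeffD !lift_coeff /= ?(fset0U, fsetU0) // !smZl !smZr.
have sg0l S : grassmann_sign F fset0 S = 1.
  by rewrite /grassmann_sign fdisjoint0X big_seq_fset0.
have sg0r S : grassmann_sign F S fset0 = 1.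
  by rewrite /grassmann_sign fdisjointX0 big1 // => t _; rewrite big_seq_fset0.
by rewrite !(sg0l, sg0r) !grassmann_sign_odd_fset //= !expr0 !scale1r.
Qed.
End SuperIdentities.

(** * Graded linear algebra *)

Section PolySum.
Variables (F : fieldType) (V : lmodType F).
(** The value of p on a sequence that plays the role of powers: iterates of an operator, or powers
    of an element of an algebra without unit. *)
Definition poly_sum (u : nat -> V) (p : {poly F}) := \sum_(i < size p) p`_i *: u i.

Lemma poly_sumE N u (p : {poly F}) : (size p <= N)%N -> poly_sum u p = \sum_(i < N) p`_i *: u i.
Proof.
move=> pN; rewrite /poly_sum (big_ord_widen N (fun i => p`_i *: u i) pN) big_mkcond.
by apply: eq_bigr => i _; case: ltnP => // /(nth_default 0)->; rewrite scale0r.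
Qed.

Lemma poly_sum0 u : poly_sum u 0 = 0.
Proof. by rewrite /poly_sum size_poly0 big_ord0. Qed.

Lemma poly_sumD u (p q : {poly F}) : poly_sum u (p + q) = poly_sum u p + poly_sum u q.
Proof.
pose N := maxn (size p) (size q).
rewrite !(@poly_sumE N) ?leq_maxl ?leq_maxr ?size_polyD // -big_split; apply: eq_bigr => i _.
by rewrite coefD scalerDl.
Qed.

Lemma poly_sumZ u c (p : {poly F}) : poly_sum u (c *: p) = c *: poly_sum u p.
Proof.
rewrite (@poly_sumE (size p)) ?size_scale_leq // scaler_sumr; apply: eq_bigr => i _.
by rewrite coefZ scalerA.
Qed.

Lemma poly_sumX u (p : {poly F}) : poly_sum u (p * 'X) = poly_sum (fun i => u i.+1) p.
Proof.
have [->|p0] := eqVneq p 0; first by rewrite mul0r !poly_sum0.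
rewrite (@poly_sumE (size p).+1); last by rewrite size_mulX.
rewrite big_ord_recl coefMX eqxx scale0r add0r; apply: eq_bigr => i _.
by rewrite coefMX.
Qed.

Lemma poly_sumC u c : poly_sum u c%:P = c *: u 0%N.
Proof. by rewrite (@poly_sumE 1%N) ?size_polyC ?leq_b1 // big_ord1 coefC. Qed.

End PolySum.

Lemma linear_dependence (F : fieldType) (V : vectType F) (u : nat -> V) : exists2 p : {poly F}, p != 0 & poly_sum u p = 0.
Proof.
pose N := (dim V).+1; pose X := [tuple of mkseq u N].
have : ~~ free X.
  by apply/negP; rewrite /free => /eqP fX; have := dimvS (subvf <<X>>%VS); rewrite fX dimvf size_tuple ltnn.
move=> /freeP nf; have [k [k0 nk]] : exists k : 'I_N -> F,
    \sum_i k i *: X`_i = 0 /\ ~ (forall i, k i = 0).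
  by apply: NNPP => h; apply: nf => k k0; apply: NNPP => /not_all_ex_not nk; apply: h; exists k;
    split=> // /[dup] kk; case: nk => i; rewrite kk.
pose p := \poly_(i < N) k (inord i).
have pk (i : 'I_N) : p`_i = k i by rewrite coef_poly ltn_ord inord_val.
exists p; first by apply/eqP => p0; apply: nk => i; rewrite -pk p0 coef0.
rewrite (poly_sumE _ (size_poly _ _)) -[RHS]k0; apply: eq_bigr => i _ /=.
by rewrite -pk nth_mkseq.
Qed.

Section Graded.
Variables (F : fieldType) (A : superalgebra F).
Hypothesis two : 2%:R != 0 :> F.
Hypothesis jordanA : jordan_superalgebra A.
Notation "x ** y" := (supermul A x y) (at level 40, left associativity).
Notation half := (2%:R^-1 : F).
Local Notation part := (superpart A).

Lemma smDl (x y z : A) : (x + y) ** z = x ** z + y ** z. Proof. exact: linearDl. Qed.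
Lemma smDr (x y z : A) : x ** (y + z) = x ** y + x ** z. Proof. exact: linearDr. Qed.
Lemma sm0l (z : A) : 0 ** z = 0. Proof. exact: linear0l. Qed.
Lemma sm0r (z : A) : z ** 0 = 0. Proof. exact: linear0r. Qed.
Lemma smZl a (x y : A) : (a *: x) ** y = a *: (x ** y). Proof. exact: linearZl. Qed.
Lemma smZr a (x y : A) : x ** (a *: y) = a *: (x ** y). Proof. exact: linearZr. Qed.
Lemma smNl (x y : A) : (- x) ** y = - (x ** y). Proof. exact: linearNl. Qed.
Lemma smNr (x y : A) : x ** (- y) = - (x ** y). Proof. exact: linearNr. Qed.
Definition smE := (smDl, smDr, smZl, smZr, smNl, smNr, sm0l, sm0r).

Lemma lin0 (f : A -> F) : (forall a u, f (a *: u) = a * f u) -> f 0 = 0.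
Proof. by move=> fZ; rewrite -(scale0r 0) fZ mul0r. Qed.
Lemma linN (f : A -> F) : (forall a u, f (a *: u) = a * f u) -> forall u, f (- u) = - f u.
Proof. by move=> fZ u; rewrite -scaleN1r fZ mulN1r. Qed.
Lemma linMn (f : A -> F) : (forall u v, f (u + v) = f u + f v) ->
  (forall a u, f (a *: u) = a * f u) -> forall u n, f (u *+ n) = f u *+ n.
Proof.
by move=> fD fZ u; elim=> [|n IH]; rewrite ?mulr0n ?(lin0 fZ) // !mulrS fD IH.
Qed.

Lemma ssgnC i j : ssgn F i j = ssgn F j i. Proof. by rewrite /ssgn andbC. Qed.
Lemma ssgn_sq i j : ssgn F i j * ssgn F i j = 1.
Proof. by rewrite /ssgn -expr2 sqrr_sign. Qed.

Definition even_odd i : 'End(A) := daddv_pi (part i) (part (~~ i)).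
Local Notation pr := even_odd.

Lemma part_cap i : (part i :&: part (~~ i) = 0)%VS.
Proof. by case: i; rewrite /= ?(capvC (part true)) superpart_direct. Qed.

Lemma prP i x : pr i x \in part i. Proof. exact: memv_pi. Qed.

Lemma pr_dec x : x = pr false x + pr true x.
Proof.
rewrite /even_odd daddv_pi_add //; first exact: (part_cap false).
by rewrite superpart_full memvf.
Qed.

Lemma pr_id i x : x \in part i -> pr i x = x.
Proof. exact/daddv_pi_id/part_cap. Qed.

Lemma pr_neq i x : x \in part i -> pr (~~ i) x = 0.
Proof.
move=> xi; have := pr_dec x; rewrite -{1}(pr_id xi).
by case: i xi => /= _ /eqP; [rewrite -subr_eq subrr|rewrite -subr_eq0 opprD addrA subrr sub0r oppr_eq0]
  => /eqP.
Qed.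

Lemma part_disj i x : x \in part i -> x \in part (~~ i) -> x = 0.
Proof. by move=> xi /pr_id <-; apply: pr_neq. Qed.

(** The r-th power of the grading automorphism: the sign of an operator of parity r moving past x,
    written without assuming x homogeneous. *)
Definition sigma (r : bool) : 'End(A) := pr false + (-1) ^+ r *: pr true.

Lemma sigma_hom r i x : x \in part i -> sigma r x = ssgn F r i *: x.
Proof.
rewrite add_lfunE scale_lfunE /ssgn; case: i => xi /=.
  by rewrite (pr_neq xi) add0r (pr_id xi); case: r.
by rewrite (pr_neq xi) scaler0 addr0 (pr_id xi) andbF scale1r.
Qed.

Lemma sigma0 x : sigma false x = x.
Proof. by rewrite add_lfunE scale_lfunE scale1r -pr_dec. Qed.

Lemma hom_eq (f g : 'End(A)) : (forall i x, x \in part i -> f x = g x) -> forall x, f x = g x.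
Proof. by move=> h x; rewrite (pr_dec x) !linearD /= !(h _ _ (prP _ _)). Qed.

Definition lmul x : 'End(A) := linfun (supermul A x).
Lemma lmulE x y : lmul x y = x ** y. Proof. by rewrite lfunE. Qed.

Lemma comm_sigma j x y : y \in part j -> y ** x = sigma j x ** y.
Proof.
move=> yj; rewrite (pr_dec x) !smDr linearD /= smDl.
by congr (_ + _); rewrite (sigma_hom _ (prP _ _)) smZl; apply: supercomm => //; apply: prP.
Qed.

Lemma comm_even x y : y \in part false -> y ** x = x ** y.
Proof. by move/comm_sigma->; rewrite sigma0. Qed.

Definition parity (r : bool) (f : 'End(A)) := forall i x, x \in part i -> f x \in part (i (+) r).

(* A delta-superderivation when r is the parity of f, and a delta-derivation of A when r = false. *)
Definition tder (delta : F) (r : bool) (f : 'End(A)) :=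
  forall x y, f (x ** y) = delta *: (f x ** y + sigma r x ** f y).

Lemma tder_hom delta r (f : 'End(A)) : (forall k l x y, x \in part k -> y \in part l ->
  f (x ** y) = delta *: (f x ** y + ssgn F r k *: (x ** f y))) -> tder delta r f.
Proof.
move=> h x y; rewrite {1}(pr_dec x) {1}(pr_dec y) !smE !linearD /=.
rewrite !(h _ _ _ _ (prP _ _) (prP _ _)).
rewrite [in RHS](pr_dec x) [in RHS](pr_dec y) !linearD /= !smE !(sigma_hom _ (prP _ _)) !smZl.
apply: vect_sep => phi fD fZ; rewrite !(fD, fZ); ring.
Qed.

Definition scomm (r s : bool) (f g : 'End(A)) : 'End(A) := (f \o g - ssgn F r s *: (g \o f))%VF.

Lemma scommE r s f g x : scomm r s f g x = f (g x) - ssgn F r s *: g (f x).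
Proof. by rewrite add_lfunE opp_lfunE scale_lfunE !comp_lfunE. Qed.

Definition inner i j x y := scomm i j (lmul x) (lmul y).

Lemma innerE i j x y z : inner i j x y z = x ** (y ** z) - ssgn F i j *: (y ** (x ** z)).
Proof. by rewrite scommE !lmulE. Qed.

Lemma inner_tder i j x y : x \in part i -> y \in part j -> tder 1 (i (+) j) (inner i j x y).
Proof.
move=> xi yj; apply: tder_hom => k l z w zk wl; rewrite scale1r !innerE.
by rewrite (superinner two jordanA xi yj zk wl) (ssgnC k).
Qed.

Lemma sm_part i j x y : x \in part i -> y \in part j -> x ** y \in part (i (+) j).
Proof. exact: superpart_mul. Qed.

Lemma inner_parity i j x y : x \in part i -> y \in part j -> parity (i (+) j) (inner i j x y).
Proof.
move=> xi yj k z zk; rewrite innerE rpredB ?rpredZ //.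
  by have := sm_part xi (sm_part yj zk); rewrite addbA addbC.
by have := sm_part yj (sm_part xi zk); rewrite addbCA addbA addbC.
Qed.

Lemma scomm_parity r s f g : parity r f -> parity s g -> parity (r (+) s) (scomm r s f g).
Proof.
move=> fr gs i x xi; rewrite scommE rpredB ?rpredZ //.
  by rewrite addbA addbAC; apply/fr/gs.
by rewrite addbA; apply/gs/fr.
Qed.

Lemma sigma_parity r s (f : 'End(A)) x : parity s f -> sigma r (f x) = ssgn F r s *: f (sigma r x).
Proof.
move=> fs; suff: forall x, (sigma r \o f)%VF x = (ssgn F r s *: (f \o sigma r))%VF x.
  by move/(_ x); rewrite !(comp_lfunE, scale_lfunE).
apply: hom_eq => i {}x xi; rewrite scale_lfunE !comp_lfunE (sigma_hom _ xi).
rewrite (sigma_hom _ (fs _ _ xi)) linearZ scalerA; congr (_ *: _).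
by rewrite /ssgn; case: r; case: s {fs}; case: i {xi} => /=; rewrite !(expr0, expr1); ring.
Qed.

Lemma sigmaC r s x : sigma r (sigma s x) = sigma s (sigma r x).
Proof.
suff: forall x, (sigma r \o sigma s)%VF x = (sigma s \o sigma r)%VF x by move/(_ x); rewrite !comp_lfunE.
apply: hom_eq => i {}x xi.
by rewrite !comp_lfunE !(sigma_hom _ xi) !linearZ /= !(sigma_hom _ xi) !scalerA mulrC.
Qed.

Lemma sigmaD r s x : sigma (r (+) s) x = sigma r (sigma s x).
Proof.
suff: forall x, sigma (r (+) s) x = (sigma r \o sigma s)%VF x by move/(_ x); rewrite !comp_lfunE.
apply: hom_eq => i {}x xi.
rewrite !comp_lfunE !(sigma_hom _ xi) !linearZ /= !(sigma_hom _ xi) !scalerA; congr (_ *: _).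
by rewrite /ssgn; case: r; case: s; case: i {xi} => /=; rewrite !(expr0, expr1); ring.
Qed.

(** The cross terms, in which one operator falls on each factor, cancel; the two remaining terms
    carry the factor d d'. *)
Lemma scomm_tder d d' r s f g : parity r f -> parity s g -> tder d r f -> tder d' s g ->
  tder (d * d') (r (+) s) (scomm r s f g).
Proof.
move=> fr gs df dg x y; rewrite !scommE dg df !linearZ !linearD /= !df !dg.
rewrite (sigma_parity _ _ fr) (sigma_parity _ _ gs) sigmaD (sigmaC s r).
apply: vect_sep => phi fD fZ; have fN := linN fZ; rewrite !(fD, fZ, fN, smE).
rewrite (ssgnC s r).
have := ssgn_sq r s.
move: (ssgn F r s) => t tt.
apply: (linear_combination (congr1 ( *%R (d * d' * phi (f (sigma s x) ** g y))) (esym tt))).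
by ring.
Qed.

Definition linear_pred (P : A -> Prop) := P 0 /\ forall a x y, P x -> P y -> P (a *: x + y).

(** A subspace inside P can be enlarged by a vector of P only as often as the dimension allows.
    Classical reasoning thus turns undecidable linear conditions into subspaces. *)
Lemma linear_pred_vspace P : linear_pred P -> exists U : {vspace A}, forall x, x \in U <-> P x.
Proof.
move=> [P0 PD].
suff: forall n (U : {vspace A}), (\dim {:A} - \dim U <= n)%N -> (forall x, x \in U -> P x) ->
    exists U : {vspace A}, forall x, x \in U <-> P x.
  by move/(_ _ 0%VS (leqnn _)); apply=> x; rewrite memv0 => /eqP->.
elim=> [|n IH] U Un UP.
  have /eqP fU : U == fullv.
    by rewrite eqEdim subvf; rewrite leqn0 subn_eq0 in Un.
  by exists U => x; split=> [/UP//|_]; rewrite fU memvf.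
have [h|] := classic (forall x, P x -> x \in U).
  by exists U => x; split; [apply: UP | apply: h].
move/not_all_ex_not; case=> x nx; have [Px /negP xU] := imply_to_and _ _ nx.
apply: (IH (U + <[x]>)%VS).
  have lt : (\dim U < \dim (U + <[x]>))%N.
    rewrite ltn_neqAle dimvS ?addvSl // andbT; apply: contra xU => /eqP e.
    have /eqP -> : U == (U + <[x]>)%VS by rewrite eqEdim addvSl e leqnn.
    by have := memv_add (mem0v U) (memv_line x); rewrite add0r.
  by rewrite -ltnS; apply: leq_trans Un; apply: ltn_sub2l => //; apply: leq_trans lt (dimvS (subvf _)).
by move=> y /memv_addP[u uU [v /vlineP[a ->] ->]]; rewrite addrC; apply/PD => //; apply: UP.
Qed.

(** * Consequences of simplicity *)

Hypothesis simpleA : simple_superalgebra A.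

(** Left multiplications suffice: by supercommutativity a right multiple of a homogeneous element is
    a left multiple by a [sigma]-twist. *)
Lemma ideal_pred (P : A -> Prop) : linear_pred P -> (forall i x, P x -> P (pr i x)) ->
  (forall a x, P x -> P (a ** x)) -> (forall x, P x -> x = 0) \/ (forall x, P x).
Proof.
move=> PL Ppr PM; have [U UP] := linear_pred_vspace PL; case: PL => P0 PD.
suff /(simpleA.2) [U0|Uf] : graded_ideal U.
- by left=> x /UP; rewrite U0 memv0 => /eqP.
- by right=> x; apply/UP; rewrite Uf memvf.
split.
- apply/vspaceP => x; apply/idP/memv_addP => [xU|[u uU [v vU ->]]].
    exists (pr false x); first by rewrite memv_cap prP andbT; apply/UP/Ppr/UP.
    exists (pr true x); last exact: pr_dec.
    by rewrite memv_cap prP andbT; apply/UP/Ppr/UP.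
  by rewrite memvD //; [move: uU | move: vU]; rewrite memv_cap => /andP[].
- by move=> a x /UP Px; apply/UP/PM.
- move=> a x /UP Px; apply/UP; rewrite (pr_dec x) smDl !(comm_sigma _ (prP _ _)).
  have PDD y z : P y -> P z -> P (y + z) by move=> Py Pz; rewrite -[y]scale1r; apply: PD.
  apply: PDD; last exact/PM/Ppr.
  exact/PM/Ppr.
Qed.

(** The span of all products is a graded ideal, nonzero since the multiplication is. [Q] describes
    this span as the intersection of all linear predicates that contain the products. *)
Lemma sm_full (P : A -> Prop) : linear_pred P -> (forall x y, P (x ** y)) -> forall x, P x.
Proof.
move=> [P0 PD] PM.
pose Q x := forall R : A -> Prop, linear_pred R -> (forall x y, R (x ** y)) -> R x.
have QL : linear_pred Q.
  by split=> [R [] // | a x y Qx Qy R RL RM]; apply: (RL.2); [apply: Qx | apply: Qy].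
have [] := ideal_pred QL.
- move=> i x Qx R [R0 RD] RM; apply: (Qx (fun x => R (pr i x))).
    split; first by rewrite linear0.
    by move=> a u v; rewrite linearP; apply: RD.
  have RDD y z : R y -> R z -> R (y + z) by move=> Ry Rz; rewrite -[y]scale1r; apply: RD.
  move=> u v; have hom k l u' v' : u' \in part k -> v' \in part l -> R (pr i (u' ** v')).
    move=> uk vl; have := sm_part uk vl; have [<-|] := eqVneq (k (+) l) i.
      by move/pr_id->.
    by move/negPf=> ne kl; rewrite -[i]negbK (_ : ~~ i = k (+) l) ?pr_neq //; case: i k l ne {kl uk vl} => [] [] [].
  rewrite (pr_dec u) (pr_dec v) !smE !linearD /=.
  by apply: (RDD); apply: (RDD); exact: (hom _ _ _ _ (prP _ _) (prP _ _)).
- by move=> a x _ R _; apply.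
- case: simpleA => [[x [y xy]] _] Q0; case: xy; apply: Q0 => R _; exact.
- by move=> + x; move/(_ x); apply.
Qed.

Inductive op_span (K : bool -> 'End(A) -> Prop) : A -> Prop :=
| op_span0 : op_span K 0
| op_spanP a x y : op_span K x -> op_span K y -> op_span K (a *: x + y)
| op_span_gen r k z : K r k -> op_span K (k z).

Definition nilpotent (f : 'End(A)) := exists n, forall x, iter n f x = 0.

Lemma nilpotent_img (f : 'End(A)) (W : {vspace A}) : nilpotent f -> (W <= f @: W)%VS -> W = 0%VS.
Proof.
move=> [n fn] Wf; apply/vspaceP => x; rewrite memv0; apply/idP/eqP => [xW|->]; last exact: mem0v.
suff: forall m, exists2 y, y \in W & x = iter m f y by move/(_ n) => [y _ ->].
elim=> [|m [y yW ->]]; first by exists x.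
have /(subvP Wf) /memv_imgP[z zW ->] := yW.
by exists z; rewrite // iterSr.
Qed.

(* A maximal nonzero product v of elements of K kills K(A), whose span is an ideal. *)
Lemma nil_supercommuting_ideal (K : bool -> 'End(A) -> Prop) :
  (forall r k, K r k -> parity r k) ->
  (forall r s k l, K r k -> K s l -> scomm r s k l = 0) ->
  (forall r k, K r k -> nilpotent k) ->
  (forall r k y z, K r k -> op_span K (y ** k z)) ->
  forall r k, K r k -> k = 0.
Proof.
move=> Kpar Kcomm Knil Kmul r0 k0 Kk0.
have [| | |h|h] := @ideal_pred (op_span K).
- by split; [apply: op_span0 | move=> a x y; apply: op_spanP].
- move=> i x; elim=> [|a {}x y _ h1 _ h2|r k z Kk]; first by rewrite linear0; apply: op_span0.
    by rewrite linearP; apply: op_spanP.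
  have kp := Kpar _ _ Kk; suff -> : pr i (k z) = k (pr (i (+) r) z) by apply: op_span_gen Kk.
  rewrite {1}(pr_dec z) !linearD /=.
  have e j : pr (j (+) r) (k (pr j z)) = k (pr j z) by apply/pr_id/kp/prP.
  have e' j : pr (~~ (j (+) r)) (k (pr j z)) = 0 by apply/pr_neq/kp/prP.
  case: i; case: r Kk kp e e' => Kk kp e e' /=; rewrite ?(e true) ?(e false) ?(e' true) ?(e' false);
   by rewrite ?add0r ?addr0.
- move=> a x; elim=> [|b {}x y _ h1 _ h2|r k z Kk]; first by rewrite sm0r; apply: op_span0.
    by rewrite smDr smZr; apply: op_spanP.
  exact: Kmul Kk.
- by apply/lfunP => z; rewrite lfunE; apply: h; apply: op_span_gen Kk0.
have [v v0 vK] : exists2 v : 'End(A), v != 0 & forall r k, K r k -> (v \o k)%VF = 0.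
  (* Induction on the rank of a product v, which commutes with K up to scalars. A nonzero [v \o k]
     has smaller rank: otherwise the nilpotent k would map the image of v onto itself. *)
  suff: forall n (v : 'End(A)), (\dim (limg v) <= n)%N -> v != 0 ->
      (forall r k, K r k -> exists c, (v \o k = c *: (k \o v))%VF) ->
      exists2 v : 'End(A), v != 0 & forall r k, K r k -> (v \o k)%VF = 0.
    move/(_ _ \1%VF (leqnn _)); apply.
      case: simpleA => [[x [y xy]] _]; apply/eqP => e; apply: xy.
      by rewrite -[_ ** _]id_lfunE e zero_lfunE.
    by move=> r k _; exists 1; rewrite comp_lfun1l comp_lfun1r scale1r.
  elim=> [|n IH] v vn v0 vK.
    case/eqP: v0; apply/lfunP => x; have := memv_img v (memvf x).
    by move: vn; rewrite leqn0 dimv_eq0 => /eqP->; rewrite memv0 zero_lfunE => /eqP.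
  have [h'|] := classic (forall r k, K r k -> (v \o k)%VF = 0); first by exists v.
  move/not_all_ex_not; case=> r /not_all_ex_not; case=> k nk.
  have [Kk /eqP vk0] := imply_to_and _ _ nk.
  have sub : (limg (v \o k)%VF <= limg v)%VS by rewrite limg_comp limgS // subvf.
  apply: (IH (v \o k)%VF) => //.
    rewrite -ltnS; apply: leq_trans vn; rewrite ltn_neqAle dimvS // andbT.
    apply: contra v0 => /eqP e.
    have {}e : limg (v \o k)%VF = limg v by apply/eqP; rewrite eqEdim sub e leqnn.
    have [c vkc] := vK _ _ Kk.
    have W0 : limg v = 0%VS.
      apply: (nilpotent_img (Knil _ _ Kk)); rewrite -{1}e; apply/subvP => y /memv_imgP[x _ ->].
      by rewrite vkc scale_lfunE comp_lfunE memvZ // memv_img // memv_img // memvf.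
    apply/eqP/lfunP => x; have := memv_img v (memvf x).
    by rewrite W0 memv0 zero_lfunE => /eqP.
  move=> s l Kl; have [c vlc] := vK _ _ Kl.
  have /eqP := Kcomm _ _ _ _ Kk Kl; rewrite /scomm subr_eq0 => /eqP kl.
  exists (ssgn F r s * c); apply/lfunP => x; rewrite scale_lfunE !comp_lfunE.
  have := congr1 (fun f : 'End(A) => v (f x)) kl; rewrite scale_lfunE !comp_lfunE linearZ /= => ->.
  have := congr1 (fun f : 'End(A) => f (k x)) vlc; rewrite scale_lfunE !comp_lfunE => ->.
  by rewrite scalerA.
case/eqP: v0; apply/lfunP => x; rewrite zero_lfunE.
elim: (h x) => [|a {}x y _ h1 _ h2|r k z Kk]; first by rewrite linear0.
  by rewrite linearP /= h1 h2 scaler0 addr0.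
by rewrite -comp_lfunE (vK _ _ Kk) zero_lfunE.
Qed.

(* C = [D, U] commutes with U, and [D, C] commutes with C. If f(U) C^m = 0 with deg f minimal,
   commuting with D gives f'(U) C^(m+2) = 0. *)
Section Jacobson.
Hypothesis charF0 : [pchar F] =i pred0.
Variables D U C : 'End(A).
Hypothesis DU : forall x, D (U x) = U (D x) + C x.
Hypothesis UC : forall x, C (U x) = U (C x).
Hypothesis DC : forall x, D (C (C x)) - C (D (C x)) = C (D (C x)) - C (C (D x)).

Let act (f : {poly F}) x := poly_sum (fun i => iter i U x) f.

Let iterUC i x : C (iter i U x) = iter i U (C x).
Proof. by elim: i => //= i IH; rewrite UC IH. Qed.

Let D_iterU i x : D (iter i U x) = iter i U (D x) + iter i.-1 U (C x) *+ i.
Proof.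
elim: i => [|i IH]; first by rewrite mulr0n addr0.
rewrite iterS DU IH iterUC linearD /= -addrA; congr (_ + _).
case: i {IH} => [|i] /=; first by rewrite mulr0n linear0 add0r mulr1n.
by rewrite linearMn /= -mulrSr.
Qed.

Let D_act (f : {poly F}) x : D (act f x) = act f (D x) + act f^`() (C x).
Proof.
have sz : (size f^`() <= size f)%N by rewrite (leq_trans (size_poly _ _)) ?leq_pred.
rewrite /act (poly_sumE _ (leqnSn (size f))) (poly_sumE (fun i => iter i U (D x)) (leqnSn (size f))).
rewrite (poly_sumE _ sz) linear_sum /=.
rewrite (eq_bigr (fun i : 'I_ _ => f`_i *: iter i U (D x) + f`_i *: (iter i.-1 U (C x) *+ i))).
  rewrite big_split /=; congr (_ + _); rewrite big_ord_recl mulr0n scaler0 add0r.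
  by apply: eq_bigr => i _; rewrite coef_deriv -scalerMnl scalerMnr.
by move=> i _; rewrite linearZ /= D_iterU scalerDr.
Qed.

Let C' x := D (C x) - C (D x).

Let C'C x : C' (C x) = C (C' x).
Proof. by rewrite /C' DC linearB. Qed.

Let iterC_C' m x : iter m C (C' x) = C' (iter m C x).
Proof. by elim: m => //= m ->; rewrite C'C. Qed.

Let D_iterC m x : D (iter m C x) = iter m C (D x) + iter m.-1 C (C' x) *+ m.
Proof.
elim: m => [|m IH]; first by rewrite mulr0n addr0.
have -> : D (iter m.+1 C x) = C (D (iter m C x)) + C' (iter m C x).
  by rewrite /C' /= addrC subrK.
rewrite IH linearD /= -addrA -iterC_C'; congr (_ + _).
case: m {IH} => [|m] /=; first by rewrite mulr0n linear0 add0r mulr1n.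
by rewrite linearMn /= -mulrSr.
Qed.

Let actD (f : {poly F}) x y : act f (x + y) = act f x + act f y.
Proof.
rewrite /act -big_split; apply: eq_bigr => i _ /=; rewrite -scalerDr; congr (_ *: _).
by elim: (i : nat) => //= j ->; rewrite linearD.
Qed.

Let act0 (f : {poly F}) : act f 0 = 0.
Proof. by have := actD f 0 0; rewrite addr0 => /eqP; rewrite -subr_eq subrr => /eqP. Qed.

Let actMn (f : {poly F}) x n : act f (x *+ n) = act f x *+ n.
Proof. by elim: n => [|n IH]; rewrite ?mulr0n ?act0 // !mulrS actD IH. Qed.

Lemma commutator_nilpotent : nilpotent C.
Proof.
suff key : forall n (f : {poly F}) m, (size f <= n)%N -> f != 0 ->
    (forall x, act f (iter m C x) = 0) -> nilpotent C.
  pose Un i : 'End(A) := iter i (fun g => (U \o g)%VF) \1%VF.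
  have UnE i x : Un i x = iter i U x.
    by elim: i => [|i IH]; rewrite /Un /= ?id_lfunE // comp_lfunE IH.
  have [f f0 h] := linear_dependence Un.
  apply: (key _ f 0) (leqnn _) f0 _ => x; have := congr1 (fun g : 'End(A) => g x) h.
  rewrite zero_lfunE sum_lfunE => e; rewrite -[RHS]e; apply: eq_bigr => i _.
  by rewrite scale_lfunE UnE.
elim=> [|n IH] f m sz f0 h.
  by case/eqP: f0; apply/eqP; rewrite -size_poly_eq0 -leqn0.
have [/size1_polyC|s1] := leqP (size f) 1.
  move: (f`_0) => c fc; rewrite {}fc in f0 h; exists m => x; have := h x.
  rewrite /act poly_sumC => /eqP.
  by rewrite scaler_eq0 => /orP[/eqP e|/eqP//]; rewrite e eqxx in f0.
have d0 : f^`() != 0.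
  apply/eqP => /(congr1 (fun p : {poly F} => p`_(size f).-2)); rewrite coef_deriv coef0 => /eqP.
  rewrite -mulr_natr mulf_eq0; move/pcharf0P: charF0 => ->.
  have e : (size f).-2.+1 = (size f).-1 by case: (size f) s1 => [|[]].
  rewrite e -lead_coefE lead_coef_eq0 (negPf f0) /=.
  by case: (size f) s1 => [|[]].
(* Of the two new factors C, one arises when D meets the powers of U; the other ensures that what D
   makes of C^(m+1) still contains C^m and is killed by [act f]. *)
apply: (IH f^`() m.+2) => //; first by rewrite -ltnS (leq_trans _ sz) // lt_size_deriv.
move=> x; have := D_act f (iter m C (C x)).
by rewrite h linear0 -iterSr D_iterC actD iterSr h add0r actMn [_.+1.-1]/= h mul0rn add0r => <-.
Qed.
End Jacobson.

(** * An even idempotent exists *)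

Ltac vring := apply: vect_sep; let f := fresh "f" in let fD := fresh "fD" in
  let fZ := fresh "fZ" in move=> f fD fZ;
  rewrite ?smE ?(fD, fZ, linN fZ, lin0 fZ, linMn fD fZ) ?(mulr1n, mulr2n, mulr0n, mulrS); ring.
Ltac vfield := apply: vect_sep; let f := fresh "f" in let fD := fresh "fD" in
  let fZ := fresh "fZ" in move=> f fD fZ;
  rewrite ?smE ?(fD, fZ, linN fZ, lin0 fZ, linMn fD fZ); field.

Lemma predD P : linear_pred P -> forall x y, P x -> P y -> P (x + y).
Proof. by move=> [_ PD] x y Px Py; rewrite -[x]scale1r; apply: PD. Qed.
Lemma predZ P : linear_pred P -> forall a x, P x -> P (a *: x).
Proof. by move=> [P0 PD] a x Px; rewrite -[_ *: _]addr0; apply: PD. Qed.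
Lemma predB P : linear_pred P -> forall x y, P x -> P y -> P (x - y).
Proof. by move=> PL x y Px Py; rewrite addrC -scaleN1r; apply: PL.2. Qed.
Lemma predB_trans P : linear_pred P -> forall x y, P (x - y) -> P y -> P x.
Proof. by move=> PL x y Pxy Py; rewrite -(subrK y x); apply: predD. Qed.
Lemma predZ_inv P : linear_pred P -> forall a x, a != 0 -> P (a *: x) -> P x.
Proof. by move=> PL a x a0 /(predZ PL a^-1); rewrite scalerA mulVf // scale1r. Qed.

Lemma nilpotentD (f g : 'End(A)) : (forall x, f (g x) = g (f x)) -> nilpotent f -> nilpotent g ->
  nilpotent (f + g)%VF.
Proof.
move=> fg [n fn] [m gm]; exists (n + m)%N => x.
have giter i y : iter i f (g y) = g (iter i f y) by elim: i => //= i ->; rewrite fg.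
have it0 (h : 'End(A)) k : iter k h 0 = 0 by elim: k => //= k ->; rewrite linear0.
have itD (h : 'End(A)) k y z : iter k h (y + z) = iter k h y + iter k h z.
  by elim: k => //= k ->; rewrite linearD.
have itge (h : 'End(A)) k l y : (k <= l)%N -> (forall y, iter k h y = 0) -> iter l h y = 0.
  by move/subnK <- => hk; rewrite iterD hk it0.
suff: forall s i j y, (n + m <= s + i + j)%N -> iter s (f + g)%VF (iter i f (iter j g y)) = 0.
  by move/(_ (n + m)%N 0%N 0%N x); rewrite !addn0; apply.
elim=> [|s IH] i j y h.
  have [ni|] := leqP n i; first exact: itge ni fn.
  move=> lt; rewrite [iter j g y](itge g m) ?it0 // -(leq_add2l n) (leq_trans h) // add0n leq_add2r ltnW //.
by rewrite iterSr add_lfunE itD -!iterS -giter -iterS !IH ?addr0 // -?addnS; move: h; rewrite !(addSn, addnS).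
Qed.

(** * Engel's theorem for the even part *)

Section Engel.
Hypothesis three : 3%:R != 0 :> F.
Let A0 (x : A) := x \in part false.

Let superE a b x w : A0 a -> A0 b -> _ := fun ha hb => superjordan_even two jordanA (a:=a) (b:=b) x w ha hb.
Let A0M a b : A0 a -> A0 b -> A0 (a ** b). Proof. exact: (@sm_part false false). Qed.
Let cA0 (x y : A) : A0 x -> x ** y = y ** x. Proof. exact: comm_even. Qed.

(** The form in which nilpotency is used throughout: take the last member outside Q of the orbit of
    t. *)
Lemma nil_last (f : 'End(A)) (S Q : A -> Prop) : nilpotent f -> Q 0 -> (forall x, S x -> S (f x)) ->
  (exists t, S t /\ ~ Q t) -> exists t, [/\ S t, ~ Q t & Q (f t)].
Proof.
move=> [n fn] Q0 Sf [t [St nQ]].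
suff: forall m t, S t -> ~ Q t -> Q (iter m f t) -> exists t, [/\ S t, ~ Q t & Q (f t)].
  by move/(_ n t St nQ); rewrite fn; apply.
elim=> [//|m IH] {nQ St}t St nQ; rewrite iterSr => Qm.
by have [Qf|nQf] := classic (Q (f t)); [exists t | apply: (IH (f t)) => //; apply: Sf].
Qed.

(* Engel's theorem for B; the version relative to U is what the induction on B needs. *)
Definition engel (B : A -> Prop) := forall U V : A -> Prop, linear_pred U -> linear_pred V ->
  (forall b u, B b -> U u -> U (b ** u)) -> (forall b v, B b -> V v -> V (b ** v)) ->
  (exists v, V v /\ ~ U v) -> exists v, [/\ V v, ~ U v & forall b, B b -> U (b ** v)].

Section Step.
Variable B : A -> Prop.
Hypotheses (Bl : linear_pred B) (BA : forall b, B b -> A0 b).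
Hypothesis BB : forall b c, B b -> B c -> B (b ** c).
Hypothesis Be : engel B.
Let sq (x : A) := x ** x.
(** The normalizer of B. Unlike in the Lie case, adjoining z to B need not give a subalgebra,
    because of z z; hence the extra demand in [goal]. *)
Let Z z := A0 z /\ forall b, B b -> B (b ** z).
Let goal := exists z, [/\ Z z, ~ B z & B (z ** z)].

Section Chain.
Variable x : A.
Hypothesis Zx : Z x.
Let f b := (x ** x) ** b.
Let Q b := B b /\ B (f b).
Let Q1 b := B b /\ forall c, B c -> Q (c ** b).
Let R y := exists2 b, Q1 b & B (y - f b).
Let Ax : A0 x. Proof. by case: Zx. Qed.
Let Bx b : B b -> B (x ** b). Proof. by move=> Bb; rewrite cA0 //; apply: Zx.2. Qed.

(** Modulo B, the map b |-> x^2 b commutes with multiplications by B. So its kernel [Q] is a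
    B-submodule of B, and Engel for B can be applied to B modulo Q. *)
Lemma sq_actM b c : B b -> B c -> B (c ** f b - f (c ** b)).
Proof.
move=> Bb Bc; have h := superE c b Ax Ax.
rewrite (_ : _ - _ = (2%:R : F) *: ((x ** c) ** (x ** b) - x ** ((x ** c) ** b))).
  by apply: predZ => //; apply: predB => //; [apply: BB; apply: Bx | apply: Bx; apply: BB => //; apply: Bx].
by apply: (linear_combination h); rewrite /f; vring.
Qed.

Let xf b : x ** f b = f (x ** b).
Proof.
have h := superE x b Ax Ax; apply: vect_sep => phi fD fZ; apply: (mulfI three).
have := congr1 phi h; rewrite /f !fD => e; apply: (linear_combination e); ring.
Qed.

Let Ql : linear_pred Q.
Proof.
split=> [|a b c [Bb fb] [Bc fc]]; first by split; rewrite /f ?sm0r; apply: Bl.1.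
by split; rewrite /f ?smDr ?smZr; apply: Bl.2.
Qed.

Let QB b c : B c -> Q b -> Q (c ** b).
Proof.
move=> Bc [Bb fb]; split; first exact: BB.
rewrite -[f _](subKr (c ** f b)); apply: predB => //; [exact: BB | exact: sq_actM].
Qed.

Let Qx b : Q b -> Q (x ** b).
Proof. by move=> [Bb fb]; split; [|rewrite -xf]; apply: Bx. Qed.

Let Q1c b c : Q1 b -> B c -> Q (b ** c).
Proof. by move=> [Bb Qb] Bc; rewrite cA0 ?(BA Bb) //; apply: Qb. Qed.

Let Q1sq b : Q1 b -> Q1 ((x ** b) ** (x ** b)).
Proof.
move=> Q1b; have [Bb Qb] := Q1b; have Bp := Bx Bb; set p := x ** b in Bp *.
have [Ab Ap] := (BA Bb, BA Bp); split=> [|c Bc]; first exact: BB.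
have Ac := BA Bc.
have Qpc : Q ((p ** c) ** p).
  have h := superE c b Ap Ax.
  rewrite (_ : _ ** p = c ** ((p ** x) ** b) + p ** ((x ** c) ** b) + x ** ((p ** c) ** b)
     - (p ** x) ** (c ** b) - (x ** c) ** (p ** b)); last by apply: (linear_combination (esym h)); vring.
  have Bpx : B (p ** x) by rewrite cA0 //; apply: Bx.
  have Bxc := Bx Bc; have Bpc := BB Bp Bc.
  do ![apply: predB => // | apply: predD => //].
  - exact/QB/Qb.
  - exact/QB/Qb.
  - exact/Qx/Qb.
  - exact/QB/Qb.
  - exact/QB/Qb.
have h := superE c p Ab Ax.
have pE : b ** x = p by rewrite cA0.
rewrite pE in h.
rewrite (_ : c ** _ = p ** (c ** p) + (x ** c) ** (b ** p) + (b ** c) ** (x ** p)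
    - b ** ((x ** c) ** p) - x ** ((b ** c) ** p)); last by apply: (linear_combination h); vring.
have Bxc := Bx Bc; have Bxp := Bx Bp.
have Qbc : Q (b ** c) by apply: Q1c.
do ![apply: predB => // | apply: predD => //].
- by rewrite cA0 // (cA0 _ Ac).
- by apply: QB => //; apply: Q1c.
- by rewrite cA0 ?A0M //; apply: QB.
- by apply: Q1c => //; apply: BB.
- by apply: Qx; rewrite cA0 ?A0M //; apply: QB.
Qed.

Let R_Z y : R y -> Z y.
Proof.
move=> [b [Bb Qb] By]; split.
  by rewrite -[y](subrK (f b)) /A0 rpredD //; [apply: BA | apply: A0M (A0M Ax Ax) (BA Bb)].
move=> c Bc; rewrite -[y](subrK (f b)) smDr; apply: predD => //; first exact: BB.
by apply: (predB_trans Bl (sq_actM Bb Bc)); have [] := Qb c Bc.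
Qed.

(** The witness comes from (x^2 b)^2 = 2 x^2 (x b)^2 modulo B; [Q1sq] ensures that (x b)^2 is again
    in [Q1]. *)
Let R_sq y : R y -> R (sq y).
Proof.
move=> [b Q1b By]; have [Bb Qb] := Q1b; have Ab := BA Bb; have Bp := Bx Bb.
have {By} [b0 yE By] : exists2 b0, y = f b + b0 & B b0 by exists (y - f b); rewrite // addrC subrK.
set p := x ** b in Bp; have Q1p := Q1sq Q1b; rewrite -/p in Q1p.
exists ((2%:R : F) *: (p ** p)).
  split=> [|c Bc]; first by apply: predZ => //; case: Q1p.
  by rewrite smZr; apply: predZ => //; apply: Q1p.2.
have Af : A0 (f b) by apply: A0M (A0M Ax Ax) Ab.
have Bbf : B (b0 ** f b) by apply: (predB_trans Bl (sq_actM Bb By)); case: (Qb _ By).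
have Qpb : Q (p ** b) by apply: Qb.
have h1 := superE b b Ax Ax; have h2 := superE x x Ab Ab; have h3 := superE (f b) b Ax Ax.
have pE : b ** x = p by rewrite cA0.
have Bbf' : B (f (b ** f b)).
  have -> : b ** f b = x ** ((b ** b) ** x) + (2%:R : F) *: (b ** (p ** x)) - (2%:R : F) *: (x ** (p ** b)).
    rewrite pE in h2; have h2' := cA0 (b ** b) (A0M Ax Ax).
    apply: (linear_combination (congr2 +%R h1 (congr2 +%R h2' (esym h2)))); rewrite /f -/p; vring.
  suff: Q (x ** (b ** b ** x) + (2%:R : F) *: (b ** (p ** x)) - (2%:R : F) *: (x ** (p ** b))) by case.
  apply: predB => //; [apply: predD => //|apply: predZ => //; exact: Qx].
    by apply: Qx; rewrite cA0 ?A0M //; apply: Qx; apply: Qb.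
  by apply: predZ => //; apply: Q1c => //; rewrite cA0 ?(BA Bp) //; apply: Bx.
have Bf1 := sq_actM Bp Bp; have Bf2 : B (b ** f p).
  by apply: (predB_trans Bl (sq_actM Bp Bb)); have [] := Q1c Q1b Bp.
rewrite (_ : _ - _ = (b0 ** f b + b0 ** f b + b0 ** b0) + f (b ** f b)
   + (2%:R : F) *: (p ** f p - f (p ** p)) - (2%:R : F) *: (x ** (b ** f p))).
  do ![apply: predB => // | apply: predD => //]; try exact: BB.
    exact: predZ.
  by apply: predZ => //; apply: Bx.
have c1 := cA0 b Af; have c2 := cA0 (f b) (BA By).
have c3 := xf b; rewrite -/p in c3; have c4 := cA0 p (A0M (A0M Ax Ax) (BA Bp)); have c5 := cA0 b (A0M (A0M Ax Ax) (BA Bp)).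
rewrite /sq yE; rewrite c3 -/p (_ : f p ** p = p ** f p) // (_ : f p ** b = b ** f p) // in h3.
rewrite c1 in h3; rewrite !smDl !smDr c2; apply: (linear_combination h3); rewrite /f; vring.
Qed.

(** Squaring stays in [R], hence in the normalizer, and reaches 0; the last square outside B is the
    element sought. *)
Lemma chain_R n y : R y -> ~ B y -> iter n sq y = 0 -> goal.
Proof.
elim: n y => [|n IH] y Ry nB; first by move=> y0; case: nB; rewrite [y]y0; apply: Bl.1.
rewrite iterSr => yn; have [Bsq|nBs] := classic (B (sq y)); last exact: IH (R_sq Ry) nBs yn.
by exists y; split=> //; apply: R_Z.
Qed.
End Chain.

Hypothesis sq_nil : forall a, A0 a -> exists n, iter n sq a = 0.
Hypothesis lmul_nil : forall a, A0 a -> nilpotent (lmul a).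

(** If x^2 normalizes B, x^2 replaces x. Otherwise Engel for B modulo [Q] gives c outside Q with B c
    inside Q, and x^2 c starts a chain in [R]. *)
Lemma normalizing_sq n x : Z x -> ~ B x -> iter n sq x = 0 -> goal.
Proof.
elim: n x => [|n IH] x Zx nB; first by move=> x0; case: nB; rewrite [x]x0; apply: Bl.1.
rewrite iterSr => xn; have [Bs|nBs] := classic (B (sq x)); first by exists x.
have [Zs|nZs] := classic (Z (sq x)); first exact: IH xn.
have Ax : A0 x by case: Zx.
have [b [Bb nBb]] : exists b, B b /\ ~ B (sq x ** b).
  apply: NNPP => h; apply: nZs; split; first exact: A0M.
  move=> b Bb; rewrite cA0 ?BA //; apply: NNPP => nb; apply: h; by exists b.
pose Q b := B b /\ B ((x ** x) ** b).
have Ql : linear_pred Q.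
  split=> [|a c d [Bc fc] [Bd fd]]; first by split; rewrite ?sm0r; apply: Bl.1.
  by split; rewrite ?smDr ?smZr; apply: Bl.2.
have QB c u : B c -> Q u -> Q (c ** u).
  move=> Bc [Bu fu]; split; first exact: BB.
  rewrite -[_ ** (c ** u)](subKr (c ** ((x ** x) ** u))); apply: predB => //; first exact: BB.
  exact: (sq_actM Zx).
have [|c [Bc nQ Qc]] := Be Ql Bl QB BB; first by exists b; split=> // -[].
pose y := (x ** x) ** c.
have [m ym] := sq_nil (A0M (A0M Ax Ax) (BA Bc)).
apply: (@chain_R x Zx m y _ _ ym); last by move=> By; apply: nQ.
by exists c; [split | rewrite subrr; apply: Bl.1].
Qed.

Variable z : A.
Hypotheses (Zz : Z z) (Bzz : B (z ** z)).
Let C c := exists b k, B b /\ c = b + k *: z.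

(** The vectors [V0] of V that B sends into U would settle the matter if they were stable under the
    nilpotent L_z. If z v leaves [V0], the problem is moved from V modulo U to B itself by the map b
    |-> b (z v). *)
Lemma engel_extend : engel C.
Proof.
move=> U V Ul Vl UC VC [v0 [Vv0 nUv0]].
have Az : A0 z by case: Zz.
have CB b : B b -> C b by exists b, 0; rewrite scale0r addr0.
have Cz : C z by exists 0, 1; rewrite scale1r add0r; split=> //; apply: Bl.1.
have UB b u : B b -> U u -> U (b ** u) by move/CB; apply: UC.
have VB b u : B b -> V u -> V (b ** u) by move/CB; apply: VC.
have Bz b : B b -> B (z ** b) by move=> Bb; rewrite cA0 //; apply: Zz.2.
suff [v [Vv nUv Uv Uzv]] : exists v, [/\ V v, ~ U v, forall b, B b -> U (b ** v) & U (z ** v)].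
  exists v; split=> // c [b [k [Bb ->]]]; rewrite smDl smZl.
  by apply: predD => //; [apply: Uv | apply: predZ].
pose V0 v := V v /\ forall b, B b -> U (b ** v).
have [v1 [Vv1 nUv1 Uv1]] := Be Ul Vl UB VB (ex_intro _ v0 (conj Vv0 nUv0)).
have [h|] := classic (forall v, V0 v -> V0 (z ** v)).
  have [||v [[Vv Uv] nUv Uzv]] := @nil_last (lmul z) V0 U (lmul_nil Az) Ul.1.
  - by move=> v /h; rewrite lmulE.
  - by exists v1; split.
  by exists v; split=> //; rewrite -lmulE.
move/not_all_ex_not; case=> v nv; have [[Vv Uv] nV0] := imply_to_and _ _ nv.
have {nv nV0} [b0 [Bb0 nUb0]] : exists b, B b /\ ~ U (b ** (z ** v)).
  apply: NNPP => h; apply: nV0; split; first exact: VC.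
  by move=> b Bb; apply: NNPP => nb; apply: h; exists b.
(* Modulo U, [g] commutes with multiplications by B and by z, as [gM] and [gz] show; its kernel in B
   is [Q] below. *)
pose g b := b ** (z ** v).
have gM b c : B b -> B c -> U (b ** g c - g (b ** c)).
  move=> Bb Bc; have h := superE v c (BA Bb) Az.
  rewrite (_ : _ - _ = (b ** z) ** (c ** v) + (z ** c) ** (b ** v) - z ** (c ** (b ** v)) - ((b ** z) ** c) ** v).
    have Bbz : B (b ** z) by apply: Zz.2.
    do ![apply: predB => // | apply: predD => //].
    - by apply/UB/Uv.
    - by apply: UB; [apply: Bz | apply: Uv].
    - by apply: UC => //; apply/UB/Uv.
    - by apply/Uv/BB.
  have e1 := cA0 v (A0M (A0M (BA Bb) Az) (BA Bc)); have e2 := cA0 c (A0M Az (BA Bb)).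
  have e3 := cA0 v Az; have e4 := cA0 v (BA Bb); have e5 := cA0 v (BA Bc).
  have e6 : z ** v ** c = c ** (z ** v) by rewrite (cA0 _ (BA Bc)).
  have e7 : b ** v ** c = c ** (b ** v) by rewrite (cA0 _ (BA Bc)).
  have e8 : z ** v ** (b ** c) = b ** c ** (z ** v) by rewrite (cA0 _ (A0M (BA Bb) (BA Bc))).
  have e9 : b ** v ** (z ** c) = z ** c ** (b ** v) by rewrite (cA0 _ (A0M Az (BA Bc))).
  rewrite -e5 -e1 e6 e7 e8 e9 in h.
  by apply: (linear_combination h); rewrite /g; vring.
have gz b : B b -> U (z ** g b - g (z ** b)).
  move=> Bb; apply: (@predZ_inv _ Ul 2%:R) => //.
  have h := superE v b Az Az.
  rewrite (_ : _ *: _ = (z ** z) ** (b ** v) - (z ** z ** b) ** v).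
    apply: predB => //; first by apply/UB/Uv.
    by apply/Uv/BB.
  have e1 := cA0 v (A0M (A0M Az Az) (BA Bb)); have e5 := cA0 v (BA Bb).
  have e6 : z ** v ** b = b ** (z ** v) by rewrite (cA0 _ (BA Bb)).
  have e8 : z ** v ** (z ** b) = z ** b ** (z ** v) by rewrite (cA0 _ (A0M Az (BA Bb))).
  rewrite -e5 -e1 e6 e8 in h.
  by apply: (linear_combination h); rewrite /g; vring.
pose Q b := B b /\ U (g b); pose Q1 b := B b /\ forall c, B c -> Q (c ** b).
have Ql : linear_pred Q.
  split=> [|a c d [Bc fc] [Bd fd]]; first by split; rewrite /g ?sm0l; [apply: Bl.1 | apply: Ul.1].
  by split; rewrite /g ?smDl ?smZl; [apply: Bl.2 | apply: Ul.2].
have QB c u : B c -> Q u -> Q (c ** u).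
  move=> Bc [Bu gu]; split; first exact: BB.
  rewrite -[g _](subKr (c ** g u)); apply: predB => //; [exact: UB | exact: gM].
have Qz u : Q u -> Q (z ** u).
  move=> [Bu gu]; split; first exact: Bz.
  by rewrite -[g _](subKr (z ** g u)); apply: predB => //; [apply: UC | apply: gz].
have Q1c b c : Q1 b -> B c -> Q (b ** c).
  by move=> [Bb Qb] Bc; rewrite cA0 ?(BA Bb) //; apply: Qb.
have [|b [Bb nQb Qb]] := Be Ql Bl QB BB; first by exists b0; split=> // -[].
have {b0 Bb0 nUb0} Q1b : Q1 b by split.
(* On such an S, nilpotency of L_z gives t' outside [Q] with B t' and z t' inside Q; then [g t'] is
   the required vector of V. *)
suff [S [SQ Sz [t [St nQt]]]] : exists S : A -> Prop,
    [/\ forall s, S s -> Q1 s, forall s, S s -> S (z ** s) & exists t, S t /\ ~ Q t].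
  have [| |t' [St' nQt' Qzt]] := @nil_last (lmul z) S Q (lmul_nil Az) Ql.1.
  - by move=> s /Sz; rewrite lmulE.
  - by exists t.
  rewrite lmulE in Qzt; have [Bt Qt] := SQ _ St'.
  exists (g t'); split.
  - by apply: VB => //; apply: VC.
  - by move=> Ut; apply: nQt'.
  - by move=> c Bc; apply: (predB_trans Ul (gM _ _ Bc Bt)); case: (Qt c Bc).
  - by apply: (predB_trans Ul (gz _ Bt)); case: Qzt.
have [h|] := classic (forall s, Q1 s -> Q1 (z ** s)).
  by exists Q1; split=> //; exists b.
move/not_all_ex_not; case=> {Bb nQb Qb}b' nb; have {b Q1b}[Q1b nQu] := imply_to_and _ _ nb.
move: b' Q1b nQu {nb} => b Q1b nQu; have [Bb Qb] := Q1b.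
pose u := z ** b; have Bu : B u by apply: Bz.
have Au := BA Bu; have Ab := BA Bb.
have zb : b ** z = u by rewrite cA0.
have [c0 [Bc0 nQc0]] : exists c, B c /\ ~ Q (c ** u).
  by apply: NNPP => h; apply: nQu; split=> // c Bc; apply: NNPP => nc; apply: h; exists c.
have Qdcu c d : B c -> B d -> Q (d ** (c ** u)).
  move=> Bc Bd; have [Ac Ad] := (BA Bc, BA Bd).
  have Q1' : Q (u ** (c ** d)).
    have h := superE d z Ab Ac.
    have e1 : c ** d ** z = z ** (c ** d) by rewrite (cA0 _ Az).
    have e2 : b ** d ** (c ** z) = c ** z ** (b ** d) by rewrite cA0 ?A0M.
    have e3 : c ** d ** (b ** z) = u ** (c ** d) by rewrite zb cA0 ?A0M.
    rewrite e2 e3 in h.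
    rewrite (_ : _ ** _ = d ** (b ** c ** z) + c ** (b ** d ** z) + b ** (c ** d ** z)
       - b ** c ** (d ** z) - c ** z ** (b ** d)); last by apply: (linear_combination (esym h)); vring.
    do ![apply: predB => // | apply: predD => //].
    - by apply: QB => //; rewrite cA0 ?A0M //; apply/Qz/Q1c.
    - by apply: QB => //; rewrite cA0 ?A0M //; apply/Qz/Q1c.
    - by apply: Q1c => //; apply/Zz.2/BB.
    - by rewrite cA0 ?A0M //; apply: QB; [apply: Zz.2 | apply: Q1c].
    - by apply: QB; [apply: Zz.2 | apply: Q1c].
  have h := superE d c Ab Az; rewrite zb in h.
  rewrite (_ : _ ** _ = u ** (c ** d) + (z ** d) ** (b ** c) + (b ** d) ** (z ** c)
     - b ** (z ** d ** c) - z ** (b ** d ** c)); last first.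
    rewrite (cA0 u Ac) (cA0 d Ac); apply: (linear_combination h); vring.
  have [Bzc Bzd] := (Bz _ Bc, Bz _ Bd).
  do ![apply: predB => // | apply: predD => //].
  - by apply: QB => //; apply: Q1c.
  - by rewrite cA0 ?A0M //; apply: QB => //; apply: Q1c.
  - by apply: Q1c => //; apply: BB.
  - by apply: Qz; rewrite cA0 ?A0M //; apply: QB => //; apply: Q1c.
have Qzcu c : B c -> Q (z ** (c ** u) - (z ** c) ** u).
  move=> Bc; have Ac := BA Bc; apply: (@predZ_inv _ Ql 2%:R) => //.
  have h := superE b c Az Az.
  rewrite -/u (cA0 c Au) (cA0 (z ** c) Au) in h.
  rewrite (_ : _ *: _ = z ** z ** (b ** c) - b ** (z ** z ** c)); last first.
    by apply: (linear_combination h); vring.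
  apply: predB => //; first by apply: QB => //; apply: Q1c.
  by apply: Q1c => //; apply: BB.
(* When [Q1] is not stable under z, say at u = z b, its subspace B u + Q is, because z (c u) = (z c)
   u modulo Q. *)
exists (fun s => exists c q, [/\ B c, Q q & s = c ** u + q]); split.
- move=> _ [c [q [Bc Qq ->]]]; split.
    by apply: predD => //; [apply: BB | case: Qq].
  by move=> d Bd; rewrite smDr; apply: predD => //; [apply: Qdcu | apply: QB].
- move=> _ [c [q [Bc Qq ->]]]; exists (z ** c), (z ** (c ** u) - z ** c ** u + z ** q); split.
  + exact: Bz.
  + by apply: predD => //; [apply: Qzcu | apply: Qz].
  + vring.
- exists (c0 ** u); split=> //; exists c0, 0; split; rewrite ?addr0 //; exact: Ql.1.
Qed.
End Step.

(** A subalgebra B with Engel's property is enlarged: acting on A_0 modulo B it has a normalizing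
    element outside B, [normalizing_sq] arranges that the square lies in B, and [engel_extend]
    adjoins the result. *)
Lemma engel_even : (forall a, A0 a -> exists n, iter n (fun x : A => x ** x) a = 0) ->
  (forall a, A0 a -> nilpotent (lmul a)) -> engel A0.
Proof.
move=> sq_nil lmul_nil.
have A0l : linear_pred A0.
  by split=> [|a x y xA yA]; rewrite /A0 ?mem0v // rpredD ?rpredZ.
suff: forall n (B : {vspace A}), (\dim {:A} - \dim B <= n)%N -> (forall b, b \in B -> A0 b) ->
    (forall b c, b \in B -> c \in B -> b ** c \in B) -> engel (fun b => b \in B) -> engel A0.
  move/(_ _ 0%VS (leqnn _)); apply.
  - by move=> b; rewrite memv0 => /eqP->; apply: A0l.1.
  - by move=> b c /[!memv0] /eqP-> _; rewrite sm0l.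
  - move=> U V Ul Vl _ _ [v [Vv nUv]]; exists v; split=> // b; rewrite memv0 => /eqP->.
    by rewrite sm0l; apply: Ul.1.
elim=> [|n IH] B Bn BA BB Be.
  have /eqP fB : B == fullv by rewrite eqEdim subvf; rewrite leqn0 subn_eq0 in Bn.
  have BA0 x : x \in B <-> A0 x by split=> [/BA//|_]; rewrite fB memvf.
  move=> U V Ul Vl UA VA e; have [||v [Vv nU Uv]] := Be U V Ul Vl _ _ e.
  - by move=> b u /BA; apply: UA.
  - by move=> b u /BA; apply: VA.
  by exists v; split=> // b /BA0; apply: Uv.
have Bl : linear_pred (fun b => b \in B).
  by split=> [|a x y xB yB]; rewrite ?mem0v // rpredD ?rpredZ.
have [h|] := classic (forall x, A0 x -> x \in B).
  move=> U V Ul Vl UA VA e; have [||v [Vv nU Uv]] := Be U V Ul Vl _ _ e.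
  - by move=> b u /BA; apply: UA.
  - by move=> b u /BA; apply: VA.
  by exists v; split=> // b /h; apply: Uv.
move/not_all_ex_not; case=> x0 nx; have [Ax0 nBx0] := imply_to_and _ _ nx.
have [|x [Ax nBx Bx]] := Be _ _ Bl A0l BB _ (ex_intro _ x0 (conj Ax0 nBx0)).
  by move=> b v /BA Ab Av; apply: A0M.
have [m xm] := sq_nil x Ax.
have [z [[Az Bz] nBz Bzz]] := normalizing_sq Bl BA BB Be sq_nil (conj Ax Bx) nBx xm.
have := engel_extend Bl BA BB Be lmul_nil (conj Az Bz) Bzz => Ce.
have CE c : c \in (B + <[z]>)%VS <-> exists b k, b \in B /\ c = b + k *: z.
  split=> [/memv_addP[b bB [_ /vlineP[k ->] ->]]|[b [k [bB ->]]]]; first by exists b, k.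
  by rewrite memv_add // memvZ // memv_line.
apply: (IH (B + <[z]>)%VS).
- have lt : (\dim B < \dim (B + <[z]>))%N.
    rewrite ltn_neqAle dimvS ?addvSl // andbT; apply/negP => /eqP e; apply: nBz.
    have /eqP -> : B == (B + <[z]>)%VS by rewrite eqEdim addvSl e leqnn.
    by have := memv_add (mem0v B) (memv_line z); rewrite add0r.
  have le := dimvS (subvf (B + <[z]>)%VS); rewrite -ltnS; apply: leq_trans Bn.
  exact: ltn_sub2l (leq_trans lt le) lt.
- by move=> c /CE[b [k [/BA Ab ->]]]; apply: (predD A0l) => //; apply: (predZ A0l).
- move=> c d /CE[b [k [bB ->]]] /CE[b' [k' [b'B ->]]]; apply/CE.
  exists (b ** b' + k' *: (b ** z) + k *: (b' ** z) + (k * k') *: (z ** z)), 0; split.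
    have [[m1 m2] m3] := (BB _ _ bB b'B, Bz _ bB, Bz _ b'B).
    exact: (memvD (memvD (memvD m1 (memvZ _ m2)) (memvZ _ m3)) (memvZ _ Bzz)).
  by rewrite (cA0 z (BA _ b'B)); vring.
- move=> U V Ul Vl UC VC e; have [||v [Vv nU Uv]] := Ce U V Ul Vl _ _ e.
  + by move=> b u /CE; apply: UC.
  + by move=> b u /CE; apply: VC.
  by exists v; split=> // c /CE; apply: Uv.
Qed.

(** An A_0-submodule of [part i] is enlarged by vectors that A_0 sends into it; at the last proper
    stage it absorbs A_0 times [part i]. *)
Lemma engel_proper i : engel A0 -> (exists v, v \in part i /\ v <> 0) ->
  exists2 U : {vspace A}, (forall a x, A0 a -> x \in part i -> a ** x \in U) &
    exists2 v, v \in part i & v \notin U.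
Proof.
move=> Ae [v0 [v0i v0n]].
have A0i a x : A0 a -> x \in part i -> a ** x \in part i by exact: (@sm_part false i).
have pl (U : {vspace A}) : linear_pred (fun x => x \in U).
  by split=> [|a x y xU yU]; rewrite ?mem0v // rpredD ?rpredZ.
suff: forall n (U : {vspace A}), (\dim (part i) - \dim U <= n)%N -> (U <= part i)%VS ->
    (forall a u, A0 a -> u \in U -> a ** u \in U) -> (exists v, v \in part i /\ ~ v \in U) ->
    exists2 U : {vspace A}, (forall a x, A0 a -> x \in part i -> a ** x \in U) &
      exists2 v, v \in part i & v \notin U.
  move/(_ _ 0%VS (leqnn _)); apply; first exact: sub0v.
    by move=> a u _ /[!memv0] /eqP->; rewrite sm0r.
  by exists v0; split=> //; rewrite memv0 => /eqP.
elim=> [|n IH] U Un Ui UA [v [vi nvU]].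
  case: nvU; suff /eqP -> : U == part i by [].
  by rewrite eqEdim Ui; rewrite leqn0 subn_eq0 in Un.
have [w [wi nwU wU]] := Ae _ _ (pl U) (pl (part i)) UA A0i (ex_intro _ v (conj vi nvU)).
have sub : (U + <[w]> <= part i)%VS by rewrite subv_add Ui -memvE.
have [h|] := classic (forall x, x \in part i -> x \in (U + <[w]>)%VS).
  exists U; last by exists v => //; apply/negP.
  move=> a x Aa /h /memv_addP[u uU [_ /vlineP[k ->] ->]].
  by rewrite smDr smZr; apply: memvD (UA _ _ Aa uU) (memvZ _ (wU a Aa)).
move/not_all_ex_not; case=> x nx; have [xi nxU] := imply_to_and _ _ nx.
apply: (IH (U + <[w]>)%VS) => //; last by exists x.
  have lt : (\dim U < \dim (U + <[w]>))%N.
    rewrite ltn_neqAle dimvS ?addvSl // andbT; apply/negP => /eqP e; apply: nwU.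
    have /eqP -> : U == (U + <[w]>)%VS by rewrite eqEdim addvSl e leqnn.
    by have := memv_add (mem0v U) (memv_line w); rewrite add0r.
  by rewrite -ltnS; apply: leq_trans Un; apply: ltn_sub2l (leq_trans lt (dimvS sub)) lt.
move=> a _ Aa /memv_addP[u uU [_ /vlineP[k ->] ->]].
rewrite smDr smZr -[_ + _]addr0; apply: memv_add (mem0v _); exact: memvD (UA _ _ Aa uU) (memvZ _ (wU a Aa)).
Qed.

(** Since A is spanned by products, A_1 = A_0 A_1, and A_0 = A_0 A_0 if A_1 = 0; Engel's property
    would make these products span proper subspaces. *)
Lemma not_engel : ~ engel A0.
Proof.
move=> Ae.
have prl i (U : {vspace A}) : linear_pred (fun x => pr i x \in U).
  by split=> [|a x y xU yU]; rewrite ?linear0 ?mem0v // linearP rpredD ?rpredZ.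
have prM i x y : pr i (x ** y) = pr false x ** pr i y + pr true x ** pr (~~ i) y.
  have M k l j : pr j (pr k x ** pr l y) = if j == (k (+) l) then pr k x ** pr l y else 0.
    have kl := sm_part (prP k x) (prP l y).
    case: eqP => [->|/eqP ne]; first exact: pr_id.
    have -> : j = ~~ (k (+) l) by case: j k l ne {kl} => [] [] [].
    exact: pr_neq kl.
  rewrite {1}(pr_dec x) {1}(pr_dec y) !smE !linearD /= !M.
  by case: i; rewrite /= ?(addr0, add0r).
have [[v1 v1n]|h1] := classic (exists v, v \in part true /\ v <> 0).
  have [U UA [v vi /negP nvU]] := engel_proper Ae (ex_intro _ v1 v1n).
  apply: nvU; rewrite -(pr_id vi); apply: (sm_full (prl true U)) => x y.
  rewrite prM; apply: memvD; first exact: (UA _ _ (prP false x) (prP true y)).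
  rewrite /= -(cA0 _ (prP false y)); exact: (UA _ _ (prP false y) (prP true x)).
have z1 x : pr true x = 0 by apply: NNPP => n; apply: h1; exists (pr true x); rewrite prP.
have [[v0 v0n]|h0] := classic (exists v, v \in part false /\ v <> 0).
  have [U UA [v vi /negP nvU]] := engel_proper Ae (ex_intro _ v0 v0n).
  apply: nvU; rewrite -(pr_id vi); apply: (sm_full (prl false U)) => x y.
  rewrite prM z1 sm0l addr0; exact: (UA _ _ (prP false x) (prP false y)).
have z0 x : pr false x = 0 by apply: NNPP => n; apply: h0; exists (pr false x); rewrite prP.
case: simpleA => [[x [y xy]] _]; apply: xy.
by rewrite (pr_dec (x ** y)) z0 z1 addr0.
Qed.

(** * Powers of an even element *)

Section Powers.
Variable a : A.
Hypothesis Aa : A0 a.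
(** This is a^(n+1): in the absence of a unit the indices are shifted by one. *)
Let pw n := iter n (supermul A a) a.

Let pwA n : A0 (pw n). Proof. by elim: n => //= n; apply: A0M. Qed.

Lemma mul_power_rec p x : A0 p -> a ** (a ** p) ** x =
  (2%:R : F) *: (a ** p ** (a ** x)) + a ** a ** (p ** x) - a ** (a ** (p ** x)) - p ** (a ** (a ** x)).
Proof.
move=> Ap; have h := superE x a Aa Ap.
have e1 : x ** (a ** p ** a) = a ** (a ** p) ** x.
  by rewrite -(cA0 x (A0M (A0M Aa Ap) Aa)) -(cA0 (a ** p) Aa).
have e2 : p ** x ** a = a ** (p ** x) by rewrite -(cA0 _ Aa).
have e3 : a ** x ** a = a ** (a ** x) by rewrite -(cA0 _ Aa).
have e4 : x ** a = a ** x by rewrite -(cA0 _ Aa).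
have e5 : p ** x ** (a ** a) = a ** a ** (p ** x) by rewrite -(cA0 _ (A0M Aa Aa)).
have e6 : a ** x ** (p ** a) = a ** p ** (a ** x) by rewrite -(cA0 p Aa) -(cA0 _ (A0M Aa Ap)).
rewrite e1 e2 e3 e4 e5 e6 in h; apply: (linear_combination h).
vring.
Qed.

(** By [mul_power_rec] every L_(a^n) is a polynomial in L_a and L_(a^2), which commute by the Jordan
    identity. The recursion has depth two, so the induction carries two consecutive powers. *)
Lemma power_commute n x : pw n ** (a ** x) = a ** (pw n ** x).
Proof.
have C2 y : a ** a ** (a ** y) = a ** (a ** a ** y).
  have h := superE a y Aa Aa; apply: vect_sep => phi fD fZ; apply: (mulfI three).
  have := congr1 phi h; rewrite !fD => e; apply: (linear_combination (esym e)); ring.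
suff H y : [/\ pw n ** (a ** y) = a ** (pw n ** y),
    pw n ** (a ** a ** y) = a ** a ** (pw n ** y), pw n.+1 ** (a ** y) = a ** (pw n.+1 ** y)
    & pw n.+1 ** (a ** a ** y) = a ** a ** (pw n.+1 ** y)] by case: (H x).
elim: n {x} y => [|n IH] y; first by split=> //=; rewrite C2.
have IH1 z : pw n ** (a ** z) = a ** (pw n ** z) by case: (IH z).
have IH2 z : pw n ** (a ** a ** z) = a ** a ** (pw n ** z) by case: (IH z).
have IH3 z : a ** pw n ** (a ** z) = a ** (a ** pw n ** z) by case: (IH z).
have IH4 z : a ** pw n ** (a ** a ** z) = a ** a ** (a ** pw n ** z) by case: (IH z).
rewrite /=; split=> //.
  by rewrite !(mul_power_rec _ (pwA n)) !(IH1, IH3) !smE !(IH1, IH3, C2).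
by rewrite !(mul_power_rec _ (pwA n)) -!C2 !(IH2, IH4) !smE !(IH2, IH4, C2).
Qed.

Lemma mul_power i j : pw i ** pw j = pw (i + j).+1.
Proof.
elim: j => [|j IH]; first by rewrite addn0 /= cA0.
by rewrite [pw j.+1]/= power_commute IH addnS.
Qed.

Lemma power_sq n : exists2 k, (n <= k)%N & iter n (fun x : A => x ** x) a = pw k.
Proof.
elim: n => [|n [k nk e]]; first by exists 0%N.
by exists (k + k).+1; rewrite ?iterS ?e ?mul_power // ltnS (leq_trans nk) ?leq_addr.
Qed.

Lemma idempotent_of_power : (forall n, pw n <> 0) -> exists e, [/\ A0 e, e <> 0 & e ** e = e].
Proof.
move=> pw0; pose act := poly_sum pw.
have actX (f : {poly F}) : act ('X * f) = a ** act f.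
  rewrite mulrC /act poly_sumX [RHS]linear_sumr; apply: eq_bigr => i _; by rewrite /= -smZr.
have act0 : act 0 = 0 := poly_sum0 pw.
have actD (f g : {poly F}) : act (f + g) = act f + act g := poly_sumD pw f g.
have actZ c (f : {poly F}) : act (c *: f) = c *: act f := poly_sumZ pw c f.
have actC c : act c%:P = c *: a := poly_sumC pw c.
have act_comm (f : {poly F}) x : act f ** (a ** x) = a ** (act f ** x).
  rewrite !(big_morph (fun z => z ** _) (fun u v => smDl u v _) (sm0l _)) [RHS]linear_sumr.
  by apply: eq_bigr => i _; rewrite !smZl linearZr power_commute.
have actA f : A0 (act f) by apply: memv_suml => i _; apply/memvZ/pwA.
have actM (p q : {poly F}) : act p ** act q = act ('X * p * q).
  elim/poly_ind: q => [|q c IH]; first by rewrite mulr0 act0 sm0r.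
  rewrite mulrDr !actD (mulrC q) actX smDr act_comm IH actC smZr.
  rewrite (_ : 'X * p * ('X * q) = 'X * ('X * p * q)) ?actX; last by ring.
  by rewrite (mulrC _ c%:P) mul_polyC actZ actX -(cA0 _ Aa).
have [f f0 fa] := linear_dependence pw.
have [m [g]] := multiplicity_XsubC f 0; rewrite f0 /= subr0 => g0 fE.
(* With f = g X^m and g(0) nonzero, division by g(0) turns the relation into a^(m+1) = a^(m+1) (a
   h(a)). *)
have {g0 fE f0 fa} [h hm] : exists h : {poly F}, act ('X^m) = act ('X^m * ('X * h)).
  elim/poly_ind: g g0 fE => [|g c _]; first by rewrite root0.
  rewrite /root !hornerE => c0 fE.
  exists (- c^-1 *: g); have: act f = 0 by [].
  rewrite fE mulrDl actD [c%:P * _]mul_polyC actZ => /eqP; rewrite addrC addr_eq0 => /eqP e.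
  rewrite -!scalerAr actZ -[LHS]scale1r -(mulVf c0) -scalerA e scalerN scaleNr.
  by congr (- (_ *: act _)); ring.
have actMr (p q r : {poly F}) : act p = act q -> act (p * r) = act (q * r).
  move=> e; elim/poly_ind: r => [|r c IH]; first by rewrite !mulr0.
  rewrite !mulrDr !actD !(mulrC _ c%:P) !mul_polyC !actZ e; congr (_ + _).
  by rewrite ![_ * (r * 'X)]mulrA ![_ * 'X]mulrC !actX IH.
have hk k : act ('X^m * ('X * h) ^+ k) = act ('X^m).
  elim: k => [|k IH]; first by rewrite expr0 mulr1.
  by rewrite exprSr mulrA (actMr _ _ _ IH) -hm.
have key (q : {poly F}) k : act ('X^m * ('X * h) ^+ k * q) = act ('X^m * q) by apply/actMr/hk.
(* This is (a h(a))^(m+1), idempotent because a h(a) acts as a unit on a^(m+1). *)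
exists (act ('X^m * h ^+ m.+1)); split=> //.
  move=> e0; apply: (pw0 m).
  have <- : act 'X^m = pw m.
    rewrite /act (poly_sumE (N := m.+1)) ?size_polyXn // big_ord_recr /= coefXn eqxx scale1r big1 ?add0r // => i _.
    by rewrite coefXn ltn_eqF ?scale0r.
  rewrite -(hk m.+1) (_ : 'X^m * ('X * h) ^+ m.+1 = 'X^m * h ^+ m.+1 * 'X^(m.+1)); last by rewrite exprMn; ring.
  have -> : (0 : A) = act (0 * 'X^(m.+1)) by rewrite mul0r act0.
  by apply: actMr; rewrite e0 act0.
rewrite actM -(key (h ^+ m.+1) m.+1); congr (act _); rewrite exprMn !exprS; ring.
Qed.
End Powers.

(** From 2 L_a^3 = 3 L_(a^2) L_a - L_(a^3). Induction on the nilpotency index applies to a^2 and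
    a^3, so L_a^3 is a sum of two commuting nilpotent operators. *)
Lemma nil_lmul n a : A0 a -> iter n (supermul A a) a = 0 -> nilpotent (lmul a).
Proof.
elim/ltn_ind: n a => n IH a Aa; case: n IH => [|n] IH an.
  by exists 1%N => x /=; rewrite lmulE [a]an sm0l.
have A2 : A0 (a ** a) by apply: A0M. have A3 : A0 (a ** (a ** a)) by apply: A0M.
have pw0 k : (n < k)%N -> iter k (supermul A a) a = 0.
  by move/subnK <-; rewrite iterD an; elim: (_ - _)%N => //= l ->; rewrite sm0r.
have pwM k l : iter k (supermul A (iter l (supermul A a) a)) (iter l (supermul A a) a) =
    iter (l + k * l.+1) (supermul A a) a.
  elim: k => [|k IHk]; first by rewrite addn0.
  by rewrite iterS IHk mul_power // -addnS mulSn; congr (iter _ _ _); rewrite !(addnS, addSn); congr _.+1;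
   rewrite addnCA addnA.
have ltn : (n.+1./2 < n.+1)%N by rewrite -divn2 ltn_Pdiv.
have n2 : (n <= n.+1./2.*2)%N.
  by rewrite -ltnS -[X in (X <= _)%N](odd_double_half n.+1) -[X in (_ <= X)%N]add1n leq_add2r leq_b1.
have nil2 : nilpotent (lmul (a ** a)).
  by apply: (IH _ ltn) => //; rewrite (pwM _ 1%N) pw0 // add1n muln2.
have nil3 : nilpotent (lmul (a ** (a ** a))).
  apply: (IH _ ltn) => //; rewrite (pwM _ 2%N) pw0 // addSn ltnS mulnSr muln2.
  by rewrite (leq_trans n2) // addnCA leq_addr.
have C1 x : a ** a ** (a ** x) = a ** (a ** a ** x) by exact: (power_commute Aa 1).
have C2 x : a ** (a ** a) ** (a ** x) = a ** (a ** (a ** a) ** x) by exact: (power_commute Aa 2).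
have rec x : a ** (a ** a) ** x = (3%:R : F) *: (a ** a ** (a ** x)) - (2%:R : F) *: (a ** (a ** (a ** x))).
  by rewrite mul_power_rec // C1; vring.
pose f : 'End(A) := ((3%:R / 2%:R) *: (lmul (a ** a) \o lmul a))%VF.
pose g : 'End(A) := (- 2%:R^-1 *: lmul (a ** (a ** a)))%VF.
have scale_nil c (h : 'End(A)) : nilpotent h -> nilpotent (c *: h)%VF.
  move=> [k hk]; exists k => x; suff -> : iter k (c *: h)%VF x = c ^+ k *: iter k h x by rewrite hk scaler0.
  by elim: k {hk} => [|k IHk]; rewrite ?scale1r // !iterS IHk scale_lfunE linearZ scalerA -exprS.
have nilf : nilpotent f.
  apply: scale_nil; case: nil2 => k hk; exists k => x.
  suff -> : iter k (lmul (a ** a) \o lmul a)%VF x = iter k (lmul (a ** a)) (iter k (lmul a) x) by rewrite hk.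
  elim: k x {hk} => //= k IHk x; rewrite IHk comp_lfunE; congr (lmul _ _).
  by elim: k {IHk} (iter k _ x) => //= k IHk y; rewrite -IHk !lmulE C1.
have nilg : nilpotent g by apply: scale_nil.
have fg x : f (g x) = g (f x).
  rewrite !scale_lfunE !comp_lfunE !linearZ /= !lmulE !scalerA mulrC; congr (_ *: _).
  have C3 y : a ** (a ** a) ** (a ** a ** y) = a ** a ** (a ** (a ** a) ** y).
    by rewrite !rec !smE -!C1.
  by rewrite C3 C2.
have [k hk] := nilpotentD fg nilf nilg.
exists (k * 3)%N => x; rewrite -[RHS](hk x); elim: k {hk} => //= k ->.
rewrite add_lfunE !scale_lfunE !comp_lfunE !lmulE rec.
by vfield.
Qed.

Lemma idempotent_ex : exists e, [/\ A0 e, e <> 0 & e ** e = e].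
Proof.
apply: NNPP => none; apply: not_engel.
have pw0 a : A0 a -> exists n, iter n (supermul A a) a = 0.
  move=> Aa; apply: NNPP => h; apply: none; apply: (idempotent_of_power Aa) => n e; apply: h; by exists n.
apply: engel_even => a Aa; have [n an] := pw0 a Aa; last exact: nil_lmul an.
have [k nk e] := power_sq Aa n; exists n; rewrite e -(subnK nk) iterD an.
by elim: (_ - _)%N => //= l ->; rewrite sm0r.
Qed.
End Engel.

(** * Peirce decomposition *)

Ltac bool_cases := repeat match goal with b : bool |- ?G => match G with context [b] => destruct b end end.
Ltac svfield := apply: vect_sep; let f := fresh "f" in let fD := fresh "fD" in
  let fZ := fresh "fZ" in move=> f fD fZ;
  rewrite ?smE ?(fD, fZ, linN fZ, lin0 fZ, linMn fD fZ) /ssgn;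
  bool_cases; rewrite /= ?(expr0, expr1); field.

Ltac lc h := first [apply: (linear_combination h); solve [svfield => //]
  | apply: (linear_combination (esym h)); solve [svfield => //]].

Section Idempotent.
Hypothesis three : 3%:R != 0 :> F.
Variable e : A.
Hypotheses (e_even : e \in part false) (e_neq0 : e <> 0) (ee : e ** e = e).

(* The Peirce spaces P_1 (b = true), P_0 (b = false) and P_(1/2) of e; hP and hH add homogeneity of
   parity i. On P_1 + P_0, pk b is the projection onto P_1 (b = true) or P_0 (b = false). *)
Definition int_peirce (b : bool) (x : A) := e ** x = b%:R *: x.
Definition half_peirce (x : A) := e ** x = half *: x.
Local Notation Pk := int_peirce.
Local Notation Ph := half_peirce.
Definition hP i b x := x \in part i /\ Pk b x.
Definition hH i x := x \in part i /\ Ph x.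
Definition pk (b : bool) (m : A) := if b then e ** m else m - e ** m.

Let sc i j x y : x \in part i -> y \in part j -> x ** y = ssgn F i j *: (y ** x).
Proof. exact: supercomm. Qed.
Let ce x : x ** e = e ** x. Proof. by rewrite -(comm_even _ e_even). Qed.

Lemma peirce_cubic x : (2%:R : F) *: (e ** (e ** (e ** x))) = (3%:R : F) *: (e ** (e ** x)) - e ** x.
Proof.
have := superjordan_even two jordanA x e e_even e_even.
by rewrite !ee !ce => h; apply: (linear_combination h); vring.
Qed.

Lemma peirce_eigen c x : e ** x = c *: x -> c != 0 -> c != half -> c != 1 -> x = 0.
Proof.
move=> ex c0 ch c1; have := peirce_cubic x; rewrite !ex !smE !ex !smE !ex => h.
have : (2%:R * c * (c - half) * (c - 1)) *: x = 0.
  by apply: (linear_combination h); vfield.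
move/eqP; rewrite scaler_eq0 !mulf_eq0 !subr_eq0 (negPf two) (negPf c0) (negPf ch) (negPf c1) /=.
by move/eqP.
Qed.

Lemma part_lin i : linear_pred (fun x : A => x \in part i).
Proof. by split=> [|a x y xi yi]; rewrite ?mem0v // rpredD ?rpredZ. Qed.

Lemma peirce_ind (R : A -> Prop) : linear_pred R -> (forall i b x, hP i b x -> R x) ->
  (forall i x, hH i x -> R x) -> forall x, R x.
Proof.
move=> Rl R1 R2 x; suff hom i : forall y, y \in part i -> R y.
  by rewrite (pr_dec x); apply: predD => //; apply: (hom _ _ (prP _ _)).
move=> y yi; have ez z : z \in part i -> e ** z \in part i by move=> zi; exact: (sm_part e_even zi).
have c := peirce_cubic y.
(* The Lagrange polynomials 2t^2 - t, 4(t - t^2) and 1 - 3t + 2t^2 for the nodes 1, 1/2, 0, taken at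
   t = L_e. *)
have -> : y = ((2%:R : F) *: (e ** (e ** y)) - e ** y) + (4%:R : F) *: (e ** y - e ** (e ** y))
   + (y - (3%:R : F) *: (e ** y) + (2%:R : F) *: (e ** (e ** y))).
  vring.
apply: (predD Rl); first apply: (predD Rl).
- apply: (R1 i true); split; first by rewrite rpredB ?rpredZ ?ez ?ez.
  by rewrite /Pk; apply: (linear_combination c); vring.
- apply: (R2 i); split; first by rewrite rpredZ ?rpredB ?ez ?ez.
  by rewrite /Ph; apply: (linear_combination (congr1 ( *:%R (-2%:R : F)) c)); vfield.
- apply: (R1 i false); split; first apply: (predD (part_lin i)).
  + by apply: (predB (part_lin i)) => //; apply/memvZ/ez.
  + by apply/memvZ/ez/ez.
  + by rewrite /Pk; apply: (linear_combination c); vring.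
Qed.

Lemma peirce_comm b p w : Pk b p -> e ** (p ** w) = p ** (e ** w).
Proof.
rewrite /Pk => ep; have := superjordan_even two jordanA p w e_even e_even.
by rewrite ee ep => h; case: b ep h => ep h; [apply: (linear_combination h) | apply: (linear_combination (esym h))];
  rewrite !smE /=; vring.
Qed.

Lemma hPM i j b x y : hP i b x -> hP j b y -> hP (i (+) j) b (x ** y).
Proof.
move=> [xi ex] [yj ey]; split; first exact: sm_part.
by rewrite /Pk (peirce_comm _ ex) ey smZr.
Qed.

Lemma hPHM i a b p x : hP i b p -> hH a x -> hH (i (+) a) (p ** x).
Proof.
move=> [pi ep] [xa ex]; split; first exact: sm_part.
by rewrite /Ph (peirce_comm _ ep) ex smZr.
Qed.

Lemma hHZ a c x : hH a x -> hH a (c *: x).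
Proof. by move=> [xa ex]; split; rewrite ?rpredZ // /Ph smZr ex !scalerA mulrC. Qed.

Lemma hHPM i a b p x : hP i b p -> hH a x -> hH (i (+) a) (x ** p).
Proof.
move=> hp hx; rewrite (sc hx.1 hp.1); apply: hHZ; exact: hPHM hp hx.
Qed.

Lemma hPP0 i j b x y : hP i b x -> hP j (~~ b) y -> x ** y = 0.
Proof.
move=> [xi ex] [yj ey].
have e1 : e ** (x ** y) = (~~ b)%:R *: (x ** y) by rewrite (peirce_comm _ ex) ey smZr.
have e2 : e ** (x ** y) = b%:R *: (x ** y).
  by rewrite (sc xi yj) smZr (peirce_comm _ ey) ex smZr !scalerA mulrC.
rewrite e2 in e1; case: b {ex ey e2} e1; rewrite !(scale1r, scale0r) //.
Qed.

Lemma hHH a c x y : hH a x -> hH c y -> e ** (e ** (x ** y)) = e ** (x ** y).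
Proof.
move=> [xa ex] [yc ey]; have := inner_tder e_even xa e y.
rewrite !innerE (sigma_hom _ e_even) ee ey ce ex !smE ex ey !smE => h.
lc h.
Qed.

Lemma pkP a c b x y : hH a x -> hH c y -> hP (a (+) c) b (pk b (x ** y)).
Proof.
move=> hx hy; have ev := sm_part hx.1 hy.1; have := hHH hx hy => h.
have eev := sm_part e_even ev.
split; case: b; rewrite /pk ?rpredB // /Pk.
  by rewrite h scale1r.
by rewrite smDr smNr h subrr scale0r.
Qed.

Lemma pk_dec b m : m = pk b m + pk (~~ b) m.
Proof. by case: b; rewrite /pk /=; vring. Qed.

Lemma pkZ b c m : pk b (c *: m) = c *: pk b m. Proof. by case: b; rewrite /pk; vring. Qed.
(** For x in P_(1/2) this superderivation exchanges P_1 + P_0 and P_(1/2), and on each it is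
    multiplication by x up to scalars on Peirce components. Its Leibniz rule therefore encodes the
    Peirce relations below. *)
Definition dH a x := inner false a e x.
Lemma dH_tder a x : hH a x -> tder 1 a (dH a x).
Proof. by move=> [xa _]; exact: (inner_tder e_even xa). Qed.
Lemma dH_parity a x : hH a x -> parity a (dH a x).
Proof. by move=> [xa _]; exact: (inner_parity e_even xa). Qed.

Lemma dH_int a i b x p : hH a x -> hP i b p -> dH a x p = (half - b%:R) *: (x ** p).
Proof.
move=> hx hp; have [_ h] := hHPM hp hx; rewrite /dH innerE h hp.2 /ssgn expr0 !smE; by vfield.
Qed.

Lemma dH_half a c x y : hH a x -> hH c y -> dH a x y = half *: (pk true (x ** y) - pk false (x ** y)).
Proof. by move=> hx hy; rewrite /dH innerE hy.2 /pk /ssgn expr0 !smE; vfield. Qed.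

Lemma half_sub (b : bool) : half - b%:R != 0 :> F.
Proof.
case: b => /=; last by rewrite mulr0n subr0 invr_eq0.
rewrite subr_eq0; apply/eqP => h.
have := congr1 ( *%R 2%:R) h; rewrite mulfV // mulr1 => /eqP.
by rewrite -subr_eq0 (_ : _ - _ = -1) ?oppr_eq0 ?oner_eq0 //; ring.
Qed.

(** The map p |-> 2 L_p is a homomorphism from P_b to the operators on P_(1/2) with the symmetrized
    product: the Leibniz rule of [dH a x] on p ** q. *)
Lemma peirce_act i j a b p q x : hP i b p -> hP j b q -> hH a x ->
  (p ** q) ** x = p ** (q ** x) + ssgn F i j *: (q ** (p ** x)).
Proof.
move=> hp hq hx; have := dH_tder hx p q.
rewrite (dH_int hx hp) (dH_int hx hq) (dH_int hx (hPM hp hq)) (sigma_hom _ hp.1).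
rewrite (sc hx.1 (sm_part hp.1 hq.1)) (sc hx.1 hp.1) (sc hx.1 hq.1) => h.
have e1 := sc (sm_part hp.1 hx.1) hq.1.
apply/(scalerI (half_sub b)).
have := congr1 ( *:%R (ssgn F a (i (+) j))) h; rewrite !smE e1 => h'.
lc h'.
Qed.

Lemma peirce_cross i j a b p q x : hP i b p -> hP j (~~ b) q -> hH a x ->
  p ** (q ** x) = ssgn F i j *: (q ** (p ** x)).
Proof.
move=> hp hq hx; have := dH_tder hx p q.
rewrite (dH_int hx hp) (dH_int hx hq) (hPP0 hp hq) linear0 (sigma_hom _ hp.1).
rewrite (sc hx.1 hp.1) (sc hx.1 hq.1) => h.
have e1 := sc (sm_part hp.1 hx.1) hq.1.
have := congr1 ( *:%R (ssgn F a (i (+) j))) h; rewrite !smE e1 => h'.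
apply/(scalerI (half_sub b)).
lc h'.
Qed.

(** The two Peirce components of the Leibniz rule of [dH a x] on p ** y; p annihilates the P_(1-b)
    part of x ** y, so the second component involves no third term. *)
Lemma peirce_pi i a c b p x y : hP i b p -> hH a x -> hH c y ->
  p ** (x ** y) = pk b ((p ** x) ** y) + ssgn F a i *: pk b (x ** (p ** y)) /\
  pk (~~ b) ((p ** x) ** y) = ssgn F a i *: pk (~~ b) (x ** (p ** y)).
Proof.
move=> hp hx hy; have hpx := hPHM hp hx; have hpy := hPHM hp hy.
have := dH_tder hx p y.
rewrite (dH_int hx hp) (dH_half hx hy) (dH_half hx hpy) (sigma_hom _ hp.1) (sc hx.1 hp.1) => h.
have z : p ** pk (~~ b) (x ** y) = 0 by apply: hPP0 hp (pkP _ hx hy).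
have zz : p ** (x ** y) = p ** pk b (x ** y) by rewrite {1}(pk_dec b (x ** y)) smDr z addr0.
have eM : e ** (p ** (x ** y)) = b%:R *: (p ** (x ** y)).
  by rewrite zz; exact: (hPM hp (pkP b hx hy)).2.
have k1 := hHH hpx hy; have k2 := hHH hx hpy.
have h1 := congr1 (pk b) h; have h2 := congr1 (pk (~~ b)) h.
have e3 : p ** (half *: (pk true (x ** y) - pk false (x ** y))) = (b%:R - half) *: (p ** (x ** y)).
  by rewrite zz; case: b {h h1 h2 zz hp eM} z => /=; rewrite !smE => ->; vfield.
have h3 : (b%:R - half) *: pk b (x ** (p ** y)) = (half - b%:R) *: (ssgn F a i *: pk b ((p ** x) ** y))
   + ssgn F a i *: ((b%:R - half) *: (p ** (x ** y))).
  move: h1; rewrite !smZl e3; case: (b) eM; rewrite /pk /= !smE => eM; rewrite ?smE ?k1 ?k2 ?eM => h1; lc h1.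
have h4 : (half - b%:R) *: pk (~~ b) (x ** (p ** y)) = (half - b%:R) *: (ssgn F a i *: pk (~~ b) ((p ** x) ** y)).
  move: h2; rewrite !smZl e3; case: (b) eM; rewrite /pk /= !smE => eM; rewrite ?smE ?k1 ?k2 ?eM => h2; lc h2.
split; apply/(scalerI (half_sub b)).
  lc (congr1 ( *:%R (ssgn F a i)) h3).
lc (congr1 ( *:%R (ssgn F a i)) h4).
Qed.

Lemma pr_mull j y z i : y \in part j -> pr i (y ** z) = y ** pr (i (+) j) z.
Proof.
move=> yj; have M l : pr i (y ** pr l z) = if i == (j (+) l) then y ** pr l z else 0.
  have yl := sm_part yj (prP l z).
  case: eqP => [->|/eqP ne]; first exact: pr_id.
  have -> : i = ~~ (j (+) l) by case: i j l ne {yj yl} => [] [] [].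
  exact: pr_neq yl.
rewrite {1}(pr_dec z) smDr linearD /= !M.
by case: i j {yj M} => [] [] /=; rewrite ?(addr0, add0r).
Qed.

Lemma pr_mulr j y z i : y \in part j -> pr i (z ** y) = pr (i (+) j) z ** y.
Proof.
move=> yj; have M l : pr i (pr l z ** y) = if i == (l (+) j) then pr l z ** y else 0.
  have yl := sm_part (prP l z) yj.
  case: eqP => [->|/eqP ne]; first exact: pr_id.
  have -> : i = ~~ (l (+) j) by case: i j l ne {yj yl} => [] [] [].
  exact: pr_neq yl.
rewrite {1}(pr_dec z) smDl linearD /= !M.
by case: i j {yj M} => [] [] /=; rewrite ?(addr0, add0r).
Qed.

Lemma pr_peirce (c : F) z i : e ** z = c *: z -> e ** pr i z = c *: pr i z.
Proof. by move=> h; have := pr_mull z i e_even; rewrite addbF h linearZ /= => <-. Qed.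

Lemma int_half b x : Pk b x -> Ph x -> x = 0.
Proof.
move=> e1 e2; have /eqP := half_sub b; have : (half - b%:R) *: x = 0 by rewrite scalerBl -e1 -e2 subrr.
by move/eqP; rewrite scaler_eq0 => /orP[/eqP//|/eqP].
Qed.

Lemma e_peirce : hP false true e. Proof. by split=> //; rewrite /Pk ee scale1r. Qed.

Lemma peirce_ideal (P : A -> Prop) : linear_pred P -> (forall i z, P z -> P (pr i z)) ->
  (forall i b j p z, hP i b p -> z \in part j -> P z -> P (p ** z)) ->
  (forall i j x z, hH i x -> z \in part j -> P z -> P (x ** z)) ->
  (forall z, P z -> z = 0) \/ (forall z, P z).
Proof.
move=> Pl Ppr P1 P2; apply: ideal_pred => // a z Pz; move: a; apply: peirce_ind.
- split=> [|c u v hu hv]; first by rewrite sm0l; apply: Pl.1.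
  by rewrite smDl smZl; apply: Pl.2.
- move=> i b p hp; rewrite (pr_dec z) smDr; apply: predD => //; apply: P1 hp (prP _ _) (Ppr _ _ Pz).
- move=> i x hx; rewrite (pr_dec z) smDr; apply: predD => //; apply: P2 hx (prP _ _) (Ppr _ _ Pz).
Qed.

(** The annihilator of P_(1/2) inside P_(1/2) is a graded ideal, and it misses e. *)
Lemma half_ann0 z : Ph z -> (forall c y, hH c y -> y ** z = 0) -> z = 0.
Proof.
move=> hz zy; have [||||h|h] := @peirce_ideal (fun z => Ph z /\ forall c y, hH c y -> y ** z = 0).
- split=> [|a u v [hu uy] [hv vy]]; first by split=> [|c y _]; rewrite /Ph ?sm0r ?scaler0.
  split=> [|c y hy]; last by rewrite smDr smZr (uy _ _ hy) (vy _ _ hy) scaler0 addr0.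
  by rewrite /Ph !smE hu hv scalerDr !scalerA mulrC.
- move=> i u [hu uy]; split; first exact: pr_peirce.
  by move=> c y hy; have := pr_mull u (i (+) c) hy.1; rewrite (uy _ _ hy) linear0 -addbA addbb addbF => <-.
- move=> i b j p u hp uj [hu uy]; have hu' : hH j u by split.
  split; first exact: (hPHM hp hu').2.
  move=> c y hy; have [h1 h2] := peirce_pi hp hy hu'.
  have e1 := uy _ _ (hPHM hp hy); rewrite e1 (uy _ _ hy) !sm0r in h1 h2.
  have p0 b' : pk b' 0 = 0 by case: b'; rewrite /pk !sm0r ?subrr.
  rewrite !p0 add0r in h1 h2; rewrite (pk_dec b (y ** _)).
  have s0 (v : A) : 0 = ssgn F c i *: v -> v = 0.
    by move/(congr1 ( *:%R (ssgn F c i))); rewrite scalerA ssgn_sq scaler0 scale1r.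
  by rewrite (s0 _ h1) (s0 _ h2) addr0.
- move=> i j x u hx uj [hu uy]; rewrite (uy _ _ hx); split; first by rewrite /Ph sm0r scaler0.
  by move=> c y _; rewrite sm0r.
- by apply: h; split.
case: e_neq0; have [he _] := h e; exact: int_half e_peirce.2 he.
Qed.

Definition has_half := exists c x, hH c x /\ x <> 0.

(** The elements of P_b that kill P_(1/2) form a graded ideal, proper as P_(1/2) is nonzero. So
    equations in P_b may be tested on P_(1/2). *)
Lemma peirce_faithful b p : has_half -> Pk b p -> (forall c y, hH c y -> p ** y = 0) -> p = 0.
Proof.
move=> [c0 [x0 [hx0 x0n]]] hp py.
have [||||h|h] := @peirce_ideal (fun z => Pk b z /\ forall c y, hH c y -> y ** z = 0).
- split=> [|a u v [hu uy] [hv vy]]; first by split=> [|c y _]; rewrite /Pk ?sm0r ?scaler0.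
  split=> [|c y hy]; last by rewrite smDr smZr (uy _ _ hy) (vy _ _ hy) scaler0 addr0.
  by rewrite /Pk !smE hu hv scalerDr !scalerA mulrC.
- move=> i u [hu uy]; split; first exact: pr_peirce.
  by move=> c y hy; have := pr_mull u (i (+) c) hy.1; rewrite (uy _ _ hy) linear0 -addbA addbb addbF => <-.
- move=> i b' j q u hq uj [hu uy]; have hu' : hP j b u by split.
  have [bb|bb] := eqVneq b' b; last first.
    have {hu'} hu' : hP j (~~ b') u by move: hu'; have -> : ~~ b' = b by case: (b') (b) bb => [] [].
    rewrite (hPP0 hq hu'); split; first by rewrite /Pk sm0r scaler0.
    by move=> c y _; rewrite sm0r.
  rewrite bb in hq; split; first exact: (hPM hq hu').2.
  move=> c y hy; rewrite (sc hy.1 (sm_part hq.1 uj)) (peirce_act hq hu' hy).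
  rewrite (sc uj hy.1) (sc uj (hPHM hq hy).1) (uy _ _ hy) (uy _ _ (hPHM hq hy)).
  by rewrite !scaler0 sm0r addr0 scaler0.
- move=> i j x u hx uj [hu uy]; rewrite (uy _ _ hx); split; first by rewrite /Pk sm0r scaler0.
  by move=> c y _; rewrite sm0r.
- apply: h; split=> // c y hy; rewrite (pr_dec p) smDr !(sc hy.1 (prP _ _)).
  have z i : pr i p ** y = 0.
    by have := pr_mulr p (i (+) c) hy.1; rewrite (py _ _ hy) linear0 -addbA addbb addbF => <-.
  by rewrite !z !scaler0 addr0.
case: x0n; exact: int_half (h _).1 hx0.2.
Qed.

(** B, P_(1/2) and the Peirce components of products of P_(1/2) span a nonzero graded ideal. With B
    = P_1 it follows that P_0 needs no verification of its own. *)
Lemma peirce_gen (B : A -> Prop) : linear_pred B -> (forall i z, B z -> B (pr i z)) ->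
  (forall z, B z -> Pk true z) -> (forall i p z, hP i true p -> B z -> B (p ** z)) ->
  (exists2 z, z <> 0 & B z \/ exists c, hH c z) ->
  forall R, linear_pred R -> (forall z, B z -> R z) -> (forall c x, hH c x -> R x) ->
    (forall a c b x y, hH a x -> hH c y -> R (pk b (x ** y))) -> forall x, R x.
Proof.
move=> Bl Bpr B1 BM [z0 z0n Bz0].
pose Q z := forall R, linear_pred R -> (forall z, B z -> R z) -> (forall c x, hH c x -> R x) ->
    (forall a c b x y, hH a x -> hH c y -> R (pk b (x ** y))) -> R z.
have Ql : linear_pred Q.
  split=> [R [] // |a u v hu hv R Rl RB RH RK]; apply: (Rl.2); [exact: hu | exact: hv].
have QB z : B z -> Q z by move=> Bz R _ RB _ _; apply: RB.
have QH c x : hH c x -> Q x by move=> hx R _ _ RH _; apply: RH hx.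
have QK a c b x y : hH a x -> hH c y -> Q (pk b (x ** y)) by move=> hx hy R _ _ _ RK; apply: RK hx hy.
have pr_hom i k (R : A -> Prop) x : R 0 -> x \in part k -> R x -> R (pr i x).
  move=> R0 xk Rx; have [->|ik] := eqVneq i k; first by rewrite pr_id.
  by have -> : i = ~~ k; [case: (i) (k) ik => [] [] | rewrite pr_neq].
have [|||h|h] := peirce_ideal Ql.
- move=> i z Qz; apply: (Qz (fun z => Q (pr i z))).
  + by split=> [|a u v hu hv]; [rewrite linear0; apply: Ql.1 | rewrite linearP; apply: Ql.2].
  + by move=> u Bu; exact: QB (Bpr _ _ Bu).
  + by move=> c x hx; apply: (pr_hom _ c) (Ql.1) hx.1 _; exact: (QH _ _ hx).
  + by move=> a c b x y hx hy; apply: (pr_hom _ (a (+) c)) (Ql.1) (pkP _ hx hy).1 _; exact: (QK _ _ _ _ _ hx hy).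
- move=> i b j p z hp _ Qz; apply: (Qz (fun z => Q (p ** z))).
  + by split=> [|a u v hu hv]; [rewrite sm0r; apply: Ql.1 | rewrite smDr smZr; apply: Ql.2].
  + move=> u Bu; case: b hp => hp; first exact: QB (BM _ _ _ hp Bu).
    rewrite (pr_dec u) smDr !(hPP0 hp (conj (prP _ _) (B1 _ (Bpr _ _ Bu)))) addr0; exact: Ql.1.
  + by move=> c x hx; exact: (QH _ _ (hPHM hp hx)).
  + move=> a c b' x y hx hy; have hm := pkP b' hx hy.
    have [bb|bb] := eqVneq b' b; last first.
      have {}hm : hP (a (+) c) (~~ b) (pk b' (x ** y)).
        by move: hm; have {1}-> : b' = ~~ b by case: (b') (b) bb => [] [].
      rewrite (hPP0 hp hm); exact: Ql.1.
    have z0' : p ** pk (~~ b) (x ** y) = 0 by apply: hPP0 hp (pkP _ hx hy).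
    have -> : p ** pk b' (x ** y) = p ** (x ** y) by rewrite bb [in RHS](pk_dec b (x ** y)) smDr z0' addr0.
    rewrite (peirce_pi hp hx hy).1; apply: (predD Ql); first exact: (QK _ _ _ _ _ (hPHM hp hx) hy).
    apply: (predZ Ql); exact: (QK _ _ _ _ _ hx (hPHM hp hy)).
- move=> i j x z hx _ Qz; apply: (Qz (fun z => Q (x ** z))).
  + by split=> [|a u v hu hv]; [rewrite sm0r; apply: Ql.1 | rewrite smDr smZr; apply: Ql.2].
  + move=> u Bu; rewrite (pr_dec u) smDr; apply: (predD Ql).
      exact: (QH _ _ (hHPM (conj (prP _ _) (B1 _ (Bpr _ _ Bu))) hx)).
    exact: (QH _ _ (hHPM (conj (prP _ _) (B1 _ (Bpr _ _ Bu))) hx)).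
  + move=> c y hy; rewrite (pk_dec true (x ** y)); apply: (predD Ql); exact: (QK _ _ _ _ _ hx hy).
  + by move=> a c b u v hu hv; exact: (QH _ _ (hHPM (pkP b hu hv) hx)).
- by case: z0n; apply: h; case: Bz0 => [/QB|[c /(QH c)]].
- by move=> R Rl RB RH RK x; apply: h.
Qed.

Lemma peirce_gen1 R : linear_pred R -> (forall i p, hP i true p -> R p) -> (forall c x, hH c x -> R x) ->
  (forall a c x y, hH a x -> hH c y -> R (x ** y)) -> forall x, R x.
Proof.
move=> Rl R1 RH RM; have Bl : linear_pred (Pk true).
  by split=> [|a u v hu hv]; rewrite /Pk ?sm0r ?scaler0 // !smE hu hv; vring.
apply: (peirce_gen Bl) => //.
- by move=> i z; apply: pr_peirce.
- by move=> i p z [_ hp] hz; rewrite /Pk (peirce_comm _ hp) hz smZr.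
- by exists e => //; left; exact: e_peirce.2.
- by move=> z hz; rewrite (pr_dec z); apply: predD => //; apply: R1 (conj (prP _ _) (pr_peirce _ hz)).
- have R1' a c x y : hH a x -> hH c y -> R (pk true (x ** y)) by move=> hx hy; apply: R1 (pkP true hx hy).
  move=> a c [] x y hx hy; first exact: R1' hx hy.
  by apply: (predB Rl); [exact: RM hx hy | exact: R1' hx hy].
Qed.

(** * Half-derivations and the Peirce decomposition *)

Lemma sigma_even r x : x \in part false -> sigma r x = x.
Proof. by move=> x0; rewrite (sigma_hom _ x0) /ssgn andbF expr0 scale1r. Qed.

Lemma tder_e delta r (f : 'End(A)) z : tder delta r f ->
  f (e ** z) = delta *: (f e ** z + e ** f z).
Proof. by move=> df; rewrite df (sigma_even _ e_even). Qed.

Lemma tder_e_eigen delta r (f : 'End(A)) : delta != 0 -> tder delta r f ->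
  e ** f e = (2%:R * delta)^-1 *: f e.
Proof.
move=> d0 df; have h : f e = (2%:R * delta) *: (e ** f e).
  by have := tder_e e df; rewrite ee ce => h; apply: (linear_combination h); vring.
by rewrite [in RHS]h scalerA mulVf ?scale1r // mulf_neq0.
Qed.

Lemma one_half : (1 : F) != half.
Proof. by have := half_sub true; rewrite subr_eq0 eq_sym. Qed.

(** f e is an eigenvector of L_e for 1/(2 delta), which is no Peirce eigenvalue, so f e = 0. Then f
    turns an eigenvalue c into c/delta. This kills P_(1/2), and P_1 too unless delta = 2, where f p
    lies in P_(1/2) and annihilates it. *)
Lemma tder_trivial delta r (f : 'End(A)) : delta != 0 -> delta != half -> delta != 1 ->
  tder delta r f -> forall x, f x = 0.
Proof.
move=> d0 dh d1 df; have dd0 : 2%:R * delta != 0 by rewrite mulf_neq0.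
have e1 : (2%:R * delta)^-1 != 0 by rewrite invr_eq0.
have e2 : (2%:R * delta)^-1 != half.
  apply: contra d1 => /eqP /invr_inj h; apply/eqP/(mulfI two); by rewrite h mulr1.
have e3 : (2%:R * delta)^-1 != 1.
  apply: contra dh => /eqP /(congr1 (fun t => t^-1)); rewrite invrK invr1 => h.
  by apply/eqP/(mulfI two); rewrite h mulfV.
have u0 : f e = 0 by apply: peirce_eigen (tder_e_eigen d0 df) _ _ _.
have fe z : f (e ** z) = delta *: (e ** f z) by rewrite (tder_e _ df) u0 sm0l add0r.
have fH c x : hH c x -> f x = 0.
  move=> [_ hx]; apply: (peirce_eigen (c := (2%:R * delta)^-1)) => //.
  have := fe x; rewrite hx linearZ /= => h.
  have -> : e ** f x = delta^-1 *: (delta *: (e ** f x)) by rewrite scalerA mulVf // scale1r.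
  by rewrite -h !scalerA invfM mulrC.
apply: peirce_gen1.
- by split=> [|a x y hx hy]; rewrite ?linear0 // linearP /= hx hy scaler0 addr0.
- move=> i p hp; have fp : e ** f p = delta^-1 *: f p.
    have := fe p; rewrite hp.2 scale1r => {2}->.
    by rewrite scalerA mulVf // scale1r.
  have [dh'|dh'] := eqVneq delta^-1 half.
    apply: half_ann0; first by rewrite /Ph fp dh'.
    move=> c v hv; have := df v p; rewrite (fH _ _ (hHPM hp hv)) (fH _ _ hv) sm0l add0r.
    rewrite (sigma_hom _ hv.1) smZl scalerA => /esym/eqP; rewrite scaler_eq0 mulf_eq0 (negPf d0).
    by rewrite /ssgn signr_eq0 => /eqP.
  apply: peirce_eigen fp _ _ _ => //; first by rewrite invr_eq0.
  by rewrite -invr1 (inj_eq invr_inj).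
- by move=> c x; apply: fH.
- by move=> a c x y hx hy; rewrite df (fH _ _ hx) (fH _ _ hy) sm0l sm0r addr0 scaler0.
Qed.

Lemma tder_half_scomm r s (f g : 'End(A)) : parity r f -> parity s g -> tder half r f -> tder half s g ->
  forall x, f (g x) = ssgn F r s *: g (f x).
Proof.
move=> fr gs df dg x; apply/eqP; rewrite -subr_eq0 -scommE; apply/eqP.
have h0 : half != 0 by rewrite invr_eq0.
apply: (tder_trivial _ _ _ (scomm_tder fr gs df dg)).
- by rewrite mulf_neq0.
- by rewrite -subr_eq0 -[X in _ - X]mulr1 -mulrBr mulf_neq0 // subr_eq0 eq_sym one_half.
- apply/eqP => h; have : (3%:R : F) = 0; last by apply/eqP.
  have h2 : half * 2%:R = 1 by rewrite mulVf.
  have -> : (3%:R : F) = (2%:R * 2%:R) * (1 - half * half) + (half * 2%:R - 1) * (half * 2%:R + 1) by ring.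
  by rewrite h h2 !subrr mulr0 mul0r addr0.
Qed.

Section HalfDerivation.
Variables (r s : bool) (f : 'End(A)).
Hypotheses (fs : parity s f) (df : tder half r f).

(** The parity s of f and the parity r in its Leibniz rule are kept apart to cover superderivations
    (r = s) as well as odd maps with the rule without signs (r = false, s = true). *)
Lemma half_der_e : hP s true (f e).
Proof.
split; first by have := fs e_even.
have h0 : half != 0 by rewrite invr_eq0.
by rewrite /Pk (tder_e_eigen h0 df) mulfV // invr1.
Qed.

(** The difference of both sides is an eigenvector of L_e for 2, which is distinct from 0, 1/2 and 1
    as 2 and 3 are invertible. *)
Lemma half_der_int p : Pk true p -> f p = f e ** p.
Proof.
move=> hp; have hu := half_der_e.2; apply/eqP; rewrite -subr_eq0; apply/eqP.
apply: (peirce_eigen (c := 2%:R)) => //.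
- have := tder_e p df; rewrite hp scale1r => h; have := peirce_comm p hu; rewrite hp scale1r => h2.
  by rewrite smDr smNr h2; apply: (linear_combination (congr1 ( *:%R (-2%:R : F)) h)); vfield.
- apply/eqP => h; have : (3%:R : F) = 0; last by apply/eqP.
  have h2 : half * 2%:R = 1 by rewrite mulVf.
  rewrite -h in h2; have -> : (3%:R : F) = 2%:R * 2%:R - 1 by ring.
  by rewrite h2 subrr.
- by rewrite -subr_eq0 (_ : _ - _ = 1) ?oner_eq0 //; ring.
Qed.

Lemma half_der_int0 i p : hP i false p -> Pk false (f p).
Proof.
move=> hp; have := tder_e p df; rewrite (hPP0 half_der_e hp) hp.2 !scale0r linear0 add0r => /esym/eqP.
by rewrite scaler_eq0 invr_eq0 (negPf two) /Pk scale0r => /eqP.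
Qed.

Lemma half_der_hP i b p : hP i b p -> hP (i (+) s) b (f p).
Proof.
move=> hp; split; first exact: fs hp.1.
case: b hp => hp; last exact: half_der_int0 hp.
by rewrite (half_der_int hp.2); exact: (hPM half_der_e hp).2.
Qed.

(** So on P_(1/2) f is multiplication by 2 f(e) plus a map into P_1; [pder] and [oder] isolate these
    two behaviours. *)
Lemma half_der_half x : Ph x -> Pk true (f x - (2%:R : F) *: (f e ** x)).
Proof.
move=> hx; have hu := half_der_e.2; have := tder_e x df; rewrite hx linearZ /= => h.
have h2 := peirce_comm x hu; rewrite hx smZr in h2.
rewrite /Pk !smE h2; lc (congr1 ( *:%R (2%:R : F)) h).
Qed.
End HalfDerivation.

(* 1/2-superderivations that preserve, resp. exchange, P_1 + P_0 and P_(1/2). *)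
Definition pder r (f : 'End(A)) := [/\ parity r f, tder half r f & forall x, Ph x -> Ph (f x)].
Definition oder r (f : 'End(A)) := [/\ parity r f, tder half r f, forall i b p, hP i b p -> f p = 0
  & forall x, Ph x -> Pk true (f x)].

Section EvenHalfDerivation.
Variables (r : bool) (f : 'End(A)).
Hypotheses (Pf : pder r f).
Let fr : parity r f. Proof. by case: Pf. Qed.
Let df : tder half r f. Proof. by case: Pf. Qed.

Lemma pder_e : hP r true (f e). Proof. exact: half_der_e fr df. Qed.

Lemma pder_hP i b p : hP i b p -> hP (i (+) r) b (f p). Proof. exact: half_der_hP fr df _ _ _. Qed.

Lemma pder_hH a x : hH a x -> hH (a (+) r) (f x).
Proof. by move=> [xa hx]; split; [exact: fr | case: Pf => _ _; exact]. Qed.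

Lemma pder_half x : Ph x -> f x = (2%:R : F) *: (f e ** x).
Proof.
move=> hx; apply/eqP; rewrite -subr_eq0; apply/eqP/(int_half (half_der_half fr df hx)).
rewrite /Ph !smE (peirce_comm _ pder_e.2) hx; case: Pf => _ _ /(_ _ hx) ->; vring.
Qed.

Lemma pder_act i b a p x : hP i b p -> hH a x -> f (p ** x) = ssgn F r i *: (p ** f x).
Proof.
move=> hp hx; have hu := pder_e; have hpx := hPHM hp hx.
rewrite (pder_half hx.2) (pder_half hpx.2) smZr.
case: b hp => hp; last by rewrite (peirce_cross hu hp hx) !scalerA mulrC.
have h1 := peirce_act hu hp hx; have := df p x.
rewrite (pder_half hpx.2) (half_der_int fr df hp.2) (pder_half hx.2) h1 (sigma_hom _ hp.1) => h.
apply/(scalerI three); lc (congr1 ( *:%R (4%:R : F)) h).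
Qed.

Lemma pder_actl i b a p x : hP i b p -> hH a x -> f p ** x = f (p ** x).
Proof.
move=> hp hx; have := df p x; rewrite (sigma_hom _ hp.1) smZl -(pder_act hp hx) => h.
lc (congr1 ( *:%R (2%:R : F)) h).
Qed.

Lemma pder_comm i b p z : has_half -> hP i b p -> f (p ** z) = ssgn F r i *: (p ** f z).
Proof.
move=> hh hp; move: z; apply: peirce_ind.
- split=> [|a u v hu hv]; first by rewrite sm0r !linear0 ?scaler0.
  by rewrite smDr smZr !linearP /= hu hv; vring.
- move=> j b' z hz; have hfz := pder_hP hz; have [bb|bb] := eqVneq b' b; last first.
    have {bb}bb : b' = ~~ b by case: (b') (b) bb => [] [].
    by rewrite bb in hz hfz; rewrite (hPP0 hp hz) (hPP0 hp hfz) linear0 scaler0.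
  rewrite bb in hz hfz; apply/eqP; rewrite -subr_eq0; apply/eqP.
  have hpz := hPM hp hz; have hfpz := pder_hP hpz; have hpfz := hPM hp hfz.
  apply: (peirce_faithful (b := b) hh).
    by rewrite /Pk !smE hfpz.2 hpfz.2; vring.
  move=> c y hy; have hzy := hPHM hz hy; have hpy := hPHM hp hy.
  rewrite !smE (pder_actl hpz hy) (peirce_act hp hz hy) (peirce_act hp hfz hy).
  rewrite (pder_actl hz hy) (pder_actl hz hpy) linearD linearZ /= (pder_act hp hzy).
  by svfield.
- by move=> a x hx; apply: pder_act hp hx.
Qed.

Lemma pder_eq0 : has_half -> f e = 0 -> forall z, f z = 0.
Proof.
move=> hh u0; have fH x : Ph x -> f x = 0 by move=> hx; rewrite (pder_half hx) u0 sm0l scaler0.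
apply: peirce_ind => [|i b p hp|a x [_ /fH]//].
  by split=> [|a x y hx hy]; rewrite ?linear0 // linearP /= hx hy scaler0 addr0.
apply: (peirce_faithful hh (pder_hP hp).2) => c y hy.
by rewrite (pder_actl hp hy) fH //; exact: (hPHM hp hy).2.
Qed.

(** On P_(1/2), f (f x) = 2 (f e ** f e) ** x; the other Peirce components follow from f (p ** z) =
    p ** f z and faithfulness. *)
Lemma pder_sq0 : r = false -> has_half -> f e ** f e = 0 -> forall z, f (f z) = 0.
Proof.
move=> r0 hh uu; have hu := pder_e; rewrite r0 in hu.
have s1 i : ssgn F r i = 1 by rewrite r0.
have fH a x : hH a x -> f (f x) = 0.
  move=> hx; rewrite (pder_half hx.2) linearZ /= (pder_act hu hx) s1 scale1r (pder_half hx.2) smZr.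
  have := peirce_act hu hu hx; rewrite uu sm0l => h.
  lc (congr1 ( *:%R (2%:R : F)) h).
apply: peirce_ind => [|i b p hp|a x /fH//].
  by split=> [|a x y hx hy]; rewrite ?linear0 // !linearP /= hx hy scaler0 addr0.
case: b hp => hp.
  rewrite (half_der_int fr df hp.2) (_ : f e ** p = p ** f e); last exact: comm_even hu.1.
  by rewrite (pder_comm _ hh hp) (half_der_int fr df hu.2) uu sm0r scaler0.
apply: (peirce_faithful hh (pder_hP (pder_hP hp)).2) => c y hy.
by rewrite (pder_actl (pder_hP hp) hy) (pder_actl hp hy) (fH _ _ (hPHM hp hy)).
Qed.
End EvenHalfDerivation.

Lemma oder_half r f a c y z : oder r f -> hH a y -> hH c z -> f y ** z + ssgn F r a *: (y ** f z) = 0.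
Proof.
move=> [fr df f0 fH] hy hz; have := df y z.
rewrite {1}(pk_dec true (y ** z)) linearD /= (f0 _ _ _ (pkP true hy hz)) (f0 _ _ _ (pkP false hy hz)).
by rewrite (sigma_hom _ hy.1) smZl addr0 => /esym/eqP; rewrite scaler_eq0 invr_eq0 (negPf two) => /eqP.
Qed.

(** The bracket sends P_1 + P_0 to P_(1/2), whereas a 1/2-superderivation preserves P_1 and P_0;
    hence it kills both. *)
Lemma pder_oder r f a x : pder r f -> hH a x -> oder (a (+) r) (scomm a r (dH a x) f).
Proof.
move=> Pf hx; have [fr df fH] := Pf; set g := scomm _ _ _ _.
have gr : parity (a (+) r) g by apply: scomm_parity => //; apply: dH_parity.
have dg : tder half (a (+) r) g by have := scomm_tder (dH_parity hx) fr (dH_tder hx) df; rewrite mul1r.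
have gH i b p : hP i b p -> Ph (g p).
  move=> hp; rewrite /Ph /g scommE (dH_int hx hp) (dH_int hx (pder_hP Pf hp)) [f (_ *: _)]linearZ /=.
  have h1 := (hHPM (pder_hP Pf hp) hx).2; have h2 := fH _ (hHPM hp hx).2.
  by rewrite !smE h1 h2; vring.
have g_e : g e = 0 by apply: int_half (half_der_e gr dg).2 (gH _ _ _ e_peirce).
split=> // [i b p hp|y hy].
  case: b hp => hp; first by rewrite (half_der_int gr dg hp.2) g_e sm0l.
  exact: int_half (half_der_int0 gr dg hp) (gH _ _ _ hp).
by have := half_der_half gr dg hy; rewrite g_e sm0l scaler0 subr0.
Qed.

(** The bracket thus measures on P_(1/2) the defect that must vanish for f to lie in the
    supercentroid. *)
Lemma pder_oderE r f a c x y : pder r f -> hH a x -> hH c y ->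
  scomm a r (dH a x) f y = (half * half) *: (x ** f y - ssgn F a r *: (f x ** y)).
Proof.
move=> Pf hx hy; have [fr df fH] := Pf; have [_ _ _ gH] := pder_oder Pf hx.
have hfx := pder_hH Pf hx; have hfy := pder_hH Pf hy.
have k1 := hHH hx hfy; have k2 := hHH hfx hy.
have m1 := (pder_hP Pf (pkP true hx hy)).2; have m0 := (pder_hP Pf (pkP false hx hy)).2.
have ed : f (dH a x y) = half *: (f (pk true (x ** y)) - f (pk false (x ** y))).
  by rewrite (dH_half hx hy) linearZ linearB.
have := gH _ hy.2; rewrite !(scommE a r (dH a x) f y) !(dH_half hx hfy) ed.
have := df x y; rewrite {1}(pk_dec true (x ** y)) linearD /= (sigma_hom _ hx.1) smZl.
move: (f (pk true _)) (f (pk false _)) m1 m0 => M1 M0; rewrite /Pk scale1r scale0r => m1 m0 h h'.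
have h2 := congr1 (supermul A e) h; rewrite !smE m1 m0 addr0 in h2.
rewrite /pk !smE m1 m0 k1 scale1r in h' *.
have hM : M0 = half *: (f x ** y - e ** (f x ** y) + ssgn F r a *: (x ** f y - e ** (x ** f y))).
  lc (congr2 +%R h (congr1 ( *:%R (-1 : F)) h2)).
rewrite hM h2 in h' *.
lc (congr1 ( *:%R (2%:R : F)) h').
Qed.

(** * Even half-derivations, P_(1/2) nonzero *)

Lemma oder_pderE s g b c y x : oder s g -> hH b y -> hH c x ->
  scomm b s (dH b y) g x = (half - 1) *: (y ** g x).
Proof.
move=> [gs dg g0 gH] hy hx; have hgx : hP (c (+) s) true (g x).
  by split; [apply: gs hx.1 | apply: gH hx.2].
rewrite (scommE b s (dH b y) g x) (dH_int hy hgx) (dH_half hy hx) [g (_ *: _)]linearZ /= [g (_ - _)]linearB /=.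
by rewrite (g0 _ _ _ (pkP true hy hx)) (g0 _ _ _ (pkP false hy hx)) subrr !scaler0 subr0.
Qed.

Lemma oder_pder s g b y : oder s g -> hH b y -> pder (b (+) s) (scomm b s (dH b y) g).
Proof.
move=> Og hy; have [gs dg g0 gH] := Og; split.
- by apply: scomm_parity => //; apply: dH_parity.
- by have := scomm_tder (dH_parity hy) gs (dH_tder hy) dg; rewrite mul1r.
- move=> x hx; have hom i : Ph (scomm b s (dH b y) g (pr i x)).
    have hxi : hH i (pr i x) by split; [apply: prP | apply: pr_peirce].
    rewrite (oder_pderE Og hy hxi).
    have hgx : hP (i (+) s) true (g (pr i x)) by split; [apply: gs hxi.1 | apply: gH hxi.2].
    by rewrite /Ph smZr (hHPM hgx hy).2; vring.
  by rewrite (pr_dec x) linearD /= /Ph smDr !(hom _) scalerDr.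
Qed.

Lemma oder_pder_e s g b y : oder s g -> hH b y ->
  scomm b s (dH b y) g e = (half * half * ssgn F b s) *: g y.
Proof.
move=> [gs dg g0 gH] hy.
rewrite (scommE b s (dH b y) g e) (dH_int hy e_peirce) (g0 _ _ _ e_peirce) linear0 ce hy.2 !linearZ /=.
by vfield.
Qed.

(** All f are allowed so that the images span an ideal: multiplying a single bracket by y in P_(1/2)
    leads to a double one, and a double bracket, itself a [pder], leads back to single brackets of
    itself. *)
Inductive half_op : bool -> 'End(A) -> Prop :=
| odd_op r f a x of pder r f & hH a x : half_op (a (+) r) (scomm a r (dH a x) f)
| even_op r f a x b y of pder r f & hH a x & hH b y :
    half_op (b (+) (a (+) r)) (scomm b (a (+) r) (dH b y) (scomm a r (dH a x) f)).

Lemma half_op_der r k : half_op r k -> parity r k /\ tder half r k.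
Proof.
case=> [{}r f a x Pf hx|{}r f a x b y Pf hx hy]; first by case: (pder_oder Pf hx).
by case: (oder_pder (pder_oder Pf hx) hy).
Qed.

Lemma op_span_linear K : linear_pred (op_span K).
Proof. by split; [exact: op_span0 | exact: op_spanP]. Qed.

Lemma half_op_ideal r k y z : has_half -> half_op r k -> op_span half_op (y ** k z).
Proof.
move=> hh; have Sl := op_span_linear half_op.
have genZ c s l u : half_op s l -> op_span half_op (c *: l u).
  by move=> Kl; apply: (predZ Sl); apply: op_span_gen Kl.
have ind (l : 'End(A)) : (forall i b p j b' q, hP i b p -> hP j b' q -> op_span half_op (p ** l q)) ->
    (forall i b p c x, hP i b p -> hH c x -> op_span half_op (p ** l x)) ->
    (forall a y i b p, hH a y -> hP i b p -> op_span half_op (y ** l p)) ->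
    (forall a y c x, hH a y -> hH c x -> op_span half_op (y ** l x)) ->
    forall y z, op_span half_op (y ** l z).
  move=> h1 h2 h3 h4 {}y {}z; move: y; apply: peirce_ind.
  - split=> [|a u v hu hv]; first by rewrite sm0l; apply: Sl.1.
    by rewrite smDl smZl; apply: Sl.2.
  - move=> i b p hp; move: z; apply: peirce_ind => [|j b' q hq|c x hx]; [|exact: h1 hp hq|exact: h2 hp hx].
    split=> [|a u v hu hv]; first by rewrite linear0 sm0r; apply: Sl.1.
    by rewrite linearP /= smDr smZr; apply: Sl.2.
  - move=> i y hy; move: z; apply: peirce_ind => [|j b' q hq|c x hx]; [|exact: h3 hy hq|exact: h4 hy hx].
    split=> [|a u v hu hv]; first by rewrite linear0 sm0r; apply: Sl.1.
    by rewrite linearP /= smDr smZr; apply: Sl.2.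
case=> {r k}[r f a x Pf hx|r f a x b0 y0 Pf hx hy0].
  have Og := pder_oder Pf hx; have Kg := odd_op Pf hx.
  move: y z; apply: ind => [i b p j b' q hp hq|i b p c z hp hz|c y i b p hy hp|b y c z hy hz].
  - by case: Og => _ _ g0 _; rewrite (g0 _ _ _ hq) sm0r; apply: Sl.1.
  - have [gs dg g0 gH] := Og; have := dg p z; rewrite (g0 _ _ _ hp) sm0l add0r (sigma_hom _ hp.1) => h.
    rewrite (_ : _ ** _ = (2%:R * ssgn F (a (+) r) i) *: scomm a r (dH a x) f (p ** z)); first exact: genZ Kg.
    by rewrite h smZl; svfield.
  - by case: Og => _ _ g0 _; rewrite (g0 _ _ _ hp) sm0r; apply: Sl.1.
  - rewrite (_ : _ ** _ = (- 2%:R : F) *: scomm b (a (+) r) (dH b y) (scomm a r (dH a x) f) z).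
      exact: genZ (even_op Pf hx hy).
    by rewrite (oder_pderE Og hy hz); vfield.
have Kk := even_op Pf hx hy0; have Pk' := oder_pder (pder_oder Pf hx) hy0.
move: (scomm b0 _ _ _) (b0 (+) _) Kk Pk' => k t Kk Pk'.
move: y z; apply: ind => [i b p j b' q hp hq|i b p c z hp hz|c y i b p hy hp|b y c z hy hz].
- rewrite (_ : _ ** _ = ssgn F t i *: k (p ** q)); first exact: genZ Kk.
  by rewrite (pder_comm Pk' _ hh hp) scalerA ssgn_sq scale1r.
- rewrite (_ : _ ** _ = ssgn F t i *: k (p ** z)); first exact: genZ Kk.
  by rewrite (pder_comm Pk' _ hh hp) scalerA ssgn_sq scale1r.
- rewrite (sc hy.1 (pder_hP Pk' hp).1) (pder_actl Pk' hp hy); exact: genZ Kk.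
- rewrite (_ : _ ** _ = ssgn F b t *: k (y ** z) + (2%:R : F) *: scomm b t (dH b y) k z).
    by apply: (predD Sl); [exact: genZ Kk | exact: genZ (odd_op Pk' hy)].
  have [_ dk _] := Pk'; rewrite (pder_oderE Pk' hy hz) dk (sigma_hom _ hy.1).
  by svfield.
Qed.

Lemma odd_tder_sq0 k : parity true k -> tder half true k -> forall x, k (k x) = 0.
Proof.
move=> kt dk x; have := tder_half_scomm kt kt dk dk x; rewrite /ssgn expr1 scaleN1r => h.
by apply: (scalerI two); rewrite scaler0; apply: (linear_combination h); vring.
Qed.

Lemma nilpotent_sq0 (k : 'End(A)) : (forall x, k (k x) = 0) -> nilpotent k.
Proof. by move=> h; exists 2%N. Qed.

Section Nilpotence.
Hypothesis charF0 : [pchar F] =i pred0.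
Hypothesis hh : has_half.

(* k (g y) = g (k y) and, as k x = 0, also k (g y) = g (k y) / 2. *)
Lemma odd_pder_nil f x y k c : pder true f -> hH false x -> hH true y -> pder false k ->
  k e = c *: scomm false true (dH false x) f y -> nilpotent k.
Proof.
move=> Pf hx hy Pk' ke; have Og := pder_oder Pf hx; have gE := pder_oderE Pf hx.
move: (scomm _ _ _ _) Og gE ke => g Og gE ke; rewrite addFb in Og.
have [gs dg g0 gH] := Og; have [fr df fH] := Pf; have [kr dk kH] := Pk'.
have s1 b : ssgn F false b = 1 by [].
have gx : g x = 0.
  by rewrite (gE _ _ hx) s1 scale1r -(comm_even (f x) hx.1) subrr scaler0.
have wx : g y ** x = 0 by have := oder_half Og hy hx; rewrite gx sm0r scaler0 addr0.
have kx : k x = 0 by rewrite (pder_half Pk' hx.2) ke smZl wx !scaler0.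
have kf z : k (f z) = f (k z) by rewrite (tder_half_scomm kr fr dk df) s1 scale1r.
have kg z : k (g z) = g (k z) by rewrite (tder_half_scomm kr gs dk dg) s1 scale1r.
have hky : hH true (k y) by have := pder_hH Pk' hy; rewrite addbF.
have kgy : k (g y) = half *: g (k y).
  rewrite (gE _ _ hy) (gE _ _ hky) s1 !scale1r linearZ linearB /= !dk !sigma0 kx !kf kx linear0 !sm0l.
  vring.
have kgy0 : k (g y) = 0 by have := kgy; rewrite -kg => h; lc (congr1 ( *:%R (2%:R : F)) h).
have ww : k e ** k e = 0.
  by rewrite {2}ke smZr -(half_der_int kr dk (gH _ hy.2)) kgy0 scaler0.
exact: nilpotent_sq0 (pder_sq0 Pk' (erefl false) hh ww).
Qed.

(** By the Jacobi identity the commutator of [D0] with f is a signed difference of the double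
    brackets [kxy] and [kyx]. By [anti] they add up, so [kxy] is the commutator of [D0] with f/2,
    and [commutator_nilpotent] applies. *)
Lemma even_pder_nil f a x y : pder false f -> hH a x -> hH a y ->
  nilpotent (scomm a (a (+) false) (dH a y) (scomm a false (dH a x) f)).
Proof.
move=> Pf hx hy; have [fr df fH] := Pf.
have Ox := pder_oder Pf hx; have Oy := pder_oder Pf hy.
have Pxy := oder_pder Ox hy; have Pyx := oder_pder Oy hx.
have exy := oder_pder_e Ox hy; have eyx := oder_pder_e Oy hx.
have gxE := pder_oderE Pf hx hy; have gyE := pder_oderE Pf hy hx.
rewrite !addbF addbb in Ox Oy Pxy Pyx exy eyx *.
pose gx := scomm a false (dH a x) f; pose gy := scomm a false (dH a y) f.
pose kxy := scomm a a (dH a y) gx; pose kyx := scomm a a (dH a x) gy.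
rewrite -/gx -/gy -/kxy -/kyx in Ox Oy Pxy Pyx exy eyx gxE gyE *.
pose D0 := scomm a a (dH a y) (dH a x).
have D0p : parity false D0 by have := scomm_parity (dH_parity hy) (dH_parity hx); rewrite addbb.
have D0d : tder 1 false D0.
  by have := scomm_tder (dH_parity hy) (dH_parity hx) (dH_tder hy) (dH_tder hx); rewrite addbb mul1r.
have anti z : kyx z = - ssgn F a a *: kxy z.
  pose m := (kyx + ssgn F a a *: kxy)%VF.
  have mE u : m u = kyx u + ssgn F a a *: kxy u.
    by rewrite /m (add_lfunE kyx) (scale_lfunE (ssgn F a a) kxy).
  suff m0 : m z = 0 by apply/eqP; rewrite -subr_eq0 scaleNr opprK -mE m0.
  (* A [pder] is determined by its value at e, which for both brackets is explicit. *)
  move: z; apply: (@pder_eq0 false) => //.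
    have [[p1 d1 h1] [p2 d2 h2]] := (Pyx, Pxy); split.
    - move=> i u ui; rewrite mE; apply: (predD (part_lin _)); first exact: p1.
      by apply/memvZ/p2.
    - by move=> u v; rewrite !mE d1 d2 !sigma0; vring.
    - by move=> u hu; rewrite mE /Ph !smE (h1 _ hu) (h2 _ hu); vring.
  rewrite mE exy eyx gxE gyE.
  rewrite (sc hy.1 (fr _ _ hx.1)) (sc (fr _ _ hy.1) hx.1) !addbF.
  by svfield.
have DU z : D0 ((half *: f)%VF z) = (half *: f)%VF (D0 z) + kxy z.
  have kE u : kxy u = dH a y (gx u) - ssgn F a a *: gx (dH a y u) by exact: scommE.
  have kE' u : kyx u = dH a x (gy u) - ssgn F a a *: gy (dH a x u) by exact: scommE.
  have gE u : gx u = dH a x (f u) - f (dH a x u).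
    by rewrite [gx u](scommE a false (dH a x) f) /ssgn andbF expr0 scale1r.
  have gE' u : gy u = dH a y (f u) - f (dH a y u).
    by rewrite [gy u](scommE a false (dH a y) f) /ssgn andbF expr0 scale1r.
  have DE u : D0 u = dH a y (dH a x u) - ssgn F a a *: dH a x (dH a y u) by exact: scommE.
  have := anti z; rewrite kE' kE !gE !gE' !linearB /= => h.
  have fB u v : f (u - ssgn F a a *: v) = f u - ssgn F a a *: f v by rewrite linearB linearZ.
  rewrite !(scale_lfunE half f) [D0 (_ *: _)]linearZ /= (DE (f z)) (DE z) fB.
  lc (congr1 ( *:%R (half * ssgn F a a)) h).
have [kp kd _] := Pxy.
have UC z : kxy ((half *: f)%VF z) = (half *: f)%VF (kxy z).
  by rewrite !(scale_lfunE half f) [kxy (_ *: _)]linearZ /= (tder_half_scomm kp fr kd df) scale1r.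
apply: (commutator_nilpotent charF0 DU UC) => z.
have mp := scomm_parity D0p kp; have md := scomm_tder D0p kp D0d kd; rewrite mul1r in md.
have := tder_half_scomm mp kp md kd z.
by rewrite (scommE false false D0 kxy) (scommE false false D0 kxy) /ssgn !expr0 !scale1r linearB.
Qed.

(** A single bracket maps P_(1/2) into P_1 and kills P_1 + P_0. An odd operator supercommutes with
    itself, so its square is zero. An even double bracket has f even with x, y of equal parity, or f
    odd with opposite parities. *)
Lemma half_op_nil r k : half_op r k -> nilpotent k.
Proof.
move=> Kk; have := half_op_der Kk; case: Kk => {r k}[r f a x Pf hx|r f a x b y Pf hx hy] [kr dk].
  apply: nilpotent_sq0; have [gs dg g0 gH] := pder_oder Pf hx.
  apply: peirce_ind => [|i b p hp|c z hz].
  - by split=> [|c u v hu hv]; rewrite ?linear0 // !linearP /= hu hv scaler0 addr0.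
  - by rewrite (g0 _ _ _ hp) linear0.
  - by apply: (g0 (c (+) (a (+) r)) true); split; [apply: gs hz.1 | apply: gH hz.2].
have Og := pder_oder Pf hx; have Pk' := oder_pder Og hy; have ke := oder_pder_e Og hy.
case: r Pf kr dk Og Pk' ke => Pf kr dk Og Pk' ke; last first.
  have [ab|ab] := eqVneq b a.
    by rewrite ab in hy *; apply: even_pder_nil.
  have ab' : b (+) (a (+) false) = true by case: (b) (a) ab => [] [].
  by rewrite ab' in kr dk; apply/nilpotent_sq0/odd_tder_sq0.
have [ab|ab] := eqVneq b a.
  have ab' : b (+) (a (+) true) = true by rewrite ab; case: (a).
  by rewrite ab' in kr dk; apply/nilpotent_sq0/odd_tder_sq0.
have ab' : b (+) (a (+) true) = false by case: (b) (a) ab => [] [].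
rewrite ab' in Pk'; case: a b ab hx hy ab' {kr dk} Og Pk' ke => [] [] // _ hx hy _ Og Pk' ke.
  apply: (odd_pder_nil (c := half * half) Pf hy hx Pk').
  rewrite ke mulr1; congr (_ *: _).
  have hfx := pder_hH Pf hx; have hfy := pder_hH Pf hy.
  rewrite (pder_oderE Pf hx hy) (pder_oderE Pf hy hx) (comm_even (f x) hy.1).
  by rewrite (sc hfy.1 hx.1); svfield.
exact: (odd_pder_nil Pf hx hy Pk' ke).
Qed.

Lemma half_op0 r k : half_op r k -> k = 0.
Proof.
apply: nil_supercommuting_ideal => {r k}[r k /half_op_der[] //|r s k l|r k|r k y z].
- move=> /half_op_der[kr dk] /half_op_der[ls dl]; apply/lfunP => z.
  by rewrite scommE (tder_half_scomm kr ls dk dl) subrr lfunE.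
- exact: half_op_nil.
- exact: half_op_ideal.
Qed.

Lemma pder_centroid r f : pder r f -> forall y z, f (y ** z) = sigma r y ** f z.
Proof.
move=> Pf y z; have [fr df fH] := Pf; move: y; apply: peirce_ind.
- split=> [|a u v hu hv]; first by rewrite sm0l !linear0 sm0l.
  by rewrite smDl smZl !linearP /= hu hv smDl smZl.
- by move=> i b p hp; rewrite (sigma_hom _ hp.1) smZl (pder_comm Pf z hh hp).
move=> a y hy; rewrite (sigma_hom _ hy.1) smZl; move: z; apply: peirce_ind.
- split=> [|c u v hu hv]; first by rewrite sm0r !linear0 ?scaler0.
  by rewrite smDr smZr !linearP /= hu hv; vring.
- move=> i b p hp; have hfp := pder_hP Pf hp.
  by rewrite (sc hy.1 hp.1) linearZ /= -(pder_actl Pf hp hy) (sc hfp.1 hy.1); svfield.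
move=> c z hz; have := half_op0 (odd_op Pf hy) => /(congr1 (fun g : 'End(A) => g z)).
rewrite (pder_oderE Pf hy hz) zero_lfunE => h.
rewrite df (sigma_hom _ hy.1).
lc (congr1 ( *:%R (2%:R * ssgn F a r)) h).
Qed.

(** The bracket k of g with [dH b y] is a [pder], so its kernel is a graded ideal. As k k = 0 this
    ideal is not zero, whence k = 0; and k e is a nonzero multiple of g y. *)
Lemma oder_even0 g : oder false g -> forall y, g y = 0.
Proof.
move=> Og; have [gs dg g0 gH] := Og; apply: peirce_ind => [|i b p|b y hy]; last 1 first.
- have Pk' := oder_pder Og hy; have ke := oder_pder_e Og hy.
  have ckk := pder_centroid Pk'; have [kr dk kH] := Pk'.
  move: (scomm _ _ _ _) ckk kr dk kH Pk' ke => k; rewrite addbF => ckk kr dk kH Pk' ke.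
  have kk z : k (k z) = 0.
    case: b hy ckk kr dk Pk' ke => hy ckk kr dk Pk' ke; first exact: odd_tder_sq0.
    have gyy : g y ** y = 0.
      have := oder_half Og hy hy; rewrite scale1r (comm_even (g y) hy.1) => h.
      by apply: (scalerI two); rewrite scaler0; apply: (linear_combination h); vring.
    have ky : k y = 0 by rewrite (pder_half Pk' hy.2) ke smZl gyy !scaler0.
    have kg : k (g y) = 0 by rewrite (tder_half_scomm kr gs dk dg) ky linear0 scaler0.
    apply: (pder_sq0 Pk' (erefl false) hh).
    by rewrite {2}ke smZr -(half_der_int kr dk (gH _ hy.2)) kg scaler0.
  have k0 z : k z = 0.
    have [|||h|h] := @ideal_pred (fun z => k z = 0).
    - by split=> [|c u v hu hv]; rewrite ?linear0 // linearP /= hu hv scaler0 addr0.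
    - move=> i u ku; have := ku; rewrite {1}(pr_dec u) linearD /= => /eqP; rewrite addr_eq0 => /eqP h.
      have e1 := kr _ _ (prP false u); have e2 := kr _ _ (prP true u).
      have z1 : k (pr false u) = 0.
        by apply: part_disj e1 _; rewrite h rpredN; move: e2; rewrite addTb addFb.
      case: i; last exact: z1.
      by apply: oppr_inj; rewrite -h z1 oppr0.
    - by move=> c u ku; rewrite ckk ku sm0r.
    - by apply: h; apply: kk.
    - exact: h.
  have := k0 e; rewrite ke => /eqP; rewrite scaler_eq0 !mulf_eq0 invr_eq0 (negPf two) /= /ssgn signr_eq0.
  by move/eqP.
- by split=> [|c u v hu hv]; rewrite ?linear0 // linearP /= hu hv scaler0 addr0.
- exact: g0.
Qed.
End Nilpotence.

(** * Even half-derivations, unital case *)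

(** The operator U_(2e-1) when e is part of a unital algebra: 8t^2 - 8t + 1 at t = L_e is 1 on P_1 +
    P_0 and -1 on P_(1/2). It is an automorphism because the Peirce rules give a grading modulo
    2. *)
Definition peirce_aut : 'End(A) := (\1 - 8%:R *: lmul e + 8%:R *: (lmul e \o lmul e))%VF.
Local Notation tau := peirce_aut.

Lemma peirce_autE x : tau x = x - (8%:R : F) *: (e ** x) + (8%:R : F) *: (e ** (e ** x)).
Proof. by rewrite !add_lfunE opp_lfunE !scale_lfunE comp_lfunE id_lfunE !lmulE. Qed.

Lemma peirce_aut_int b x : Pk b x -> tau x = x.
Proof. by rewrite /Pk => h; rewrite peirce_autE h smZr h; case: b {h}; vring. Qed.

Lemma peirce_aut_half x : Ph x -> tau x = - x.
Proof. by rewrite /Ph => h; rewrite peirce_autE h smZr h; vfield. Qed.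

Lemma peirce_autK x : tau (tau x) = x.
Proof.
move: x; apply: peirce_ind => [|i b p [_ hp]|a x [_ hx]].
- by split=> [|a x y hx hy]; rewrite ?linear0 // !linearP /= hx hy.
- by rewrite !(peirce_aut_int hp).
- by rewrite (peirce_aut_half hx) linearN /= (peirce_aut_half hx) opprK.
Qed.

Lemma peirce_autM x y : tau (x ** y) = tau x ** tau y.
Proof.
have lin1 z : linear_pred (fun x => tau (z ** x) = tau z ** tau x).
  split=> [|a u v hu hv]; first by rewrite sm0r !linear0.
  by rewrite smDr smZr !linearP /= hu hv; vring.
move: x; apply: peirce_ind => [|i b p hp|a x hx].
- split=> [|a u v hu hv]; first by rewrite sm0l !linear0 sm0l.
  by rewrite smDl smZl !linearP /= hu hv; vring.
- move: y; apply: peirce_ind => // [j c q hq|c y hy]; rewrite (peirce_aut_int hp.2).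
    rewrite (peirce_aut_int hq.2); have [bc|bc] := eqVneq c b.
      by rewrite bc in hq; exact: peirce_aut_int (hPM hp hq).2.
    have {bc} bc : c = ~~ b by case: (c) (b) bc => [] [].
    by rewrite bc in hq; rewrite (hPP0 hp hq) linear0.
  by rewrite (peirce_aut_half hy.2) (peirce_aut_half (hPHM hp hy).2) smNr.
- move: y; apply: peirce_ind => // [j c q hq|c y hy]; rewrite (peirce_aut_half hx.2).
    by rewrite (peirce_aut_int hq.2) (peirce_aut_half (hHPM hq hx).2) smNl.
  rewrite (peirce_aut_half hy.2) smNl smNr opprK {1}(pk_dec true (x ** y)) linearD /=.
  by rewrite (peirce_aut_int (pkP true hx hy).2) (peirce_aut_int (pkP false hx hy).2) -pk_dec.
Qed.

Lemma peirce_aut_parity i x : x \in part i -> tau x \in part i.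
Proof.
move=> xi; have ez z : z \in part i -> e ** z \in part i by move=> zi; exact: (sm_part e_even zi).
rewrite peirce_autE; apply: (predD (part_lin i)); last exact/memvZ/ez/ez.
by apply: (predB (part_lin i)) => //; exact/memvZ/ez.
Qed.

(** Averaging f with plus or minus its conjugate by [tau], which preserves the rule without signs,
    separates the two behaviours on P_(1/2). *)
Lemma half_der_split s f : parity s f -> tder half false f -> exists g h : 'End(A),
  [/\ parity s g, tder half false g & forall x, Ph x -> Ph (g x)] /\
  [/\ parity s h, tder half false h, forall i b p, hP i b p -> h p = 0 & forall x, Ph x -> Pk true (h x)]
  /\ forall x, f x = g x + h x.
Proof.
move=> fs df; pose f' : 'End(A) := (tau \o f \o tau)%VF.
have f'E x : f' x = tau (f (tau x)) by rewrite !comp_lfunE.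
have ex (c : F) : exists g : 'End(A), [/\ forall x, g x = half *: (f x + c *: f' x), parity s g & tder half false g].
  exists (half *: (f + c *: f'))%VF.
  have gE x : (half *: (f + c *: f'))%VF x = half *: (f x + c *: f' x).
    by rewrite scale_lfunE add_lfunE scale_lfunE.
  split=> //.
    move=> i x xi; rewrite gE; apply/memvZ/(predD (part_lin _)); first exact: fs.
    by apply: memvZ; rewrite f'E; apply/peirce_aut_parity/fs/peirce_aut_parity.
  have tauD u v : tau (half *: (u + v)) = half *: (tau u + tau v) by rewrite linearZ linearD.
  move=> x y; rewrite !gE !f'E peirce_autM !df !sigma0 tauD !peirce_autM !peirce_autK.
  vring.
have [g [gE gs dg]] := ex 1; have [h [hE hs dh]] := ex (-1).
have fH x : Ph x -> f' x = 2%:R *: (f e ** x) - (f x - 2%:R *: (f e ** x)).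
  move=> hx; have h1 := half_der_half fs df hx; have hu := half_der_e fs df.
  have h2 : Ph (2%:R *: (f e ** x)) by rewrite /Ph !smE (peirce_comm _ hu.2) hx; vring.
  rewrite f'E (peirce_aut_half hx) linearN /= -{1}(subrK (2%:R *: (f e ** x)) (f x)) linearN linearD /=.
  by rewrite (peirce_aut_int h1) (peirce_aut_half h2); vring.
exists g, h; do !split=> //.
- move=> x hx; have hu := half_der_e fs df.
  rewrite gE (fH _ hx) (_ : _ *: _ = 2%:R *: (f e ** x)); last by vfield.
  by rewrite /Ph !smE (peirce_comm _ hu.2) hx; vring.
- move=> i b p hp; rewrite hE f'E (peirce_aut_int hp.2) (peirce_aut_int (half_der_hP fs df hp).2).
  by rewrite scaleN1r subrr scaler0.
- move=> x hx; rewrite hE (fH _ hx) (_ : _ *: _ = f x - 2%:R *: (f e ** x)); last by vfield.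
  exact: (half_der_half fs df hx).
- by move=> x; rewrite gE hE; vfield.
Qed.

Lemma half_der_centroid f : [pchar F] =i pred0 -> has_half -> parity false f -> tder half false f ->
  forall y z, f (y ** z) = y ** f z.
Proof.
move=> charF0 hh fs df y z; have [g [h [Pg [Oh fE]]]] := half_der_split fs df.
by rewrite !fE !(oder_even0 charF0 hh Oh) !addr0 (pder_centroid charF0 hh Pg) sigma0.
Qed.

Lemma peirce_unit : ~ has_half -> forall x, e ** x = x.
Proof.
move=> nh; have h0 c x : hH c x -> x = 0 by move=> hx; apply: NNPP => xn; apply: nh; exists c, x.
apply: peirce_gen1.
- by split=> [|a x y hx hy]; rewrite ?sm0r // !smE hx hy.
- by move=> i p [_]; rewrite /Pk scale1r.
- by move=> c x /h0 ->; rewrite sm0r.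
- by move=> a c x y /h0 -> _; rewrite sm0l sm0r.
Qed.

Section Unital.
Hypothesis unit : forall x, e ** x = x.

Let unitr x : x ** e = x. Proof. by rewrite ce unit. Qed.

Lemma unit_half_der r f x : parity r f -> tder half r f -> f x = f e ** x.
Proof. by move=> fr df; apply: (half_der_int fr df); rewrite /Pk unit scale1r. Qed.

Inductive unit_op : bool -> 'End(A) -> Prop :=
| UnitOp r f i x j y of parity r f & tder half r f & x \in part i & y \in part j :
    unit_op ((i (+) j) (+) r) (scomm (i (+) j) r (inner i j x y) f).

Lemma unit_op_der r k : unit_op r k -> parity r k /\ tder half r k.
Proof.
case=> {r k}r f i x j y fr df xi yj; split; first exact: scomm_parity (inner_parity xi yj) fr.
by have := scomm_tder (inner_parity xi yj) fr (inner_tder xi yj) df; rewrite mul1r.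
Qed.

(** Evaluation at the unit: f is multiplication by f e, and [L_x, L_y] kills e, so only the defect
    of f at x, y is left. *)
Lemma unit_op_e r f i x j y : parity r f -> tder half r f -> x \in part i -> y \in part j ->
  f x ** y - ssgn F r i *: (x ** f y) =
  - ssgn F r (i (+) j) *: scomm (i (+) j) r (inner i j x y) f e.
Proof.
move=> fr df xi yj; have ur : f e \in part r := fr _ _ e_even.
have z0 : x ** y - ssgn F i j *: (y ** x) = 0 by rewrite (sc xi yj) subrr.
rewrite (scommE (i (+) j) r (inner i j x y) f) !innerE !unitr z0 linear0.
rewrite (unit_half_der x fr df) (unit_half_der y fr df) (sc ur xi) (sc ur yj).
by rewrite smZl smZr (sc (sm_part xi ur) yj); svfield.
Qed.

Lemma unit_op_ideal r k y z : unit_op r k -> op_span unit_op (y ** k z).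
Proof.
move=> Kk; have [kr dk] := unit_op_der Kk; have Sl := op_span_linear unit_op.
have hom i j u v : u \in part i -> v \in part j -> op_span unit_op (u ** k v).
  move=> ui vj; have h := unit_op_e kr dk ui vj.
  rewrite (_ : _ ** _ = ssgn F r i *: k (u ** v) + (half * ssgn F r i * ssgn F r (i (+) j)) *:
    scomm (i (+) j) r (inner i j u v) k e).
    apply: (predD Sl); apply: (predZ Sl); first exact: op_span_gen Kk.
    exact: op_span_gen (UnitOp kr dk ui vj).
  rewrite dk (sigma_hom _ ui) smZl; move: (scomm _ _ _ _ _) h => w h.
  lc (congr1 ( *:%R (half * ssgn F r i)) h).
rewrite (pr_dec y) (pr_dec z) linearD /= !smE.
by apply: (predD Sl); apply: (predD Sl); exact: (hom _ _ _ _ (prP _ _) (prP _ _)).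
Qed.

(** The composite f k is not a 1/2-superderivation, yet supercommutation makes it multiplication by
    its value at e. *)
Lemma half_element r s f k z : parity r f -> tder half r f -> parity s k -> tder half s k ->
  f (k e) ** z = f (k z).
Proof.
move=> fr df ks dk; have := df (k e) z; have := tder_half_scomm fr ks df dk z.
rewrite (sigma_hom _ (ks _ _ e_even)) smZl -!(unit_half_der _ ks dk) addFb => -> h.
lc (congr1 ( *:%R (2%:R : F)) h).
Qed.

Section UnitalNilpotence.
Hypothesis charF0 : [pchar F] =i pred0.

(* D_z = [L_u, L_z] kills every k e, and its values have that form, so D_y D_x = 0. *)
Lemma odd_unit_nil f x y : parity true f -> tder half true f -> x \in part false -> y \in part true ->
  nilpotent (scomm true true (inner false true x y) f).
Proof.
move=> fr df xi yj; have ur : f e \in part true := fr _ _ e_even.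
pose D i z : 'End(A) := inner true i (f e) z.
have Dder i z : z \in part i -> tder 1 (true (+) i) (D i z) by move=> zi; exact: inner_tder.
have DE i z w : z \in part i -> D i z w = half *: (f z ** w - ssgn F true i *: (z ** f w)).
  move=> zi; rewrite /D innerE -!(unit_half_der _ fr df) df (sigma_hom _ zi) smZl; by svfield.
have Dk i z s k : z \in part i -> parity s k -> tder half s k -> D i z (k e) = 0.
  move=> zi ks dk; have kes : k e \in part s := ks _ _ e_even.
  rewrite (DE _ _ _ zi) (sc (fr _ _ zi) kes) (sc zi (fr _ _ kes)) (half_element _ fr df ks dk).
  have := tder_half_scomm fr ks df dk z; rewrite -(unit_half_der (f z) ks dk) => ->.
  by svfield.
have DD i z j v k w : z \in part i -> v \in part j -> w \in part k -> D i z (D j v w) = 0.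
  move=> zi vj wk; have ks := scomm_parity (inner_parity vj wk) fr.
  have dk := scomm_tder (inner_parity vj wk) fr (inner_tder vj wk) df; rewrite mul1r in dk.
  rewrite (DE _ _ _ vj) (unit_op_e fr df vj wk) scalerA [D i z (_ *: _)]linearZ /=.
  by rewrite (Dk _ _ _ _ zi ks dk) scaler0.
have Dxx : D false x x = 0.
  by rewrite (DE _ _ _ xi) scale1r (comm_even (f x) xi) subrr scaler0.
have Dyx : D true y x = - D false x y.
  rewrite (DE _ _ _ xi) (DE _ _ _ yj) (comm_even (f y) xi : _ = f y ** x).
  by rewrite (sc yj (fr _ _ xi)); svfield.
pose k := scomm true true (inner false true x y) f.
have ks : parity false k := scomm_parity (inner_parity xi yj) fr.
have dk : tder half false k.
  by have := scomm_tder (inner_parity xi yj) fr (inner_tder xi yj) df; rewrite mul1r.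
have ke : D false x y = half *: k e.
  by rewrite (DE _ _ _ xi) (unit_op_e fr df xi yj) -/k; svfield.
have ww : k e ** k e = 0.
  have := DD _ _ _ _ _ _ yj xi (sm_part xi yj).
  rewrite (Dder _ _ xi x y) Dxx sm0l add0r scale1r (sigma_even _ xi) (Dder _ _ yj) (sigma_even _ xi).
  rewrite (DD _ _ _ _ _ _ yj xi yj) sm0r addr0 scale1r Dyx ke smNl smZl smZr => /eqP.
  by rewrite oppr_eq0 !scaler_eq0 invr_eq0 (negPf two) => /eqP.
apply: nilpotent_sq0 => z.
by rewrite -(half_element z ks dk ks dk) (unit_half_der (k e) ks dk) ww sm0l.
Qed.

Lemma unit_op_nil r k : unit_op r k -> nilpotent k.
Proof.
move=> Kk; have := unit_op_der Kk; case: Kk => {r k}r f i x j y fr df xi yj [kr dk].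
case: r fr df kr dk => fr df kr dk.
  case ij: (i (+) j) kr dk => kr dk; last exact/nilpotent_sq0/odd_tder_sq0.
  case: i xi ij {kr dk} => xi; case: j yj => // yj _; last exact: odd_unit_nil.
  have [n hn] := odd_unit_nil fr df yj xi; exists n => z.
  have kE u : scomm true true (inner true false x y) f u = - scomm true true (inner false true y x) f u.
    rewrite (scommE true true (inner true false x y) f) (scommE true true (inner false true y x) f) !innerE.
    by rewrite !linearB linearZ /= /ssgn !expr0 !scale1r; vring.
  suff -> : iter n (scomm true true (inner true false x y) f) z =
      (-1) ^+ n *: iter n (scomm true true (inner false true y x) f) z by rewrite hn scaler0.
  elim: n {hn} => [|n IH]; first by rewrite scale1r.
  by rewrite !iterS IH kE linearZ /= exprS mulN1r scaleNr.
case ij: (i (+) j) kr dk => kr dk; first exact/nilpotent_sq0/odd_tder_sq0.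
pose d := inner i j x y; pose k := scomm false false d f; rewrite -/d -/k in kr dk *.
have d0 : parity false d by rewrite -ij; exact: inner_parity.
have dd : tder 1 false d by rewrite -ij; exact: inner_tder.
have kE z : k z = d (f z) - f (d z) by rewrite [k z](scommE false false d f) /ssgn expr0 scale1r.
apply: (@commutator_nilpotent charF0 d f k) => z.
- by rewrite kE addrC subrK.
- by rewrite (tder_half_scomm kr fr dk df) scale1r.
have mp := scomm_parity d0 kr; have md := scomm_tder d0 kr dd dk; rewrite mul1r in md.
have := tder_half_scomm mp kr md dk z.
by rewrite !(scommE false false d k) /ssgn !expr0 !scale1r linearB.
Qed.

Lemma unit_centroid f y z : parity false f -> tder half false f -> f (y ** z) = y ** f z.
Proof.
move=> fr df; have K0 r k : unit_op r k -> k = 0.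
  apply: nil_supercommuting_ideal => {r k}[r k /unit_op_der[] //|r s k l|r k|r k u v].
  - move=> /unit_op_der[kr dk] /unit_op_der[ls dl]; apply/lfunP => w.
    by rewrite scommE (tder_half_scomm kr ls dk dl) subrr lfunE.
  - exact: unit_op_nil.
  - exact: unit_op_ideal.
have hom i j u v : u \in part i -> v \in part j -> f (u ** v) = u ** f v.
  move=> ui vj; have := unit_op_e fr df ui vj.
  rewrite (K0 _ _ (UnitOp fr df ui vj)) zero_lfunE scaler0 => h; rewrite df sigma0.
  lc (congr1 ( *:%R half) h).
rewrite (pr_dec y) (pr_dec z) !(smE, linearD) /= !(hom _ _ _ _ (prP _ _) (prP _ _)).
by vring.
Qed.
End UnitalNilpotence.
End Unital.

Lemma even_half_der_centroid f : [pchar F] =i pred0 -> parity false f -> tder half false f ->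
  forall y z, f (y ** z) = y ** f z.
Proof.
move=> charF0 fs df y z; have [hh|nh] := classic has_half; first exact: half_der_centroid.
exact: (unit_centroid (peirce_unit nh)).
Qed.

(** * Odd half-derivations *)

Section Odd.
Variable f : 'End(A).
Hypotheses (fs : parity true f) (df : tder half false f).

(** f y and f z are even, so y ** z and z ** y give the same Leibniz sum although they are opposite.
    This clash of unsigned rule and signed product is what the odd case exploits. *)
Lemma odd_half_der_skew y z : y \in part true -> z \in part true -> f y ** z + y ** f z = 0.
Proof.
move=> yt zt; have h1 := df y z; have h2 := df z y; rewrite !sigma0 in h1 h2.
rewrite (sc yt zt) linearZ /= h2 in h1.
rewrite (comm_even y (fs zt)) -(comm_even z (fs yt)) in h1.
by apply: (linear_combination (esym h1)); svfield.
Qed.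

Lemma odd_half_der_even a y : a \in part false -> y \in part true -> f a ** y = 0.
Proof.
move=> a0 yt; have h1 := df a y; have h2 := df y a; rewrite !sigma0 in h1 h2.
rewrite (comm_even y a0) h2 (comm_even (f y) a0) (sc (fs a0) yt) in h1.
by rewrite (sc (fs a0) yt); lc h1.
Qed.
End Odd.

(* For a, c even and s killing A_1, the derivation [L_a, L_s] shows that a (c s) - (a c) s kills A_1;
   so the elements s below form a graded ideal. *)
Lemma odd_ann0 s : s \in part true -> (forall y, y \in part true -> s ** y = 0) ->
  (forall a y, a \in part false -> y \in part true -> (a ** s) ** y = 0) -> s = 0.
Proof.
move=> st sy say.
have [|||h|h] := @ideal_pred (fun s => [/\ s \in part true, forall y, y \in part true -> s ** y = 0
  & forall a y, a \in part false -> y \in part true -> (a ** s) ** y = 0]).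
- split=> [|c u v [ut uy uay] [vt vy vay]].
    by split=> [|y _|a y _ _]; rewrite ?mem0v // ?sm0r sm0l.
  split; first exact: (part_lin true).2.
    by move=> y yt; rewrite !smE uy ?vy // scaler0 addr0.
  by move=> a y a0 yt; rewrite !smE uay ?vay // scaler0 addr0.
- move=> i u [ut uy uay]; case: i; first by rewrite pr_id.
  by rewrite (pr_neq ut); split=> [|y _|a y _ _]; rewrite ?mem0v // ?sm0r sm0l.
- move=> c u [ut uy uay].
  have -> : c ** u = pr false c ** u.
    by rewrite {1}(pr_dec c) smDl (sc (prP true c) ut) uy ?prP // scaler0 addr0.
  have c0 := prP false c; move: (pr false c) c0 => {}c c0.
  split; first exact: sm_part c0 ut.
    by move=> y yt; apply: uay.
  move=> a y a0 yt; have := inner_tder a0 ut c y.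
  have uz z : z \in part true -> u ** (a ** z) = 0 by move=> zt; apply/uy; exact: sm_part a0 zt.
  rewrite !innerE (uy (c ** y)) ?(uz y) ?(uz (c ** y)) ?(uy y) //; try exact: sm_part c0 yt.
  rewrite !(sm0r, scaler0, subr0, addr0) scale1r => h.
  have := uay _ _ (sm_part a0 c0) yt.
  rewrite -(comm_even u c0) -(comm_even u (sm_part a0 c0)) in h => h2.
  rewrite smDl smNl smZl h2 in h.
  by apply: (linear_combination (esym h)); rewrite /ssgn expr0; vring.
- by apply: h; split.
case: simpleA => [[x [y xy]] _]; case: xy.
by have [_ + _] := h x; apply; case: (h y).
Qed.

(** Such g is determined by g e. On each Peirce component a ** g e is a multiple of g a, possibly
    zero, and g a kills A_1; so [odd_ann0] applies to g e. *)
Lemma odd_half_der_pres0 g : parity true g -> tder half false g -> (forall x, Ph x -> Ph (g x)) ->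
  forall x, g x = 0.
Proof.
move=> gs dg gH; have hu := half_der_e gs dg.
have gE x : Ph x -> g x = (2%:R : F) *: (g e ** x).
  move=> hx; apply/eqP; rewrite -subr_eq0; apply/eqP/(int_half (half_der_half gs dg hx)).
  rewrite /Ph !smE (peirce_comm _ hu.2) hx (gH _ hx); vring.
have ue y : y \in part true -> g e ** y = 0 by exact: (odd_half_der_even gs dg e_even).
have u0 : g e = 0.
  apply: odd_ann0 hu.1 ue _ => a y a0 yt; rewrite -(pr_id a0).
  move: a {a0}; apply: peirce_ind => [|i b p hp|i x hx].
  - split=> [|c u v h1 h2]; first by rewrite linear0 !sm0l.
    by rewrite linearP /= !smE h1 h2 scaler0 addr0.
  - case: i hp => hp; first by rewrite (pr_neq hp.1) !sm0l.
    rewrite (pr_id hp.1); case: b hp => hp; last by rewrite (hPP0 hp hu) sm0l.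
    by rewrite (comm_even _ hp.1) -(half_der_int gs dg hp.2) (odd_half_der_even gs dg hp.1 yt).
  - case: i hx => hx; first by rewrite (pr_neq hx.1) !sm0l.
    rewrite (pr_id hx.1) (comm_even _ hx.1); apply: (scalerI two); rewrite scaler0 -smZl -(gE _ hx.2).
    exact: (odd_half_der_even gs dg hx.1 yt).
apply: peirce_gen1 => [|i p [_ hp]|c x [_ hx]|a c x y [_ hx] [_ hy]].
- by split=> [|c u v h1 h2]; rewrite ?linear0 // linearP /= h1 h2 scaler0 addr0.
- by rewrite (half_der_int gs dg hp) u0 sm0l.
- by rewrite (gE _ hx) u0 sm0l scaler0.
- by rewrite dg (gE _ hx) (gE _ hy) u0 !(sm0l, scaler0, sm0r) addr0 scaler0.
Qed.

(** * Odd half-derivations that map P_(1/2) into P_1 *)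

Section OddSwap.
Variable h : 'End(A).
Hypotheses (hs : parity true h) (dh : tder half false h).
Hypotheses (h0 : forall i b p, hP i b p -> h p = 0) (hH1 : forall x, Ph x -> Pk true (h x)).

Let hval i x : hH i x -> hP (i (+) true) true (h x).
Proof. by move=> [xi hx]; split; [apply: hs | apply: hH1]. Qed.

Let hmul a c x y : hH a x -> hH c y -> h (x ** y) = 0.
Proof.
move=> hx hy; rewrite (pk_dec true (x ** y)) linearD /=.
by rewrite (h0 (pkP true hx hy)) (h0 (pkP false hx hy)) addr0.
Qed.

(** h x is odd and kills A_1 by [odd_half_der_even]. The Peirce relations show that A_0 (h x) does
    so too, and [odd_ann0] applies. *)
Lemma swap_even x : hH false x -> h x = 0.
Proof.
move=> hx; have hw := hval hx; rewrite addFb in hw; set w := h x in hw *.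
have wy y : y \in part true -> w ** y = 0 by exact: (odd_half_der_even hs dh hx.1).
apply: (odd_ann0 hw.1 wy) => a y a0 yt; rewrite -(pr_id a0).
move: a {a0}; apply: peirce_ind => [|i b p hp|i v hv].
- split=> [|c u v h1 h2]; first by rewrite linear0 !sm0l.
  by rewrite linearP /= !smE h1 h2 scaler0 addr0.
- case: i hp => hp; first by rewrite (pr_neq hp.1) !sm0l.
  rewrite (pr_id hp.1); case: b hp => hp; last by rewrite (hPP0 hp hw) sm0l.
  have := odd_half_der_even hs dh (sm_part hp.1 hx.1) yt.
  rewrite dh (h0 hp) sm0l add0r sigma0 smZl => /eqP; rewrite scaler_eq0 invr_eq0 (negPf two) => /eqP.
  exact.
case: i hv => hv; first by rewrite (pr_neq hv.1) !sm0l.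
rewrite (pr_id hv.1) (comm_even _ hv.1) -(pr_id yt).
move: y {yt}; apply: peirce_ind => [|i b p hp|i t ht].
- split=> [|c u u' h1 h2]; first by rewrite linear0 !sm0r.
  by rewrite linearP /= !smE h1 h2 scaler0 addr0.
- case: i hp => hp; last by rewrite (pr_neq hp.1) !sm0r.
  rewrite (pr_id hp.1) (sc (sm_part hw.1 hv.1) hp.1).
  have pv := wy _ (sm_part hp.1 hv.1).
  case: b hp => hp.
    have := peirce_act hw hp hv; rewrite (wy _ hp.1) pv sm0l add0r => e1.
    by lc (congr1 ( *:%R (ssgn F true true * ssgn F true true)) e1).
  have := peirce_cross hw hp hv; rewrite pv => e1.
  by lc e1.
case: i ht => ht; last by rewrite (pr_neq ht.1) !sm0r.
have [e1 e2] := peirce_pi hw hv ht.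
have p0 b : pk b 0 = 0 by case: b; rewrite /pk !sm0r ?subrr.
rewrite (wy _ (sm_part hv.1 ht.1)) (wy _ ht.1) sm0r !p0 in e1; rewrite (wy _ ht.1) sm0r !p0 in e2.
rewrite scaler0 addr0 in e1; rewrite scaler0 in e2.
by rewrite (pr_id ht.1) (pk_dec true (w ** v ** t)) -e1 e2 addr0.
Qed.

Let skew y z : y \in part true -> z \in part true -> h y ** z + y ** h z = 0.
Proof. exact: (odd_half_der_skew hs dh). Qed.

Lemma swap_kill a z : a \in part true -> z \in part true -> h z = 0 -> h a ** z = 0.
Proof. by move=> at_ zt hz; have := skew at_ zt; rewrite hz sm0r addr0. Qed.

Lemma swap_half_even a v : hH true a -> hH false v -> h a ** v = 0.
Proof.
move=> ha hv; have := dh a v; rewrite (hmul ha hv) (swap_even hv) sm0r addr0 => /esym/eqP.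
by rewrite scaler_eq0 invr_eq0 (negPf two) => /eqP.
Qed.

Lemma swap_act0 a i j q t : hH true a -> hP i false q -> hH j t -> h a ** (q ** t) = 0.
Proof.
move=> ha hq ht; have hqt := hPHM hq ht; case ij: (i (+) j) hqt => hqt; last exact: swap_half_even.
apply: swap_kill ha.1 hqt.1 _; rewrite dh (h0 hq) sm0l add0r sigma0 (hPP0 hq (hval ht)).
exact: scaler0.
Qed.

(** Since h (p ** x) = (p ** h x) / 2, the skew rule at (a, b), (a, p ** b) and (p ** a, b),
    together with [peirce_act], determines both products after division by 3. *)
Lemma swap_act1 a p b : hH true a -> hP false true p -> hH true b ->
  h a ** (p ** b) = p ** (h a ** b) /\ (h a ** p) ** b = (2%:R : F) *: (p ** (h a ** b)).
Proof.
move=> ha hp hb; have ra := hval ha; have rb := hval hb.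
have hpa := hPHM hp ha; have hpb := hPHM hp hb; rewrite !addFb !addbT /= in hpa hpb ra rb.
have e1 := skew ha.1 hb.1; have e2 := skew ha.1 hpb.1; have e3 := skew hpa.1 hb.1.
have e4 := peirce_act hp rb ha; have e5 := peirce_act hp ra hb.
have dp x : h (p ** x) = half *: (p ** h x) by rewrite dh (h0 hp) sm0l add0r sigma0.
rewrite !dp !smE in e2 e3.
rewrite -(comm_even a rb.1) in e1; rewrite -(comm_even a (sm_part hp.1 rb.1)) in e2.
rewrite -(comm_even (p ** a) rb.1) in e3.
have rpb : h a ** (p ** b) = p ** (h a ** b).
  apply: (scalerI three).
  have E := congr2 +%R (congr1 ( *:%R (4%:R : F)) e2) (congr1 ( *:%R (-2%:R : F)) e3).
  have e1' := congr1 (supermul A p) e1; rewrite smDr sm0r in e1'.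
  have E' := congr2 +%R (congr1 ( *:%R (-2%:R : F)) e4) (congr2 +%R e5 (congr1 ( *:%R (-2%:R : F)) e1')).
  by lc (congr2 +%R E E').
by split=> //; rewrite (comm_even p ra.1 : _ = p ** h a) e5 rpb; svfield.
Qed.

Local Arguments pk : simpl never.
Let D m := pk true m - pk false m.

Lemma half_cyclic a b c : hH true a -> hH true b -> hH true c ->
  D (a ** b) ** c + D (b ** c) ** a + D (c ** a) ** b = 0.
Proof.
move=> ha hb hc; have := dH_tder ha b c.
rewrite (dH_half ha hb) (dH_half ha hc) (sigma_hom _ hb.1) {1}(pk_dec true (b ** c)) linearD /=.
rewrite (dH_int ha (pkP true hb hc)) (dH_int ha (pkP false hb hc)).
rewrite -(comm_even a (pkP true hb hc).1) -(comm_even a (pkP false hb hc).1) (sc ha.1 hc.1).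
have e1 := comm_even b (pkP true hc ha).1; have e2 := comm_even b (pkP false hc ha).1.
rewrite !pkZ /D => E.
lc (congr2 +%R (congr1 ( *:%R (-2%:R : F)) E) (congr2 +%R e1 (esym e2))).
Qed.

(** For odd arguments in P_(1/2), N is skew. H and G are the P_1 and P_0 components of (h a ** b) **
    c: G is alternating, while H is skew in its first two arguments with vanishing cyclic sum. *)
Let N a b := h a ** b.
Let H a b c := pk true (N a b ** c).
Let G a b c := pk false (N a b ** c).
Let hN a b : hH true a -> hH true b -> hH true (N a b).
Proof. by move=> ha hb; exact: (hPHM (hval ha) hb). Qed.

Lemma swap_N a b : hH true a -> hH true b -> N a b = - N b a.
Proof.
move=> ha hb; have := skew ha.1 hb.1; rewrite -(comm_even a (hval hb).1) => /eqP.
by rewrite addr_eq0 => /eqP.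
Qed.

Lemma swap_H a b c : hH true a -> hH true b -> H a b c = - H b a c.
Proof. by move=> ha hb; rewrite /H (swap_N ha hb) smNl -scaleN1r pkZ scaleN1r. Qed.

Lemma swap_G a b c : hH true a -> hH true b -> G a b c = - G b a c.
Proof. by move=> ha hb; rewrite /G (swap_N ha hb) smNl -scaleN1r pkZ scaleN1r. Qed.

Lemma swap_pi a b c : hH true a -> hH true b -> hH true c ->
  h a ** pk true (b ** c) = H a b c - H a c b /\ G a b c = - G a c b.
Proof.
move=> ha hb hc; have hr := hval ha; have [e1 e2] := peirce_pi hr hb hc.
have z0 : h a ** pk false (b ** c) = 0 by apply: hPP0 hr (pkP _ hb hc).
have bc : b ** (h a ** c) = - (N a c ** b).
  by rewrite (sc hb.1 (hN ha hc).1) /ssgn expr1 scaleN1r.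
rewrite {1}(pk_dec true (b ** c)) smDr z0 addr0 bc -[- _]scaleN1r !pkZ in e1.
rewrite bc -[- _]scaleN1r !pkZ in e2; split.
  by rewrite e1 /H; svfield.
by move: e2; rewrite /G /= => ->; svfield.
Qed.

Lemma swap_cyclic a b c : hH true a -> hH true b -> hH true c -> H a b c + H b c a + H c a b = 0.
Proof.
move=> ha hb hc; have := congr1 h (half_cyclic ha hb hc); rewrite linear0 !linearD /=.
have hD x y z : hH true x -> hH true y -> hH true z -> h (D (x ** y) ** z) = half *: (H z x y - H z y x).
  move=> hx hy hz; have hu b' : h (pk b' (x ** y) ** z) = half *: (pk b' (x ** y) ** h z).
    by rewrite dh (h0 (pkP b' hx hy)) sm0l add0r sigma0.
  rewrite /D smDl smNl linearB /= !hu (hPP0 (pkP false hx hy) (hval hz)) scaler0 subr0.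
  by rewrite (comm_even (h z) (pkP true hx hy).1) (swap_pi hz hx hy).1.
rewrite !hD // (swap_H b ha hc) (swap_H c hb ha) (swap_H a hc hb) => E.
lc E.
Qed.

(** This is [half_cyclic] for N a b, c, t, rewritten by means of the action of h a. *)
Lemma swap_eq1 a b c t : hH true a -> hH true b -> hH true c -> hH true t ->
  (2%:R : F) *: (G a b c ** t - G a b t ** c) =
  (2%:R : F) *: (H a b c ** t - H a b t ** c) - (H a t c - H a c t) ** b.
Proof.
move=> ha hb hc ht; have hn := hN ha hb; have := half_cyclic hn hc ht.
have hp := pkP true hc ht; have hq := pkP false hc ht.
have e1 := (swap_act1 ha hp hb).2; rewrite (swap_pi ha hc ht).1 in e1.
have e2 : pk false (c ** t) ** N a b = 0.
  have := swap_act0 ha hq hb; rewrite (peirce_cross (hval ha) hq hb) => e2.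
  by move/eqP: e2; rewrite scaler_eq0 /ssgn signr_eq0 => /eqP.
have tn b' : pk b' (t ** N a b) ** c = - (pk b' (N a b ** t) ** c).
  by rewrite (sc ht.1 hn.1) pkZ /ssgn expr1 scaleN1r smNl.
move=> E; have eX := tn true; have eY := tn false.
rewrite /H /G /N /D in E e1 e2 eX eY *.
lc (congr2 +%R (congr1 ( *:%R (-2%:R : F)) E) (congr2 +%R (congr1 ( *:%R (-1 : F)) e1)
  (congr2 +%R (congr1 ( *:%R (-2%:R : F)) e2) (congr2 +%R (congr1 ( *:%R (2%:R : F)) eX)
  (congr1 ( *:%R (-2%:R : F)) eY))))).
Qed.

(** The Leibniz rule of the superderivation [L_c, L_t] on h a ** b, expanded by Peirce
    components. *)
Lemma swap_eq2 a b c t : hH true a -> hH true b -> hH true c -> hH true t ->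
  (2%:R : F) *: (G a b t ** c + G a b c ** t) =
  (2%:R : F) *: ((H a t c + H a c t) ** b) - (H a t b + H a b t) ** c - (H a c b + H a b c) ** t.
Proof.
move=> ha hb hc ht; have hn := hN ha hb; have hr := hval ha.
have flip x y : hH true x -> hH true y -> x ** y = - (y ** x).
  by move=> hx hy; rewrite (sc hx.1 hy.1) /ssgn expr1 scaleN1r.
have rx x y z : hH true x -> hH true y -> hH true z ->
    h a ** (x ** (y ** z)) = half *: ((H a y z - H a z y) ** x).
  move=> hx hy hz; rewrite -(comm_even x (sm_part hy.1 hz.1)) {1}(pk_dec true (y ** z)) smDl smDr.
  rewrite (swap_act0 ha (pkP false hy hz) hx) addr0 -(swap_pi ha hy hz).1.
  have [e1 e2] := swap_act1 ha (pkP true hy hz) hx; rewrite e1 e2; by vfield.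
have xr x y : hH true x -> hH true y -> x ** (y ** h a) = - (N a y ** x).
  by move=> hx hy; rewrite -(comm_even y hr.1) (flip _ _ hx (hN ha hy)).
have xn x y : hH true x -> hH true y -> x ** (y ** N a b) = - ((N a b ** y) ** x).
  move=> hx hy; rewrite -(comm_even x (sm_part hy.1 hn.1)) (flip _ _ hy hn); exact: smNl.
have := inner_tder hc.1 ht.1 (h a) b.
rewrite sigma0 scale1r !innerE (xn _ _ hc ht) (xn _ _ ht hc) (xr _ _ hc ht) (xr _ _ ht hc).
rewrite smDr smNr smZr (rx _ _ _ hc ht hb) (rx _ _ _ ht hc hb) => E.
have g1 := congr1 (fun z => z ** b) (swap_pi ha ht hc).2.
have d1 := congr1 (fun z => z ** c) (pk_dec true (N a b ** t)).
have d2 := congr1 (fun z => z ** t) (pk_dec true (N a b ** c)).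
have d3 := congr1 (fun z => z ** b) (pk_dec true (N a t ** c)).
have d4 := congr1 (fun z => z ** b) (pk_dec true (N a c ** t)).
rewrite /H /G in E g1 *; move: E g1 d1 d2 d3 d4;
move: (pk true (N a b ** t)) (pk true (N a b ** c)) (pk true (N a t ** c)) (pk true (N a c ** t)) => H1 H2 H3 H4.
move: (pk _ (N a b ** t)) (pk _ (N a b ** c)) (pk _ (N a t ** c)) (pk _ (N a c ** t)) => G1 G2 G3 G4.
move: (pk true (N a t ** b)) (pk true (N a c ** b)) => H5 H6 E g1 d1 d2 d3 d4.
lc (congr2 +%R (congr1 ( *:%R (2%:R : F)) E) (congr2 +%R (congr1 ( *:%R (2%:R : F)) (congr2 +%R d1 d2))
  (congr2 +%R (congr1 ( *:%R (-2%:R : F)) (congr2 +%R d3 d4)) (congr1 ( *:%R (-2%:R : F)) g1)))).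
Qed.

(* swap_eq1 and swap_eq2 over all permutations of a, b, c, t form a linear system of full rank. *)
Lemma swap_solve a b c t : hH true a -> hH true b -> hH true c -> hH true t ->
  H a b c ** t = 0 /\ G a b c ** t = 0.
Proof.
move=> ha hb hc ht.
have HH x y z : hH true x -> hH true y -> hH true z ->
    [/\ H y x z = - H x y z, H z x y = - H x y z - H y z x, H z y x = - H y z x
      & H x z y = H x y z + H y z x].
  move=> hx hy hz; have cy := swap_cyclic hx hy hz; split; first exact: swap_H.
  - by lc cy.
  - exact: swap_H.
  - by rewrite (swap_H y hx hz); lc cy.
have GG x y z : hH true x -> hH true y -> hH true z ->
    [/\ G y x z = - G x y z, G z x y = G x y z, G z y x = - G x y z, G x z y = - G x y z & G y z x = G x y z].
  move=> hx hy hz; have s1 := swap_G z hy hx; have s2 := (swap_pi hx hy hz).2.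
  have s3 := swap_G y hz hx; have s4 := (swap_pi hz hx hy).2; have s5 := (swap_pi hy hx hz).2.
  have t2 : G x z y = - G x y z by rewrite s2 opprK.
  have t3 : G z x y = G x y z by rewrite s3 t2 opprK.
  by split=> //; apply: oppr_inj; rewrite ?opprK -?s4 -?s5 ?t3 ?s1.
have [a1 a2 a3 a4] := HH _ _ _ ha hb hc; have [b1 b2 b3 b4] := HH _ _ _ ha hb ht.
have [c1 c2 c3 c4] := HH _ _ _ ha hc ht; have [d1 d2 d3 d4] := HH _ _ _ hb hc ht.
have [e1 e2 e3 e4 e5] := GG _ _ _ ha hb hc; have [f1 f2 f3 f4 f5] := GG _ _ _ ha hb ht.
have [g1 g2 g3 g4 g5] := GG _ _ _ ha hc ht; have [h1 h2 h3 h4 h5] := GG _ _ _ hb hc ht.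
have rules := (a1, a2, a3, a4, b1, b2, b3, b4, c1, c2, c3, c4, d1, d2, d3, d4).
have grules := (e1, e2, e3, e4, e5, f1, f2, f3, f4, f5, g1, g2, g3, g4, g5, h1, h2, h3, h4, h5).
suff sep (phi : A -> F) : (forall u v, phi (u + v) = phi u + phi v) ->
    (forall k u, phi (k *: u) = k * phi u) -> phi (H a b c ** t) = 0 /\ phi (G a b c ** t) = 0.
  by split; apply: vect_sep => phi phiD phiZ; rewrite (lin0 phiZ); case: (sep phi phiD phiZ).
move=> phiD phiZ; have phiE := (phiD, phiZ, linN phiZ).
have q1 x y z w (hx : hH true x) (hy : hH true y) (hz : hH true z) (hw : hH true w) :
    2%:R * (phi (G x y z ** w) - phi (G x y w ** z)) =
    2%:R * (phi (H x y z ** w) - phi (H x y w ** z)) - (phi (H x w z ** y) - phi (H x z w ** y)).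
  have := swap_eq1 hx hy hz hw; move: (H x y z) (H x y w) (H x w z) (H x z w) (G x y z) (G x y w).
  by move=> *; match goal with E : _ = _ |- _ => move: (congr1 phi E) end; rewrite !smE !phiE.
have q2 x y z w (hx : hH true x) (hy : hH true y) (hz : hH true z) (hw : hH true w) :
    2%:R * (phi (G x y w ** z) + phi (G x y z ** w)) =
    2%:R * (phi (H x w z ** y) + phi (H x z w ** y)) - (phi (H x w y ** z) + phi (H x y w ** z))
     - (phi (H x z y ** w) + phi (H x y z ** w)).
  have := swap_eq2 hx hy hz hw; move: (H x y z) (H x y w) (H x w z) (H x z w) (H x w y) (H x z y).
  move: (G x y z) (G x y w) => *; match goal with E : _ = _ |- _ => move: (congr1 phi E) end.
  by rewrite !smE !phiE => ->; ring.
(* A certificate of linear algebra: once [rules] and [grules] express H and G in independent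
   unknowns, all of them but one cancel. Its multiplier 18, like 12 for G, has only the prime
   factors 2 and 3. *)
have H0 : 18%:R * phi (H a b c ** t) = 0.
  apply: (linear_combination (congr2 +%R (congr1 ( *%R (9%:R : F)) (q1 _ _ _ _ ha hc hb ht))
    (congr2 +%R (congr1 ( *%R (- 18%:R : F)) (q1 _ _ _ _ hc ht hb ha))
    (congr2 +%R (congr1 ( *%R (- 1%:R : F)) (q2 _ _ _ _ ha ht hc hb))
    (congr2 +%R (congr1 ( *%R (4%:R : F)) (q2 _ _ _ _ ha hb hc ht))
    (congr2 +%R (congr1 ( *%R (- 5%:R : F)) (q2 _ _ _ _ hc hb ht ha))
    (congr2 +%R (congr1 ( *%R (5%:R : F)) (q2 _ _ _ _ hc ha ht hb))
    (congr2 +%R (congr1 ( *%R (- 1%:R : F)) (q2 _ _ _ _ hb hc ht ha))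
    (congr2 +%R (congr1 ( *%R (- 9%:R : F)) (q1 _ _ _ _ hb ht hc ha))
    (congr2 +%R (congr1 ( *%R (- 5%:R : F)) (q2 _ _ _ _ ht ha hb hc))
    (congr2 +%R (congr1 ( *%R (5%:R : F)) (q2 _ _ _ _ ht hb ha hc))
    (congr1 ( *%R (4%:R : F)) (q2 _ _ _ _ hb ha ht hc))))))))))))).
  by rewrite !grules !rules ?smE ?(phiD, linN phiZ); ring.
have G0 : 12%:R * phi (G a b c ** t) = 0.
  apply: (linear_combination (congr2 +%R (congr1 ( *%R (- 21%:R : F)) (q1 _ _ _ _ ht hb hc ha))
    (congr2 +%R (congr1 ( *%R (- 1%:R : F)) (q2 _ _ _ _ hb ht ha hc))
    (congr2 +%R (congr1 ( *%R (- 6%:R : F)) (q1 _ _ _ _ hc ht ha hb))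
    (congr2 +%R (congr1 ( *%R (- 1%:R : F)) (q2 _ _ _ _ hc ht ha hb))
    (congr2 +%R (congr1 ( *%R (- 6%:R : F)) (q1 _ _ _ _ ha ht hb hc))
    (congr2 +%R (congr1 ( *%R (- 14%:R : F)) (q2 _ _ _ _ ht hc ha hb))
    (congr2 +%R (congr1 ( *%R (- 7%:R : F)) (q2 _ _ _ _ ht hb hc ha))
    (congr2 +%R (congr1 ( *%R (- 2%:R : F)) (q2 _ _ _ _ hc hb ha ht))
    (congr2 +%R (congr1 ( *%R (- 6%:R : F)) (q1 _ _ _ _ hb ht hc ha))
    (congr2 +%R (congr1 ( *%R (- 2%:R : F)) (q2 _ _ _ _ hb ha ht hc))
    (congr2 +%R (congr1 ( *%R (- 1%:R : F)) (q2 _ _ _ _ ha ht hc hb))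
    (congr1 ( *%R (- 2%:R : F)) (q2 _ _ _ _ ha hc hb ht)))))))))))))).
  by rewrite !grules !rules ?smE ?(phiD, linN phiZ); ring.
have n18 : 18%:R != 0 :> F by rewrite (natrM _ 2 9) (natrM _ 3 3) !mulf_neq0.
have n12 : 12%:R != 0 :> F by rewrite (natrM _ 4 3) (natrM _ 2 2) !mulf_neq0.
by split; [apply: (mulfI n18) | apply: (mulfI n12)]; rewrite ?H0 ?G0 mulr0.
Qed.

Lemma swap_N_even a b v : hH true a -> hH true b -> hH false v -> N a b ** v = 0.
Proof.
move=> ha hb hv; have hr := hval ha; have [e1 e2] := peirce_pi hr hb hv.
have rbv : h a ** (b ** v) = 0 by apply: swap_kill ha.1 (sm_part hb.1 hv.1) (hmul hb hv).
have p0 b' : pk b' 0 = 0 by case: b'; rewrite /pk !sm0r ?subrr.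
rewrite rbv (swap_half_even ha hv) sm0r !p0 scaler0 addr0 in e1.
rewrite (swap_half_even ha hv) sm0r !p0 scaler0 in e2.
by rewrite (pk_dec true (N a b ** v)) -e1 e2 addr0.
Qed.

(** Two relations suffice: [L_c, L_v] on h a ** b shows that the two products are opposite, and [dH]
    of N a b on c ** v that they are equal. *)
Lemma swap_solve_even a b c v : hH true a -> hH true b -> hH true c -> hH false v ->
  H a b c ** v = 0 /\ G a b c ** v = 0.
Proof.
move=> ha hb hc hv; have hn := hN ha hb; have hr := hval ha.
have nv x : hH true x -> N a x ** v = 0 by move=> hx; exact: swap_N_even.
have vn x : hH true x -> v ** N a x = 0 by move=> hx; rewrite (comm_even _ hv.1) nv.
have vr : v ** h a = 0 by rewrite (comm_even _ hv.1) (swap_half_even ha hv).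
have cN x : hH true x -> c ** N a x = - (N a x ** c).
  by move=> hx; rewrite (sc hc.1 (hN ha hx).1) /ssgn expr1 scaleN1r.
have rcb u : (forall b', h a ** (pk b' u ** c) = 0) -> h a ** (u ** c) = 0.
  by move=> hu; rewrite (pk_dec true u) smDl smDr !hu addr0.
have odd_kill i b' p : hP i b' p -> i = true -> h a ** (p ** c) = 0.
  by move=> hp it; rewrite it in hp; apply: swap_half_even (hPHM hp hc).
have even_kill i b' p : hP i b' p -> i = false -> h a ** (p ** v) = 0.
  by move=> hp it; rewrite it in hp; apply: swap_half_even (hPHM hp hv).
have add0 : H a b c ** v + G a b c ** v = 0.
  rewrite -smDl /H /G -pk_dec.
  have := inner_tder hc.1 hv.1 (h a) b; rewrite scale1r !innerE -/(N a b) vn // sm0r.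
  rewrite vr sm0r -(comm_even c hr.1) -/(N a c) vn // !scaler0 subr0 sm0l add0r (sigma_even _ hr.1).
  rewrite (cN b hb) smNr -(comm_even _ hv.1) => E.
  have z1 : h a ** (c ** (v ** b)) = 0.
    rewrite (comm_even b hv.1) (sc hc.1 (sm_part hb.1 hv.1)) smZr rcb ?scaler0 // => b'.
    exact: odd_kill (pkP b' hb hv) _.
  have z2 : h a ** (v ** (c ** b)) = 0.
    rewrite (comm_even (c ** b) hv.1) (pk_dec true (c ** b)) smDl smDr.
    by rewrite (even_kill _ _ _ (pkP true hc hb)) // (even_kill _ _ _ (pkP false hc hb)) // addr0.
  rewrite smDr smNr smZr z1 z2 in E.
  lc E.
have pN b' p : hP true b' p -> p ** N a b = 0.
  move=> hp; have rpb : h a ** (p ** b) = 0 by apply: swap_half_even ha (hPHM hp hb).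
  case: b' hp => hp; last by have := peirce_cross hr hp hb; rewrite rpb scale1r.
  have := peirce_act hp hr hb; rewrite rpb (sc hp.1 hr.1) (swap_kill ha.1 hp.1 (h0 hp)).
  by rewrite !scaler0 sm0l addr0.
have sub0 : H a b c ** v - G a b c ** v = 0.
  have := dH_tder hn c v; rewrite (dH_half hn hc) (dH_half hn hv) (nv _ hb).
  rewrite {1}(pk_dec true (c ** v)) linearD /= (dH_int hn (pkP true hc hv)) (dH_int hn (pkP false hc hv)).
  rewrite !(sc hn.1 (pkP _ hc hv).1) !(pN _ _ (pkP _ hc hv)) -/(H a b c) -/(G a b c) => E.
  have p0 b' : pk b' 0 = 0 by case: b'; rewrite /pk !sm0r ?subrr.
  rewrite !p0 !(subrr, scaler0, addr0, sm0r) scale1r smZl smDl smNl in E.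
  by lc (congr1 ( *:%R (2%:R : F)) E).
split.
  by apply: (scalerI two); rewrite scaler0; lc (congr2 +%R add0 sub0).
by apply: (scalerI two); rewrite scaler0; lc (congr2 +%R add0 (congr1 ( *:%R (-1 : F)) sub0)).
Qed.

(** Vanishing is tested three levels down: h a on b, N a b on c, and each Peirce component of N a b
    ** c on a further element. Hence the identities in four elements of P_(1/2). *)
Lemma swap0 x : h x = 0.
Proof.
move: x; apply: peirce_ind => [|i b p|i a ha]; last 1 first.
- case: i ha => ha; last exact: swap_even.
  have [hh|nh] := classic has_half; last first.
    have -> : a = 0 by apply: NNPP => a0; apply: nh; exists true, a.
    exact: linear0.
  have hr := hval ha; apply: (peirce_faithful hh hr.2) => c b hb.
  case: c hb => hb; last exact: swap_half_even.
  have hn := hN ha hb; apply: (half_ann0 hn.2) => i c hc.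
  have Nc : N a b ** c = 0.
    case: i hc => hc; last exact: swap_N_even.
    have hx b' : hP false b' (pk b' (N a b ** c)) := pkP b' hn hc.
    rewrite (pk_dec true (N a b ** c)).
    rewrite [pk true _](_ : _ = 0) ?add0r; last first.
      apply: (peirce_faithful hh (hx true).2) => j y; case: j => hy.
        exact: (swap_solve ha hb hc hy).1.
      exact: (swap_solve_even ha hb hc hy).1.
    apply: (peirce_faithful hh (hx false).2) => j y; case: j => hy.
      exact: (swap_solve ha hb hc hy).2.
    exact: (swap_solve_even ha hb hc hy).2.
  by rewrite (sc hc.1 hn.1) Nc scaler0.
- by split=> [|c u v h1 h2]; rewrite ?linear0 // linearP /= h1 h2 scaler0 addr0.
- exact: h0.
Qed.
End OddSwap.

Lemma odd_half_der0 f : parity true f -> tder half false f -> forall x, f x = 0.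
Proof.
move=> fs df x; have [g [h [[gs dg gH] [[hs dh h0 hH1] ->]]]] := half_der_split fs df.
by rewrite (odd_half_der_pres0 gs dg gH) (swap0 hs dh h0 hH1) addr0.
Qed.
End Idempotent.

(** * Homogeneous parts, eigenvectors and the conclusion *)

Lemma sigmaM r x y : sigma r (x ** y) = sigma r x ** sigma r y.
Proof.
have hom i j u v : u \in part i -> v \in part j -> sigma r (u ** v) = sigma r u ** sigma r v.
  move=> ui vj; rewrite (sigma_hom _ ui) (sigma_hom _ vj) (sigma_hom _ (sm_part ui vj)); by svfield.
rewrite (pr_dec x) (pr_dec y) !(smE, linearD) /= !(hom _ _ _ _ (prP _ _) (prP _ _)).
by vring.
Qed.

(** Conjugation by the grading automorphism preserves the rule without signs; the averages with
    signs plus and minus are the even and the odd part of f. *)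
Lemma tder_split delta f : tder delta false f -> exists g h : 'End(A),
  [/\ parity false g, tder delta false g, parity true h, tder delta false h & forall x, f x = g x + h x].
Proof.
move=> df; pose f' : 'End(A) := (sigma true \o f \o sigma true)%VF.
have f'E x : f' x = sigma true (f (sigma true x)) by rewrite !comp_lfunE.
have sK x : sigma true (sigma true x) = x by rewrite -sigmaD sigma0.
have sE x : sigma true x = pr false x - pr true x by rewrite add_lfunE scale_lfunE expr1 scaleN1r.
have df' : tder delta false f'.
  have sD u v : sigma true (delta *: (u + v)) = delta *: (sigma true u + sigma true v).
    by rewrite linearZ linearD.
  by move=> x y; rewrite !f'E sigmaM df !sigma0 sD !sigmaM !sK.
have ex (c : F) : exists g : 'End(A), (forall x, g x = half *: (f x + c *: f' x)) /\ tder delta false g.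
  exists (half *: (f + c *: f'))%VF.
  have gE x : (half *: (f + c *: f'))%VF x = half *: (f x + c *: f' x).
    by rewrite scale_lfunE add_lfunE scale_lfunE.
  by split=> // x y; rewrite !gE df df' !sigma0; vring.
have [g [gE dg]] := ex 1; have [h [hE dh]] := ex (-1); exists g, h.
have hom i x : x \in part i -> (g x = pr i (f x)) * (h x = pr (~~ i) (f x)).
  move=> xi; rewrite gE hE f'E (sigma_hom _ xi) [f (_ *: _)]linearZ /= [sigma true (_ *: _)]linearZ /= sE.
  have E := congr1 ( *:%R half) (pr_dec (f x)).
  by split; apply: (linear_combination E); case: i {xi}; rewrite /ssgn /= ?expr0 ?expr1; vfield.
split=> // [i x xi|i x xi|x]; try by rewrite (hom _ _ xi) ?addbF ?addbT prP.
by rewrite gE hE; vfield.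
Qed.

(** As in Schur's lemma, an eigenspace of an even map in the centroid is a graded ideal. *)
Lemma centroid_eigen f a w : parity false f -> (forall x y, f (x ** y) = x ** f y) ->
  w <> 0 -> f w = a *: w -> forall x, f x = a *: x.
Proof.
move=> fp fM w0 fw; have [|||h|h] := @ideal_pred (fun x => f x = a *: x).
- by split=> [|c u v hu hv]; rewrite ?linear0 ?scaler0 // linearP /= hu hv; vring.
- move=> i u fu; have := congr1 (pr i) fu; rewrite linearZ /= => <-.
  rewrite {2}(pr_dec u) linearD linearD /=.
  have p j : f (pr j u) \in part j by have := fp _ _ (prP j u); rewrite addbF.
  case: (i); rewrite (pr_id (p _)).
    by rewrite (pr_neq (p false)) add0r.
  by rewrite (pr_neq (p true)) addr0.
- by move=> c u fu; rewrite fM fu smZr.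
- by case: w0; apply: h.
- exact: h.
Qed.
End Graded.

(** Induction on the size of a polynomial p with p(f) w = 0: for a root a of p, either w is an
    eigenvector or (f - a) w is nonzero and killed by the quotient of p by X - a. *)
Lemma eigenvector_exists (F : closedFieldType) (V : vectType F) (f : 'End(V)) (v : V) :
  v <> 0 -> exists a w, w <> 0 /\ f w = a *: w.
Proof.
move=> v0; pose u w i := iter i f w.
have uD (p : {poly F}) a w w' : poly_sum (u (a *: w + w')) p = a *: poly_sum (u w) p + poly_sum (u w') p.
  rewrite /poly_sum scaler_sumr -big_split; apply: eq_bigr => i _ /=.
  rewrite scalerA mulrC -scalerA -scalerDr; congr (_ *: _).
  by rewrite /u; elim: (i : nat) => //= j ->; rewrite linearP.
suff key : forall n (p : {poly F}) w, (size p <= n)%N -> p != 0 -> w <> 0 -> poly_sum (u w) p = 0 ->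
    exists a w, w <> 0 /\ f w = a *: w.
  have [p p0 pv] := linear_dependence (u v); exact: key (leqnn _) p0 v0 pv.
elim=> [|n IH] p w pn p0 w0 pw; first by case/eqP: p0; apply/eqP; rewrite -size_poly_eq0 -leqn0.
have [/eqP/size_poly1P[c c0 pc]|s1] := eqVneq (size p) 1%N.
  move: pw; rewrite pc poly_sumC /= => /eqP; rewrite scaler_eq0 (negPf c0) /= => /eqP.
  by [].
have [a /factor_theorem[q pq]] := closed_rootP p s1.
have q0 : q != 0 by apply: contra p0 => /eqP q0; rewrite pq q0 mul0r.
have [fw|fw] := eqVneq (f w) (a *: w); first by exists a, w.
have sq : (size q <= n)%N by move: pn; rewrite pq size_Mmonic ?monicXsubC // size_XsubC addn2.
apply: (IH q (- a *: w + f w)) => //.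
  by move/eqP; rewrite addrC scaleNr subr_eq0 (negPf fw).
rewrite uD -[RHS]pw pq; have -> : q * ('X - a%:P) = - a *: q + q * 'X :> {poly F}.
  by rewrite mulrBr (mulrC q a%:P) mul_polyC scaleNr addrC.
rewrite poly_sumD poly_sumZ poly_sumX; congr (_ + _).
by apply: eq_bigr => i _; rewrite /u -iterSr.
Qed.

Theorem theorem4p4 (F : closedFieldType) (charF0 : [pchar F] =i pred0)
    (A : superalgebra F) (simpleA : simple_superalgebra A)
    (jordanA : jordan_superalgebra A)
    (delta : F) (phi : {linear A -> A})
    (phi_der : nontrivial_delta_derivation delta phi) :
  delta = 2%:R^-1 /\ exists alpha : F, forall x : A, phi x = alpha *: x.
Proof.
have nat0 n : n.+1%:R != 0 :> F by move/pcharf0P: charF0 => ->.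
have [two three] := (nat0 1%N, nat0 2%N).
have [e [e0 en ee]] := idempotent_ex two jordanA simpleA three.
have [dphi n1 n0] := phi_der.
pose f : 'End(A) := linfun phi; have fE x : f x = phi x by rewrite lfunE.
have df : tder delta false f.
  by move=> x y; rewrite !fE sigma0 dphi [in RHS]addrC.
have dh : delta = 2%:R^-1.
  have [d0|d0] := eqVneq delta 0.
    by case: n0 => x y; rewrite dphi d0 scale0r.
  have [d1|d1] := eqVneq delta 1; first by case: n1; rewrite -d1.
  have [//|dh] := eqVneq delta (2%:R^-1).
  case: n0 => x y; rewrite -fE.
  exact: (tder_trivial two jordanA simpleA e0 en ee d0 dh d1 df).
split=> //; rewrite dh in df; have [g [h [gp dg hp dh' fgh]]] := tder_split two df.
have gM := even_half_der_centroid two jordanA simpleA three e0 en ee charF0 gp dg.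
have [a [w [w0 gw]]] := eigenvector_exists g en.
exists a => x; rewrite -fE fgh (odd_half_der0 two jordanA simpleA three e0 en ee hp dh') addr0.
exact: (centroid_eigen jordanA simpleA gp gM w0 gw).
Qed.
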